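(* Let $d \geq 2$, $T>0$, $k \in \mathbb{N}$, $\alpha\in(0,1)$, and let $u \in C^k([0,T], C^\alpha(\mathbb{T}^d,\mathbb{R}^d))$ be a velocity field with $\operatorname{div} u(t,\cdot) = 0$ in the sense of distributions for every $t\in[0,T]$ and without any measure-preserving selection of characteristics. Let $\{\chi^\delta\}_{\delta \in (0,1)}$ be standard spatial mollifiers on $\mathbb{T}^d$, let $u^\delta := u \ast \chi^\delta$ (convolution in the space variable), and let $X^\delta : [0,T]\times\mathbb{T}^d \to \mathbb{T}^d$ be the unique solution of $$X^\delta(t,x) = x + \int_0^t u^\delta(s,X^\delta(s,x))\,ds, \quad x \in \mathbb{T}^d,\ t\in[0,T].$$ Then the family $\{X^\delta\}_{\delta \in (0,1)}$ is not strongly precompact in $L^1([0,T]\times\mathbb{T}^d)$.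
   Context: $\mathbb{T}^d := (\mathbb{R}/\mathbb{Z})^d$ is the $d$-dimensional torus and $\mathscr{L}^d$ is the Lebesgue measure on it. ODEs on the torus are understood modulo $\mathbb{Z}^d$, and $L^1$ convergence of $\mathbb{T}^d$-valued maps is understood with respect to the distance on $\mathbb{T}^d$. Standard mollifiers: $\chi^\delta$ is the periodization of $\delta^{-d}\chi(\cdot/\delta)$ for a fixed smooth, nonnegative, compactly supported $\chi$ on $\mathbb{R}^d$ with integral $1$. Definition. Given a measurable $u : [0,T]\times\mathbb{T}^d \to \mathbb{R}^d$ with $\operatorname{div} u(t,\cdot)=0$, a map $X : [0,T]\times \mathbb{T}^d \to \mathbb{T}^d$ is a measure-preserving selection of characteristics (for $u$) if: (i) for every $t \in [0,T]$, the map $X_t := X(t,\cdot)$ is Lebesgue measurable and $(X_t)_\sharp \mathscr{L}^d = \mathscr{L}^d$; (ii) for almost every $x \in \mathbb{T}^d$ the map $t \mapsto u(t,X(t,x))$ is in $L^1([0,T])$ and $X(t,x) = x + \int_0^t u(s,X(s,x))\,ds$ for every $t \in [0,T]$. *)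

(* Defs.v *)
From HB Require Import structures.
From mathcomp Require Import all_boot all_order all_algebra.
From mathcomp Require Import generic_quotient ring_quotient.
From mathcomp Require Import all_classical all_reals all_analysis.
From mathcomp Require Import measurable_realfun.

Set Implicit Arguments.
Unset Strict Implicit.
Unset Printing Implicit Defensive.

Import Order.TTheory GRing.Theory Num.Theory.
Import numFieldNormedType.Exports.

Local Open Scope classical_set_scope.
Local Open Scope ring_scope.

(* The sigma-algebra on R^n generated by the coordinates, i.e. the Borel one. *)
Definition rV_display : measure_display -> measure_display.
Proof. exact. Qed.

Section measurable_rV.
Context {d} {T : measurableType d} (n : nat).

Let coors : 'I_n -> 'rV[T]_n -> T := fun i x => x ord0 i.

Let rV_set0 : g_sigma_preimage coors set0.
Proof. exact: sigma_algebra0. Qed.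

Let rV_setC A : g_sigma_preimage coors A -> g_sigma_preimage coors (~` A).
Proof. exact: sigma_algebraC. Qed.

Let rV_bigcup (F : _^nat) : (forall i, g_sigma_preimage coors (F i)) ->
  g_sigma_preimage coors (\bigcup_i (F i)).
Proof. exact: sigma_algebra_bigcup. Qed.

HB.instance Definition _ := @isMeasurable.Build (rV_display d)
  'rV[T]_n (g_sigma_preimage coors) rV_set0 rV_setC rV_bigcup.

Lemma measurable_coord_rV (i : 'I_n) :
  measurable_fun [set: 'rV[T]_n] (fun x : 'rV[T]_n => x ord0 i).
Proof.
move=> _ Y mY; rewrite setTI; apply: sub_sigma_algebra => /=.
rewrite -bigcup_seq/=; exists i => /=; first by rewrite mem_index_enum.
by exists Y => //; rewrite setTI.
Qed.

Lemma measurable_fun_rV d1 (T1 : measurableType d1) (f : T1 -> 'rV[T]_n) :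
  (forall i, measurable_fun [set: T1] (fun x => f x ord0 i)) ->
  measurable_fun [set: T1] f.
Proof.
move=> mf.
move=> _ A mA; rewrite setTI.
suff /(_ A mA) : @measurable _ 'rV[T]_n `<=` [set B | measurable (f @^-1` B)].
  by [].
apply: smallest_sub.
  split=> [|B /= mB|F mF] /=; first by rewrite preimage_set0.
    by rewrite setTD preimage_setC; exact: measurableC.
  by rewrite preimage_bigcup; apply: bigcupT_measurable => k; exact: mF.
rewrite -bigcup_seq => _ [i _ [B mB <-]] /=.
by have := mf i measurableT B mB; rewrite !setTI.
Qed.

End measurable_rV.

Lemma sigma_finite_product d1 d2 (T1 : measurableType d1)
    (T2 : measurableType d2) (R : realType)
    (m1 : {sigma_finite_measure set T1 -> \bar R})
    (m2 : {sigma_finite_measure set T2 -> \bar R}) :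
  sigma_finite setT (m1 \x m2)%E.
Proof.
have /sigma_finiteP[F [TF ndF Foo]] := sigma_finiteT m1.
have /sigma_finiteP[G [TG ndG Goo]] := sigma_finiteT m2.
exists (fun n => F n `*` G n).
  rewrite -setXTT TF TG predeqE => -[x y]; split.
    move=> [/= [n _ Fnx] [k _ Gky]]; exists (maxn n k) => //; split.
    - by move: x Fnx; exact/subsetPset/ndF/leq_maxl.
    - by move: y Gky; exact/subsetPset/ndG/leq_maxr.
  by move=> [n _ []/= ? ?]; split; exists n.
move=> k; have [mF Fk] := Foo k; have [mG Gk] := Goo k.
split; first exact: measurableX.
by rewrite product_measure1E// lte_mul_pinfty// ge0_fin_numE.
Qed.

Section lebesgue_rV.
Variable R : realType.

Definition consrV n (z : measurableTypeR R * 'rV[R]_n) : 'rV[R]_n.+1 :=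
  \row_i (if unlift ord0 i is Some j then z.2 ord0 j else z.1).

Definition tailrV n (x : 'rV[R]_n.+1) : 'rV[R]_n :=
  \row_i x ord0 (lift ord0 i).

Lemma consrVK n (z : measurableTypeR R * 'rV[R]_n) :
  (consrV z ord0 ord0, tailrV (consrV z)) = z.
Proof.
case: z => a v; congr pair; first by rewrite mxE unlift_none.
by apply/rowP => i; rewrite !mxE liftK.
Qed.

Lemma measurable_consrV n : measurable_fun [set: _] (@consrV n).
Proof.
apply: measurable_fun_rV => i.
have -> : (fun z => consrV z ord0 i) =
    (fun z : measurableTypeR R * 'rV[R]_n =>
       if unlift ord0 i is Some j then z.2 ord0 j else z.1).
  by apply/funext => z; rewrite mxE.
case: unliftP => [j _|_]; last exact: measurable_fst.
exact: (measurableT_comp (measurable_coord_rV j) measurable_snd).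
Qed.

Lemma measurable_tailrV n : measurable_fun [set: _] (@tailrV n).
Proof.
apply: measurable_fun_rV => i.
rewrite (_ : (fun _ => _) = (fun x : 'rV[R]_n.+1 => x ord0 (lift ord0 i))).
  exact: measurable_coord_rV.
by apply/funext => x; rewrite mxE.
Qed.

Section step.
Variables (n : nat) (m : {sigma_finite_measure set 'rV[R]_n -> \bar R}).

Definition lebesgue_step : set 'rV[R]_n.+1 -> \bar R :=
  pushforward (@lebesgue_measure R \x m)%E (@consrV n).

Let step0 : (lebesgue_step set0 = 0)%E.
Proof. by rewrite /lebesgue_step/pushforward preimage_set0 measure0. Qed.

Let step_ge0 A : (0 <= lebesgue_step A)%E.
Proof. by rewrite /lebesgue_step/pushforward; exact: measure_ge0. Qed.

Let step_sigma_additive : semi_sigma_additive lebesgue_step.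
Proof.
by apply: measure_semi_sigma_additive; exact: measurable_consrV.
Qed.

HB.instance Definition _ := isMeasure.Build _ _ _ lebesgue_step
  step0 step_ge0 step_sigma_additive.

Let step_sigma_finite : sigma_finite setT lebesgue_step.
Proof.
have [F FT mF] := sigma_finite_product (@lebesgue_measure R) m.
pose g (x : 'rV[R]_n.+1) : measurableTypeR R * 'rV[R]_n :=
  (x ord0 ord0, tailrV x).
have mg : measurable_fun setT g.
  apply/measurable_fun_pair; [exact: measurable_coord_rV|].
  exact: measurable_tailrV.
exists (fun k => g @^-1` F k).
  by rewrite -preimage_bigcup -FT preimage_setT.
move=> k; have [mFk Fkoo] := mF k; split.
  by rewrite -[X in measurable X]setTI; exact: mg.
rewrite /lebesgue_step /pushforward -comp_preimage.
by rewrite (_ : g \o _ = id) ?preimage_id//; apply/funext => z /=; exact: consrVK.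
Qed.

HB.instance Definition _ :=
  @Measure_isSigmaFinite.Build _ _ _ lebesgue_step step_sigma_finite.
End step.

(* Lebesgue measure on R^n (on Borel sets), as an iterated product measure. *)
Fixpoint lebesgue_rV n : {sigma_finite_measure set 'rV[R]_n -> \bar R} :=
  match n with
  | 0%N => \d_ (0 : 'rV[R]_0)
  | n'.+1 => lebesgue_step (lebesgue_rV n')
  end.

Arguments lebesgue_rV : clear implicits.

Definition unit_cube n := [set x : 'rV[R]_n | forall i, 0 <= x ord0 i < 1].
Arguments unit_cube : clear implicits.

Lemma measurable_unit_cube n : measurable (unit_cube n).
Proof.
rewrite (_ : unit_cube n =
  \bigcap_(i in [set: 'I_n]) ((fun x => x ord0 i) @^-1` `[0, 1[)).
  apply: fin_bigcap_measurable => // i _; rewrite -[X in measurable X]setTI.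
  exact: measurable_coord_rV.
by apply/seteqP; split=> [x xI i _|x xI i]; have := xI i; rewrite /= in_itv//=;
  apply.
Qed.

Lemma lebesgue_unit_cube n : (lebesgue_rV n (unit_cube n) = 1)%E.
Proof.
elim: n => [|n IH].
  by rewrite /= diracE mem_set//= => -[].
rewrite /= /lebesgue_step /pushforward.
rewrite (_ : _ @^-1` _ = `[0, 1[%classic `*` unit_cube n).
  rewrite product_measure1E//; last exact: measurable_unit_cube.
  rewrite IH mule1; have := @lebesgue_measure_itv R `[0, 1[.
  by rewrite /= lte01 sube0.
apply/seteqP; split=> [[a v] h|[a v] [/= h1 h2] i]; last first.
  rewrite !mxE; case: unliftP => [j _|_]; first exact: h2.
  by move: h1; rewrite in_itv.
split=> /=.
  by have := h ord0; rewrite !mxE unlift_none/= in_itv.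
by move=> i; have := h (lift ord0 i); rewrite !mxE liftK.
Qed.
End lebesgue_rV.
Arguments lebesgue_rV : clear implicits.
Arguments unit_cube : clear implicits.

Section torus.
Variables (R : realType) (d : nat).

Definition Zlattice : {pred 'rV[R]_d} := fun a => a \is a mxOver Num.int.

Let Zlattice_zmod : zmod_closed Zlattice.
Proof.
split; first by apply/mxOverP => i j; rewrite mxE rpred0.
move=> a b /mxOverP aZ /mxOverP bZ; apply/mxOverP => i j.
by rewrite !mxE rpredB ?aZ ?bZ.
Qed.

HB.instance Definition _ := GRing.isZmodClosed.Build _ Zlattice Zlattice_zmod.

(* The torus (R / Z)^d, as the quotient group R^d / Z^d. *)
Definition torus : Type := Quotient.quot Zlattice.
HB.instance Definition _ := GRing.Zmodule.on torus.
HB.instance Definition _ := isPointed.Build torus 0.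

Definition tproj (a : 'rV[R]_d) : torus := (\pi_(Quotient.quot Zlattice) a)%qT.

Lemma tprojD : {morph tproj : a b / a + b}.
Proof. by move=> a b; rewrite /tproj !piE. Qed.

Lemma tprojB : {morph tproj : a b / a - b}.
Proof. by move=> a b; rewrite /tproj !piE. Qed.

Lemma tproj_eq a b : tproj a = tproj b <-> a - b \in Zlattice.
Proof.
rewrite /tproj Quotient.idealrBE; split=> [->//|/eqP//].
Qed.

Lemma tproj_surj x : exists a, tproj a = x.
Proof. by exists (repr x); rewrite /tproj reprK. Qed.

(* Borel sets of the torus: those whose preimage in R^d is Borel. *)
Let torus_set0 : measurable (tproj @^-1` set0).
Proof. by rewrite preimage_set0. Qed.

Let torus_setC (A : set torus) :
  measurable (tproj @^-1` A) -> measurable (tproj @^-1` (~` A)).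
Proof. by move=> mA; rewrite preimage_setC; exact: measurableC. Qed.

Let torus_bigcup (F : (set torus)^nat) :
  (forall i, measurable (tproj @^-1` F i)) ->
  measurable (tproj @^-1` (\bigcup_i F i)).
Proof. by move=> mF; rewrite preimage_bigcup; exact: bigcupT_measurable. Qed.

HB.instance Definition _ := @isMeasurable.Build default_measure_display torus
  [set A : set torus | measurable (tproj @^-1` A)]
  torus_set0 torus_setC torus_bigcup.

Lemma measurable_tproj : measurable_fun [set: 'rV[R]_d] tproj.
Proof. by move=> _ A mA; rewrite setTI. Qed.

Definition lebesgue_torus (A : set torus) : \bar R :=
  lebesgue_rV R d (tproj @^-1` A `&` unit_cube R d).

Let lebesgue_torus0 : lebesgue_torus set0 = 0%E.
Proof. by rewrite /lebesgue_torus preimage_set0 set0I measure0. Qed.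

Let lebesgue_torus_ge0 A : (0 <= lebesgue_torus A)%E.
Proof. exact: measure_ge0. Qed.

Let lebesgue_torus_sigma_additive : semi_sigma_additive lebesgue_torus.
Proof.
move=> F mF tF mUF; rewrite /lebesgue_torus preimage_bigcup setI_bigcupl.
apply: measure_semi_sigma_additive.
- by move=> k; apply: measurableI; [exact: mF|exact: measurable_unit_cube].
- move/trivIsetP : tF => tF; apply/trivIsetP => i j _ _ ij.
  by rewrite setIACA setIid -preimage_setI (tF i j)// preimage_set0 set0I.
- rewrite -setI_bigcupl -preimage_bigcup.
  by apply: measurableI; [exact: mUF|exact: measurable_unit_cube].
Qed.

HB.instance Definition _ := isMeasure.Build _ _ _ lebesgue_torus
  lebesgue_torus0 lebesgue_torus_ge0 lebesgue_torus_sigma_additive.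

Let lebesgue_torusT : lebesgue_torus setT = 1%E.
Proof. by rewrite /lebesgue_torus preimage_setT setTI lebesgue_unit_cube. Qed.

HB.instance Definition _ :=
  @Measure_isProbability.Build _ _ _ lebesgue_torus lebesgue_torusT.

(* Distance induced by the norm of ['rV[R]_d], which is the max norm. *)
Definition torus_norm (z : torus) : R :=
  inf [set `|a| | a in [set a : 'rV[R]_d | tproj a = z]].

Definition torus_dist (x y : torus) : R := torus_norm (x - y).

Let norm_set_lb z :
  lbound [set `|a| | a in [set a : 'rV[R]_d | tproj a = z]] 0.
Proof. by move=> _ [a _ <-]. Qed.

Let norm_set_neq0 z :
  [set `|a| | a in [set a : 'rV[R]_d | tproj a = z]] !=set0.
Proof. by have [a <-] := tproj_surj z; exists `|a|, a. Qed.

Let norm_set_inf z :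
  has_inf [set `|a| | a in [set a : 'rV[R]_d | tproj a = z]].
Proof. by split; [exact: norm_set_neq0|exists 0; exact: norm_set_lb]. Qed.

Lemma torus_norm_ge0 z : 0 <= torus_norm z.
Proof. by apply: lb_le_inf; [exact: norm_set_neq0|exact: norm_set_lb]. Qed.

Lemma torus_norm_le a : torus_norm (tproj a) <= `|a|.
Proof. by apply: ge_inf; [exact: (norm_set_inf _).2|exists a]. Qed.

Lemma torus_norm_ltP z e :
  torus_norm z < e <-> exists2 a, tproj a = z & `|a| < e.
Proof.
split=> [/(inf_lt (norm_set_neq0 z))[_ [a az <-]]|[a <-]]; first by exists a.
by apply: le_lt_trans; exact: torus_norm_le.
Qed.

Lemma torus_normN z : torus_norm (- z) = torus_norm z.
Proof.
have h x : torus_norm (- x) <= torus_norm x.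
  apply/ler_addgt0Pr => e e0.
  have /torus_norm_ltP[a <- ae] : torus_norm x < torus_norm x + e.
    by rewrite ltrDl.
  have -> : - tproj a = tproj (- a) by rewrite /tproj !piE.
  by rewrite (le_trans (torus_norm_le _))// normrN ltW.
by apply/eqP; rewrite eq_le h -{1}[z]opprK h.
Qed.

Lemma torus_normD x y : torus_norm (x + y) <= torus_norm x + torus_norm y.
Proof.
apply/ler_addgt0Pr => e e0.
have ex_repr z : exists2 a, tproj a = z & `|a| < torus_norm z + e / 2.
  by apply/torus_norm_ltP; rewrite ltrDl divr_gt0.
have [[a ax ae] [b by_ be]] := (ex_repr x, ex_repr y).
rewrite -ax -by_ -tprojD ax by_ (le_trans (torus_norm_le _))//.
by rewrite (le_trans (ler_normD _ _))// (splitr e) addrACA lerD// ltW.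
Qed.

Lemma torus_dist_ge0 x y : 0 <= torus_dist x y.
Proof. exact: torus_norm_ge0. Qed.

Lemma torus_distxx x : torus_dist x x = 0.
Proof.
apply/eqP; rewrite eq_le torus_dist_ge0 andbT /torus_dist subrr.
have <- : tproj 0 = 0 by rewrite /tproj !piE.
by apply: le_trans (torus_norm_le 0) _; rewrite normr0.
Qed.

Lemma torus_distC x y : torus_dist x y = torus_dist y x.
Proof. by rewrite /torus_dist -torus_normN opprB. Qed.

Lemma torus_distD y x z : torus_dist x z <= torus_dist x y + torus_dist y z.
Proof. by rewrite /torus_dist -(subrKA y) torus_normD. Qed.

Let measurable_norm_rV : measurable_fun [set: 'rV[R]_d] (fun a => `|a| : R).
Proof.
have -> : (fun a : 'rV[R]_d => `|a| : R) =
    (fun a => \big[Num.max/0]_ij `|a ij.1 ij.2|).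
  by apply/funext => a; rewrite -mx_normrE.
elim: (index_enum _) => [|ij s IH].
  by under eq_fun do rewrite big_nil; exact: measurable_cst.
under eq_fun do rewrite big_cons.
apply: measurable_maxr => //; rewrite (ord1 ij.1).
exact: (measurableT_comp (@normr_measurable _ _) (measurable_coord_rV ij.2)).
Qed.

Lemma measurable_torus_norm : measurable_fun [set: torus] torus_norm.
Proof.
move=> mT; apply: (measurability _ (RGenInftyO.measurableE R)) => //.
move=> _ [_ [c ->] <-]; rewrite setTI.
rewrite /measurable/= (_ : _ @^-1` _ = \bigcup_(k in [set: 'rV[int]_d])
    [set a | `|a + map_mx intr k| < c]).
  apply: countable_bigcupT_measurable => // k.
  rewrite -preimage_itvNyo -[X in measurable X]setTI.
  apply: (measurableT_comp measurable_norm_rV) => //.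
  apply: measurable_fun_rV => i; under eq_fun do rewrite !mxE.
  by apply: measurable_funD => //; exact: measurable_coord_rV.
apply/seteqP; split=> a /=; rewrite in_itv/=.
  move=> /torus_norm_ltP[b /tproj_eq ba bc].
  exists (map_mx Num.floor (b - a)) => //=.
  suff <- : b - a = map_mx intr (map_mx Num.floor (b - a)) by rewrite subrKC.
  by apply/matrixP => i j; rewrite [RHS]mxE [X in _ = X%:~R]mxE floorK// (mxOverP ba).
move=> [k _ /= akc]; apply/torus_norm_ltP; exists (a + map_mx intr k) => //.
apply/tproj_eq; rewrite addrAC subrr add0r.
by apply/mxOverP => i j; rewrite mxE intr_int.
Qed.

Definition tlift (x : torus) : 'rV[R]_d :=
  \row_i (repr x ord0 i - (Num.floor (repr x ord0 i))%:~R).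

Lemma tliftK : cancel tlift tproj.
Proof.
move=> x; rewrite -[RHS]reprK; apply/tproj_eq; apply/mxOverP => i j.
by rewrite (ord1 i) !mxE addrAC subrr add0r rpredN intr_int.
Qed.

Lemma measurable_tlift : measurable_fun [set: torus] tlift.
Proof.
move=> _ A mA; rewrite setTI /measurable/= -comp_preimage -[X in measurable X]setTI.
move: A mA; suff h : measurable_fun [set: 'rV[R]_d] (tlift \o tproj).
  by move=> A mA; exact: h.
apply: measurable_fun_rV => i.
have -> : (fun a => (tlift \o tproj) a ord0 i) =
    (fun a : 'rV[R]_d => a ord0 i - (Num.floor (a ord0 i))%:~R).
  apply/funext => a /=; rewrite !mxE; set b := repr _.
  have /tproj_eq/mxOverP/(_ ord0 i) : tproj b = tproj a by rewrite /tproj reprK.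
  rewrite !mxE => /intrP[m bam].
  have -> : b ord0 i = a ord0 i + m%:~R by rewrite -bam addrCA subrr addr0.
  by rewrite floorDrz ?intr_int// intrKfloor intrD opprD addrACA subrr addr0.
apply: measurable_funB; first exact: measurable_coord_rV.
have mfloor : measurable_fun [set: R] (fun r : R => (Num.floor r)%:~R : R).
  by apply: nondecreasing_measurable => // x y xy; rewrite ler_int le_floor.
exact: (measurableT_comp mfloor (measurable_coord_rV i)).
Qed.

Lemma measurable_torus_dist d1 (T : measurableType d1) (f g : T -> torus) :
  measurable_fun [set: T] f -> measurable_fun [set: T] g ->
  measurable_fun [set: T] (fun z => torus_dist (f z) (g z)).
Proof.
move=> mf mg; rewrite /torus_dist.
apply: (measurableT_comp measurable_torus_norm).
have -> : (fun z => f z - g z) = (fun z => tproj (tlift (f z) - tlift (g z))).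
  by apply/funext => z; rewrite tprojB !tliftK.
apply: (measurableT_comp measurable_tproj).
apply: measurable_fun_rV => i.
have -> : (fun z => (tlift (f z) - tlift (g z)) ord0 i) =
    (fun z => tlift (f z) ord0 i - tlift (g z) ord0 i).
  by apply/funext => z; rewrite mxE [X in _ + X]mxE.
apply: measurable_funB.
- apply: (measurableT_comp (measurable_coord_rV i)).
  exact: (measurableT_comp measurable_tlift).
- apply: (measurableT_comp (measurable_coord_rV i)).
  exact: (measurableT_comp measurable_tlift).
Qed.

End torus.

Arguments lebesgue_torus : clear implicits.

Section L1_maps.
Variables (R : realType) (d : nat).

(* Maps on [0, T] x torus, given by a representative on R x torus; only the
   values on [0, T] enter the (pseudo)distance. *)
Definition L1_maps (T : R) : Type :=
  {mfun (measurableTypeR R * torus R d)%type >-> torus R d}.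

Variable T : R.
HB.instance Definition _ := gen_eqMixin (L1_maps T).
HB.instance Definition _ := gen_choiceMixin (L1_maps T).

Coercion fun_of_L1_maps (f : L1_maps T) : R * torus R d -> torus R d :=
  @MeasurableFun.sort _ _ _ _ f.

Definition L1_dist (f g : L1_maps T) : \bar R :=
  (\int[(@lebesgue_measure R \x lebesgue_torus R d)]_(z in `[0%R, T] `*` setT)
    (torus_dist (f z) (g z))%:E)%E.

Definition L1_ball (f : L1_maps T) (e : R) : set (L1_maps T) :=
  [set g | (L1_dist f g < e%:E)%E].

Let ent : set_system (L1_maps T * L1_maps T) := entourage_ L1_ball.
Let nbhs_L1 (f : L1_maps T) : set_system (L1_maps T) := nbhs_ ent f.
Let nbhs_L1E : nbhs_L1 = nbhs_ ent. Proof. by []. Qed.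
Let entE : ent = entourage_ L1_ball. Proof. by []. Qed.

HB.instance Definition _ := hasNbhs.Build (L1_maps T) nbhs_L1.

Let L1_ball_center (f : L1_maps T) e : 0 < e -> L1_ball f e f.
Proof.
move=> e0; rewrite /L1_ball/= /L1_dist integral0_eq ?lte_fin// => z _.
by rewrite torus_distxx.
Qed.

Let L1_ball_sym (f g : L1_maps T) e : L1_ball f e g -> L1_ball g e f.
Proof.
rewrite /L1_ball/= /L1_dist.
by under eq_integral do rewrite torus_distC.
Qed.

Let measurable_dist (f g : L1_maps T) :
  measurable_fun (`[0, T] `*` setT)
    (fun z : measurableTypeR R * torus R d => (torus_dist (f z) (g z))%:E).
Proof.
apply: measurable_funTS; apply/measurable_EFinP.
apply: measurable_torus_dist.
  exact: (@measurable_funPT _ _ _ _ f).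
exact: (@measurable_funPT _ _ _ _ g).
Qed.

Let L1_ball_triangle (f g h : L1_maps T) e1 e2 :
  L1_ball f e1 g -> L1_ball g e2 h -> L1_ball f (e1 + e2) h.
Proof.
rewrite /L1_ball/= => fg gh; rewrite EFinD.
apply: le_lt_trans (lteD fg gh).
have mD : measurable (`[0, T] `*` setT : set (measurableTypeR R * torus R d)).
  exact: measurableX.
have dist0 (u v : L1_maps T) z : (0 <= (torus_dist (u z) (v z))%:E)%E.
  by rewrite lee_fin torus_dist_ge0.
rewrite /L1_dist -(ge0_integralD _ mD _ (measurable_dist f g) _
  (measurable_dist g h))//.
apply: ge0_le_integral => //; first exact: measurable_dist.
  by apply: emeasurable_funD; exact: measurable_dist.
by move=> z _; rewrite -EFinD lee_fin torus_distD.
Qed.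

HB.instance Definition _ := @Nbhs_isPseudoMetric.Build R (L1_maps T)
  ent nbhs_L1E L1_ball L1_ball_center L1_ball_sym L1_ball_triangle entE.
End L1_maps.
Arguments L1_maps : clear implicits.

Section fields.
Variables (R : realType) (d : nat).

Definition partial_rV (i : 'I_d) (f : 'rV[R]_d -> R) : 'rV[R]_d -> R :=
  'D_(delta_mx ord0 i) f.

Fixpoint Ck_rV (n : nat) (f : 'rV[R]_d -> R) : Prop :=
  continuous f /\
  if n is n'.+1 then
    forall i, (forall x, derivable f x (delta_mx ord0 i)) /\ Ck_rV n' (partial_rV i f)
  else True.

Definition smooth_rV (f : 'rV[R]_d -> R) := forall n, Ck_rV n f.

(* The gradient of [phi : torus R d -> R] at [x] is that of the periodic
   function [phi \o tproj] at any representative of [x]. *)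
Definition torus_partial (i : 'I_d) (phi : torus R d -> R) (x : torus R d) : R :=
  partial_rV i (phi \o @tproj R d) (repr x).

Definition weakly_divergence_free (v : torus R d -> 'rV[R]_d) :=
  forall phi : torus R d -> R, smooth_rV (phi \o @tproj R d) ->
  (\int[lebesgue_torus R d]_x
    (\sum_(i < d) v x ord0 i * torus_partial i phi x)%:E = 0)%E.

(* The diagonal contributes 0 to the seminorm, since [0 / 0 = 0]. *)
Definition holder_norm (alpha : R) (v : torus R d -> 'rV[R]_d) : \bar R :=
  (ereal_sup (range (fun x => `|v x|%:E)) +
   ereal_sup (range (fun p : torus R d * torus R d =>
     (`|v p.1 - v p.2| / torus_dist p.1 p.2 `^ alpha)%:E)))%E.

Definition continuous_holder (alpha T : R) (u : R -> torus R d -> 'rV[R]_d) :=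
  forall t : R, 0 <= t <= T ->
  holder_norm alpha (fun x => u s x - u t x) @[s --> within `[0, T] (nbhs t)]
    --> 0%E.

Definition derivative_holder (alpha T : R) (u v : R -> torus R d -> 'rV[R]_d) :=
  forall t : R, 0 <= t <= T ->
  holder_norm alpha (fun x => (s - t)^-1 *: (u s x - u t x) - v t x)
    @[s --> within `[0, T] t^'] --> 0%E.

(* C^k([0, T], C^alpha), with one-sided derivatives at the end points. *)
Fixpoint Ck_holder (k : nat) (alpha T : R) (u : R -> torus R d -> 'rV[R]_d)
    : Prop :=
  (forall t : R, 0 <= t <= T -> (holder_norm alpha (u t) < +oo)%E) /\
  continuous_holder alpha T u /\
  if k is k'.+1 then
    exists v, derivative_holder alpha T u v /\ Ck_holder k' alpha T v
  else True.

Definition mollifier (chi : 'rV[R]_d -> R) :=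
  [/\ smooth_rV chi, forall a, 0 <= chi a,
      compact (closure [set a | chi a != 0]) &
      (\int[lebesgue_rV R d]_a (chi a)%:E = 1)%E].

(* Periodization of [delta^-d chi (. / delta)]: the sum over all representatives
   of [y], finitely supported because [chi] has compact support. *)
Definition torus_mollifier (chi : 'rV[R]_d -> R) (delta : R) (y : torus R d) : R :=
  \sum_(a \in [set a : 'rV[R]_d | tproj a = y]) delta ^- d * chi (delta^-1 *: a).

Definition torus_conv (v : torus R d -> 'rV[R]_d) (rho : torus R d -> R)
    (x : torus R d) : 'rV[R]_d :=
  \row_i \int[lebesgue_torus R d]_y (v (x - y) ord0 i * rho y).

(* L^1([0, T]) is taken with respect to Lebesgue measurability, hence the
   completed measure; the equation holds in the torus, i.e. modulo Z^d. *)
Definition characteristic (T : R) (u : R -> torus R d -> 'rV[R]_d)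
    (x : torus R d) (gamma : R -> torus R d) :=
  (forall i, (@completed_lebesgue_measure R).-integrable `[0, T]
    (fun s => (u s (gamma s) ord0 i)%:E)) /\
  forall t : R, 0 <= t <= T ->
    gamma t = x + tproj (\row_i
      \int[@completed_lebesgue_measure R]_(s in `[0, t]) u s (gamma s) ord0 i).

Definition completed_lebesgue_torus :=
  @completed_measure_extension _ _ _ (lebesgue_torus R d).

(* [X t] is Lebesgue measurable: preimages of Borel sets are measurable for the
   completion of [lebesgue_torus]. *)
Definition measure_preserving_selection (T : R)
    (u : R -> torus R d -> 'rV[R]_d) (X : R -> torus R d -> torus R d) :=
  (forall t : R, 0 <= t <= T ->
     measurable_fun [set: caratheodory_type ((lebesgue_torus R d)^*)%mu] (X t) /\
     forall B : set (torus R d), measurable B ->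
       pushforward completed_lebesgue_torus (X t) B = lebesgue_torus R d B) /\
  {ae lebesgue_torus R d, forall x, characteristic T u x (X ^~ x)}.

End fields.

(* Main.v *)
Require Import Defs.
From mathcomp Require Import all_boot all_order all_algebra.
From mathcomp Require Import generic_quotient ring_quotient.
From mathcomp Require Import all_classical all_reals all_analysis.
From mathcomp Require Import measurable_realfun zify ring lra.
Import Order.TTheory GRing.Theory Num.Theory.
Import numFieldNormedType.Exports.

Set Implicit Arguments.
Unset Strict Implicit.
Unset Printing Implicit Defensive.

Local Open Scope classical_set_scope.
Local Open Scope ring_scope.

(* If the X^delta were precompact, a sequence delta_k -> 0 would give L^1, and after
   extraction almost everywhere, convergence of X^(delta_k) to some f. For almost
   every x the velocities u^(delta_k)(s, X^(delta_k)(s, x)) then converge to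
   u(s, f(s, x)) for almost every s, because u^delta -> u uniformly and u is
   continuous. By dominated convergence the curves X^(delta_k)(., x) converge at
   every time to a characteristic Y(., x) of u. Each X^(delta_k)(t, .) preserves the
   Lebesgue measure, hence so does Y(t, .), and Y is a measure-preserving selection.

   That the mollified flow preserves the measure is proved without a change of
   variables formula. For a solenoidal field v and a C^{1,1} function psi, one Euler
   step satisfies |int psi (x + h v(x)) dx - int psi| = O(h^2), by a discrete
   integration by parts. The step also preserves the C^{1,1} bounds up to a factor
   1 + O(h), so the n steps of size t / n change the integral by O(1 / n) only, while
   the Euler scheme converges uniformly to the flow. *)

(** * Affine maps and periodization *)

(** Nothing is assumed on the measurability of [X delta]: each curve is only known to be a
    characteristic. The Euler scheme therefore has a second use, it makes every [X delta t]
    measurable in [x]. Lipschitz continuity in time then gives joint measurability, and the flows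
    become elements of [L1_maps]. The divergence condition is distributional. It acts on the
    mollified field through the test functions [y |-> rho (x - y)], which say that the derivative
    matrix of the convolution has trace zero; the Euler step uses it in this form. Preservation of
    the measure is tested on Lipschitz functions. By mollification they are uniform limits of
    C^{1,1} functions, their integrals pass to pointwise limits of flows, and they determine a
    finite Borel measure because the distance to the complement of an open set is Lipschitz. The
    null set of times at which the extracted sequence may fail to converge depends on the starting
    point; Tonelli's theorem makes it null for almost every point. *)

Section affine.
Variable R : realType.
Implicit Types c e : R.

(** The pushforward of Lebesgue measure by the affine map, scaled by [|e|], has the right values on
    half-open intervals, and these values determine Lebesgue measure. *)
Lemma lebesgue_measure_affine c e (A : set (measurableTypeR R)) :
  e != 0 -> measurable A ->
  (lebesgue_measure ((fun x => c + e * x)%R @^-1` A) =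
     `|e|^-1%R%:E * lebesgue_measure A)%E.
Proof.
move=> e0 mA; have ne0 : `|e| != 0 by rewrite normr_eq0.
pose f : measurableTypeR R -> measurableTypeR R := fun x => c + e * x.
have mf : measurable_fun setT f.
  by apply: measurable_funD => //; exact: measurable_funM.
pose m := mscale (NngNum (normr_ge0 e))
  (measure_function_pushforward__canonical__measure_function_Measure
    (@lebesgue_measure R) mf).
suff -> : lebesgue_measure A = m A.
  by rewrite /m /mscale /= muleA -EFinM mulVf// mul1e.
apply: lebesgue_measure_unique => // _ [[a b] _ <-].
rewrite [RHS](_ : _ = `|e|%:E * lebesgue_measure (f @^-1` `]a, b]))%E//.
rewrite lebesgue_measure_itv /=.
have [ep|en|/eqP] := ltgtP 0 e; last by rewrite eq_sym (negPf e0).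
- have -> : f @^-1` `]a, b] = `](a - c) / e, (b - c) / e]%classic.
    apply/seteqP; split => x; rewrite /f /= !in_itv/=;
    by rewrite ltr_pdivrMr// ler_pdivlMr// ltrBlDl lerBrDl (mulrC x).
  rewrite lebesgue_measure_itv/= !lte_fin ltr_pM2r ?invr_gt0// ltrD2r.
  case: ifPn => _; last by rewrite mule0.
  rewrite -!EFinD -EFinM gtr0_norm//; congr (_%:E).
  by field; rewrite gt_eqF.
(* A negative slope exchanges the end points and moves the closed end, which does not change the
   length. *)
- have -> : f @^-1` `]a, b] = `[(b - c) / e, (a - c) / e[%classic.
    apply/seteqP; split => x; rewrite /f /= !in_itv/=;
    by rewrite ler_ndivrMr// ltr_ndivlMr// ltrBlDl lerBrDl (mulrC x) andbC.
  rewrite lebesgue_measure_itv/= !lte_fin ltr_nM2r ?invr_lt0// ltrD2r.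
  case: ifPn => _; last by rewrite mule0.
  rewrite -!EFinD -EFinM ltr0_norm//; congr (_%:E).
  by field; rewrite lt_eqF.
Qed.

Lemma measurable_affine_rV n (c : 'rV[R]_n) e :
  measurable_fun [set: 'rV[R]_n] (fun x => c + e *: x).
Proof.
apply: measurable_fun_rV => i.
under eq_fun do rewrite !mxE.
apply: measurable_funD => //; apply: measurable_funM => //.
exact: measurable_coord_rV.
Qed.

(** Induction on the dimension: the sections carry [n] of the factors, the first coordinate carries
    the last one. The slope is [-1] for reflections of the torus, [1] for lattice shifts and
    [delta^-1] for mollifiers. *)
Lemma lebesgue_rV_affine n (c : 'rV[R]_n) e (A : set 'rV[R]_n) :
  e != 0 -> measurable A ->
  (lebesgue_rV R n ((fun x => c + e *: x)%R @^-1` A) =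
     (`|e|^-1 ^+ n)%R%:E * lebesgue_rV R n A)%E.
Proof.
move=> e0; elim: n => [|n IH] in c A *.
  move=> mA /=; rewrite expr0 mul1e !diracE; congr ((nat_of_bool _)%:R%:E).
  apply: asbool_equiv_eq; rewrite /preimage /=.
  by rewrite (_ : c + _ = 0)//; apply/rowP => -[].
move=> mA; rewrite /= /lebesgue_step /pushforward /product_measure1.
set B := @consrV R n @^-1` A.
have mB : measurable B.
  by rewrite -[X in measurable X]setTI; exact: measurable_consrV.
have me : (0 <= `|e|^-1) by rewrite invr_ge0.
transitivity (\int[@lebesgue_measure R]_x
    ((`|e|^-1 ^+ n)%R%:E * (lebesgue_rV R n \o xsection B) (c ord0 ord0 + e * x)%R))%E.
  apply: eq_integral => x _ /=.
  rewrite -(IH (tailrV c)); last exact: measurable_xsection.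
  congr (lebesgue_rV R n _); apply/seteqP; split => v /=;
    rewrite /xsection /B /= !inE /preimage /=;
    (rewrite (_ : consrV (_, _) = c + e *: consrV (x, v))//;
     apply/rowP => i; rewrite !mxE; case: unliftP => [j ->|->];
     by rewrite ?mxE).
rewrite ge0_integralZl//; last first.
  apply: (@measurableT_comp _ _ _ _ _ _ (lebesgue_rV R n \o xsection B)).
    exact: measurable_fun_xsection.
  by apply: measurable_funD => //; exact: measurable_funM.
rewrite exprS (mulrC `|e|^-1) EFinM -muleA; congr (_ * _)%E.
have mF := measurable_fun_xsection (lebesgue_rV R n) mB.
pose f : measurableTypeR R -> measurableTypeR R := fun x => c ord0 ord0 + e * x.
have mf : measurable_fun setT f.
  by apply: measurable_funD => //; exact: measurable_funM.
have := @ge0_integral_pushforward _ _ _ _ R f mf (@lebesgue_measure R) setT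
  (lebesgue_rV R n \o xsection B) measurableT mF (fun y _ => measure_ge0 _ _).
rewrite preimage_setT => <-.
rewrite -(ge0_integral_mscale _ _ (NngNum me))//.
apply: eq_measure_integral => //.
move=> D mD _; rewrite /mscale/= /pushforward.
exact: lebesgue_measure_affine.
Qed.
End affine.

Section affine_integral.
Variable R : realType.

Lemma ge0_integral_rV_affine n (c : 'rV[R]_n) (e : R) (g : 'rV[R]_n -> \bar R) :
  e != 0 -> measurable_fun setT g -> (forall x, (0 <= g x)%E) ->
  (\int[lebesgue_rV R n]_x g (c + e *: x)%R =
     (`|e|^-1 ^+ n)%R%:E * \int[lebesgue_rV R n]_x g x)%E.
Proof.
move=> e0 mg g0; have me : (0 <= `|e|^-1 ^+ n) by rewrite exprn_ge0// invr_ge0.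
have mf := @measurable_affine_rV R n c e.
have := @ge0_integral_pushforward _ _ _ _ R _ mf (lebesgue_rV R n) setT
  g measurableT mg (fun y _ => g0 y).
rewrite preimage_setT => <-.
rewrite -(ge0_integral_mscale _ _ (NngNum me))//.
apply: eq_measure_integral => //.
by move=> D mD _; rewrite /mscale/= /pushforward lebesgue_rV_affine.
Qed.

End affine_integral.

Section periodization.
Variables (R : realType) (d : nat).
Local Notation L := (lebesgue_torus R d).
Local Notation pi := (@tproj R d).

(** [lebesgue_torus] is the image under [tproj] of Lebesgue measure restricted to the unit cube, and
    the restricted measure vanishes off the cube. *)
Lemma ge0_integral_torus (h : torus R d -> \bar R) :
  measurable_fun setT h -> (forall y, (0 <= h y)%E) ->
  (\int[L]_y h y = \int[lebesgue_rV R d]_(a in unit_cube R d) h (pi a))%E.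
Proof.
move=> mh h0.
have mc := @measurable_unit_cube R d.
pose m := measure_function_mrestr__canonical__measure_function_Measure
  (lebesgue_rV R d) mc.
have := @ge0_integral_pushforward _ _ _ _ R _ (@measurable_tproj R d)
  m setT h measurableT mh (fun y _ => h0 y).
rewrite preimage_setT => h1; transitivity (\int[m]_x (h \o pi) x)%E.
  by rewrite -h1.
have mhp : measurable_fun setT (h \o pi).
  by apply: measurableT_comp => //; exact: measurable_tproj.
rewrite -(setUv (unit_cube R d)) ge0_integral_setU//=; last 3 first.
- exact: measurableC.
- exact: measurable_funTS.
- by apply/disj_setPS => x [].
rewrite [X in (_ + X)%E](_ : _ = 0%E) ?adde0.
  apply: eq_measure_integral => A mA AD.
  by rewrite /m/= /mrestr setIidl.
rewrite -[RHS](@integral_measure_zero _ _ R (~` unit_cube R d) (h \o pi)).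
apply: eq_measure_integral => A mA AD.
rewrite /m/= /mrestr (_ : A `&` _ = set0) ?measure0//.
by apply/seteqP; split => // x [/AD].
Qed.

Lemma tlift_tprojE (a : 'rV[R]_d) i : tlift (pi a) ord0 i = a ord0 i - (Num.floor (a ord0 i))%:~R.
Proof.
rewrite !mxE; set b := repr _.
have /tproj_eq/mxOverP/(_ ord0 i) : pi b = pi a by rewrite /tproj reprK.
rewrite !mxE => /intrP[m bam].
have -> : b ord0 i = a ord0 i + m%:~R by rewrite -bam addrCA subrr addr0.
by rewrite floorDrz ?intr_int// intrKfloor intrD opprD addrACA subrr addr0.
Qed.

Lemma tlift_cube y : unit_cube R d (tlift y).
Proof.
move=> i; rewrite -[y]tliftK tlift_tprojE.
have /andP[h1 h2] := floor_itv (tlift y ord0 i).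
by rewrite subr_ge0 h1/= ltrBlDl -[X in _ + X]/(1%:~R) -intrD.
Qed.

Lemma tprojK_cube a : unit_cube R d a -> tlift (pi a) = a.
Proof.
move=> ha; apply/rowP => i; rewrite tlift_tprojE.
have /andP[h1 h2] := ha i.
by rewrite (_ : Num.floor _ = 0) ?subr0//; apply/floor_def; rewrite h1 add0r.
Qed.

(** Integer vectors with entries in [-m, m), indexed by a finite type. For a function of bounded
    support they turn the sum over an infinite fibre into a finite sum. *)
Definition zshift (m : nat) (j : {ffun 'I_d -> 'I_(m.*2)}) : 'rV[R]_d :=
  \row_i ((j i)%:R - m%:R).

Lemma zshift_inj m : injective (@zshift m).
Proof.
move=> j k /rowP jk; apply/ffunP => i; apply/val_inj => /=.
by have := jk i; rewrite !mxE => /addIr/eqP; rewrite eqr_nat => /eqP.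
Qed.

Lemma zshift_Zlattice m j : @zshift m j \in @Zlattice R d.
Proof.
by apply/mxOverP => i k; rewrite !mxE rpredB// natr_int.
Qed.

Lemma tproj_zshift m j a : pi (a + @zshift m j) = pi a.
Proof. by apply/tproj_eq; rewrite addrAC subrr add0r zshift_Zlattice. Qed.

Lemma zshift_diffP (m : nat) (a b : 'rV[R]_d) : pi a = pi b ->
  (forall i, - m%:R <= a ord0 i - b ord0 i < m%:R) -> exists j, a = b + @zshift m j.
Proof.
move=> /tproj_eq/mxOverP abZ hab.
have /choice[k hk] : forall i, exists k : int, a ord0 i - b ord0 i = k%:~R.
  by move=> i; have := abZ ord0 i; rewrite mxE [X in _ + X]mxE => /intrP.
have hk2 i : - m%:Z <= k i < m%:Z.
  by have := hab i; rewrite hk pmulrn -intrN ler_int ltr_int.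
have hf i : (absz (k i + m%:Z)%R < m.*2)%N by have := hk2 i; lia.
exists [ffun i => Ordinal (hf i)]; apply/rowP => i.
rewrite [RHS]mxE mxE ffunE/= addrC -[LHS](subrK (b ord0 i)) hk; congr (_ + _).
have f1 : 0 <= k i + m%:Z by have := hk2 i; lia.
have -> : (absz (k i + m%:Z)%R)%:R = (k i + m%:Z)%:~R :> R.
  by rewrite -[in RHS](gez0_abs f1).
by rewrite intrD -pmulrn addrK.
Qed.

(** The difference is the floor of the coordinate, which can reach [-m] but not [m]; hence the
    half-open window. *)
Lemma sub_tlift_itv (m : nat) (a : 'rV[R]_d) i : `|a ord0 i| < m%:R ->
  - m%:R <= a ord0 i - tlift (pi a) ord0 i < m%:R.
Proof.
rewrite ltr_norml => /andP[h1 h2].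
rewrite tlift_tprojE opprB addrC subrK pmulrn -intrN ler_int ltr_int.
by rewrite floor_ge_int intrN -pmulrn ltW//= floor_lt_int -pmulrn.
Qed.

Lemma zshiftP (m : nat) (a : 'rV[R]_d) : (forall i, `|a ord0 i| < m%:R) ->
  exists j, a = tlift (pi a) + @zshift m j.
Proof.
move=> ha; apply: zshift_diffP => [|i]; first by rewrite tliftK.
exact: sub_tlift_itv.
Qed.

(** Here [c] is any representative, not only [tlift], which jumps: a finite sum that is smooth in
    [c] is what the smoothness of periodizations requires. *)
Lemma fiber_sumE (m : nat) (g : 'rV[R]_d -> R) (c : 'rV[R]_d) :
  (forall a : 'rV[R]_d, g a != 0 -> pi a = pi c ->
    forall i, - m%:R <= a ord0 i - c ord0 i < m%:R) ->
  \sum_(a \in [set a : 'rV[R]_d | pi a = pi c]) g a =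
  \sum_(j : {ffun 'I_d -> 'I_(m.*2)}) g (c + zshift j).
Proof.
move=> gs.
rewrite (@fsbigE _ _ _ _ _ [seq c + zshift j | j <- enum {ffun 'I_d -> 'I_(m.*2)}]).
- rewrite big_map big_enum_cond/=; apply: eq_bigl => j.
  by rewrite mem_set//= tproj_zshift.
- by rewrite map_inj_uniq ?enum_uniq// => j k /addrI/zshift_inj.
- by move=> _ /mapP[j _ ->]; rewrite /= tproj_zshift.
- move=> a /= ay; apply: contraNeq => /gs/(_ ay)/(zshift_diffP ay)[j ->].
  by apply: map_f; rewrite mem_enum.
Qed.

(* Unfolding: integrating over the torus the sum of [g] over the fibres of [tproj]
   is integrating [g] over R^d. *)
Lemma integral_zshift_sum (m : nat) (g : 'rV[R]_d -> R) :
  measurable_fun setT g -> (forall a, 0 <= g a) ->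
  (forall a : 'rV[R]_d, g a != 0 -> forall i, `|a ord0 i| < m%:R) ->
  (\int[L]_y (\sum_(j : {ffun 'I_d -> 'I_(m.*2)}) g (tlift y + zshift j))%:E =
   \int[lebesgue_rV R d]_a (g a)%:E)%E.
Proof.
move=> mg g0 gs.
have mgs j : measurable_fun setT (fun a : 'rV[R]_d => g (a + @zshift m j)).
  apply: measurableT_comp => //.
  under eq_fun do rewrite addrC -[X in _ + X]scale1r.
  exact: measurable_affine_rV.
have mI j : measurable_fun setT
    (fun a : 'rV[R]_d => g a * \1_(unit_cube R d) (- @zshift m j + 1 *: a)).
  apply: measurable_funM => //.
  have mc := @measurable_unit_cube R d.
  exact: (measurableT_comp (@measurable_indic _ _ R setT _ mc)
    (@measurable_affine_rV R d (- zshift j) 1)).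
under eq_integral do rewrite -sumEFin.
rewrite ge0_integral_sum//=; last 2 first.
- move=> j; apply/measurable_EFinP.
  apply: (measurableT_comp (mgs j)); exact: measurable_tlift.
- by move=> j x _; rewrite lee_fin.
(* Translating the [j]-th term replaces the unit cube by the cube shifted by [zshift j]. *)
transitivity (\sum_(j : {ffun 'I_d -> 'I_(m.*2)}) \int[lebesgue_rV R d]_a
   (g a * \1_(unit_cube R d) (- zshift j + 1 *: a))%R%:E)%E.
  apply: eq_bigr => j _.
  rewrite ge0_integral_torus; last 2 first.
  - apply/measurable_EFinP; apply: (measurableT_comp (mgs j)).
    exact: measurable_tlift.
  - by move=> y; rewrite lee_fin.
  have := @ge0_integral_rV_affine R d (@zshift m j) 1 (fun a =>
    (g a * \1_(unit_cube R d) (- zshift j + 1 *: a))%R%:E) (oner_neq0 _).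
  rewrite normr1 invr1 expr1n mul1e => <-; last 2 first.
  - exact/measurable_EFinP.
  - by move=> x; rewrite lee_fin mulr_ge0.
  rewrite integral_mkcond; apply: eq_integral => a _.
  rewrite patchE !scale1r addrA addNr add0r indicE.
  case: ifPn => ac; last by rewrite mulr0.
  by rewrite mulr1 tprojK_cube 1?addrC//; move: ac; rewrite inE.
rewrite -ge0_integral_sum//; last 2 first.
- by move=> j; exact/measurable_EFinP.
- by move=> j x _; rewrite lee_fin mulr_ge0.
apply: eq_integral => a _; rewrite sumEFin; congr _%:E.
(* Where [g] does not vanish, exactly one of the shifted cubes contains [a]. *)
have [->|ga] := eqVneq (g a) 0; first by rewrite big1// => j _; rewrite mul0r.
have [j0 aj0] := zshiftP (gs _ ga).
rewrite (bigD1 j0)//= big1 ?addr0.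
  rewrite scale1r {2}aj0 addrCA addNr addr0 indicE mem_set ?mulr1//.
  exact: tlift_cube.
move=> j jj0; rewrite indicE memNset ?mulr0//= => /tprojK_cube.
rewrite scale1r tprojD (_ : pi (- zshift j) = 0); last first.
  rewrite -[0](_ : pi 0 = 0); first by apply/tproj_eq; rewrite subr0 rpredN zshift_Zlattice.
  by rewrite /tproj piE.
rewrite add0r {2}aj0 addrCA -[LHS]addr0 => /addrI/eqP.
by rewrite eq_sym addrC subr_eq0 (inj_eq (@zshift_inj m)) eq_sym (negPf jj0).
Qed.

Lemma fiber_sum_tliftE (m : nat) (g : 'rV[R]_d -> R) (y : torus R d) :
  (forall a : 'rV[R]_d, g a != 0 -> forall i, `|a ord0 i| < m%:R) ->
  \sum_(a \in [set a : 'rV[R]_d | pi a = y]) g a =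
  \sum_(j : {ffun 'I_d -> 'I_(m.*2)}) g (tlift y + zshift j).
Proof.
move=> gs; rewrite -{1}[y]tliftK; apply: fiber_sumE => a /gs ga ay i.
by rewrite -[y]tliftK -ay; exact: sub_tlift_itv.
Qed.

End periodization.

(** * Translations and reflections of the torus *)

Section torus_invariance.
Variables (R : realType) (d : nat).
Local Notation L := (lebesgue_torus R d).
Local Notation pi := (@tproj R d).

Lemma rVBE (u v : 'rV[R]_d) i : (u - v) ord0 i = u ord0 i - v ord0 i.
Proof. by rewrite mxE [X in _ + X]mxE. Qed.

Lemma tproj0 : pi 0 = 0.
Proof. by rewrite /tproj piE. Qed.

Lemma tprojN a : pi (- a) = - pi a.
Proof. by rewrite /tproj piE. Qed.

Lemma measurable_torusB d1 (T : measurableType d1) (f g : T -> torus R d) :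
  measurable_fun setT f -> measurable_fun setT g ->
  measurable_fun setT (fun z => f z - g z).
Proof.
move=> mf mg.
have -> : (fun z => f z - g z) = (fun z => pi (tlift (f z) - tlift (g z))).
  by apply/funext => z; rewrite tprojB !tliftK.
apply: (measurableT_comp (@measurable_tproj R d)); apply: measurable_fun_rV => i.
have -> : (fun z => (tlift (f z) - tlift (g z)) ord0 i) =
    (fun z => tlift (f z) ord0 i - tlift (g z) ord0 i).
  by apply/funext => z; rewrite mxE [X in _ + X]mxE.
apply: measurable_funB;
  by apply: (measurableT_comp (measurable_coord_rV i));
     apply: (measurableT_comp (@measurable_tlift R d)).
Qed.

Lemma measurable_torusD d1 (T : measurableType d1) (f g : T -> torus R d) :
  measurable_fun setT f -> measurable_fun setT g ->
  measurable_fun setT (fun z => f z + g z).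
Proof.
move=> mf mg; under eq_fun do rewrite -[X in _ + X]opprK -[X in _ - X]sub0r.
by apply: measurable_torusB => //; exact: measurable_torusB.
Qed.

(** The reflected unit cube is again a fundamental domain of the lattice: every fibre of [tproj]
    meets it exactly once. Unfolding the indicator of [B] therefore gives the indicator of [A]. *)
Lemma lebesgue_torus_reflect (x : torus R d) (A : set (torus R d)) :
  measurable A -> L ((fun y => x - y) @^-1` A) = L A.
Proof.
move=> mA; rewrite {1}/lebesgue_torus; set c := tlift x.
pose T (a : 'rV[R]_d) := c + (-1) *: a.
pose B := pi @^-1` A `&` T @^-1` unit_cube R d.
have mT : measurable_fun setT T by exact: measurable_affine_rV.
have mB : measurable B.
  apply: measurableI; first exact: mA.
  by rewrite -[X in measurable X]setTI; apply: mT => //; exact: measurable_unit_cube.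
have TK a : T (T a) = a.
  by rewrite /T !scaleN1r opprD addrA subrr sub0r opprK.
have piT a : pi (T a) = x - pi a.
  by rewrite /T scaleN1r tprojD tprojN tliftK.
transitivity (lebesgue_rV R d (T @^-1` B)).
  congr (lebesgue_rV R d _); apply/seteqP; split => a /=;
  by rewrite /B /= TK piT.
rewrite lebesgue_rV_affine ?oppr_eq0// normrN1 invr1 expr1n mul1e.
have -> : lebesgue_rV R d B = (\int[lebesgue_rV R d]_a (\1_B a)%:E)%E.
  by rewrite integral_indic ?setIT.
(* The window 1 suffices: a point of [B] is the difference of two points of the unit cube, so its
   coordinates lie in (-1, 1). *)
rewrite -(@integral_zshift_sum R d 1%N); last 3 first.
- exact: measurable_indic.
- by [].
- move=> a; rewrite indicE; have [|_] := boolP (a \in B); last by rewrite eqxx.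
  rewrite inE /B/= => -[_ cu] _ i.
  have := cu i; have := tlift_cube x i; rewrite -/c /T scaleN1r.
  rewrite rVBE => /andP[? ?] /andP[? ?].
  by rewrite ltr_norml; apply/andP; split; lra.
have -> : L A = (\int[L]_y (\1_A y)%:E)%E by rewrite integral_indic ?setIT.
apply: eq_integral => y _; congr _%:E.
rewrite !indicE; have [yA|yA] := boolP (y \in A); last first.
  rewrite big1// => j _; rewrite indicE memNset//= => -[]/=.
  by rewrite tproj_zshift tliftK => yA'; rewrite mem_set in yA.
(* The only point over [y] that [T] sends into the unit cube. *)
pose a0 := T (tlift (x - y)).
have a0y : pi a0 = y by rewrite piT tliftK opprB addrC subrK.
have [j0 aj0] : exists j, a0 = tlift (pi a0) + @zshift R d 1 j.
  apply: zshiftP => i; rewrite /a0 /T scaleN1r rVBE.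
  have := tlift_cube x i; have := tlift_cube (x - y) i; rewrite -/c.
  by move=> /andP[? ?] /andP[? ?]; rewrite ltr_norml; apply/andP; split; lra.
rewrite a0y in aj0.
rewrite (bigD1 j0)//= big1 ?addr0.
  rewrite indicE mem_set// /B/= -aj0; split; first by rewrite /= a0y; move: yA; rewrite inE.
  by rewrite /= TK; exact: tlift_cube.
move=> j jj0; rewrite indicE memNset// /B /= => -[_ /tprojK_cube].
rewrite piT tproj_zshift tliftK => /(congr1 T); rewrite TK -/a0 aj0.
by move=> /addrI/zshift_inj j0j; rewrite j0j eqxx in jj0.
Qed.

Lemma integral_torus_reflect (x : torus R d) (h : torus R d -> \bar R) :
  measurable_fun setT h -> (\int[L]_y h (x - y)%R = \int[L]_y h y)%E.
Proof.
have mf : measurable_fun setT (fun y : torus R d => x - y).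
  exact: measurable_torusB.
have ge0 (k : torus R d -> \bar R) : measurable_fun setT k -> (forall y, (0 <= k y)%E) ->
    (\int[L]_y k (x - y)%R = \int[L]_y k y)%E.
  move=> mk k0.
  have := @ge0_integral_pushforward _ _ _ _ R _ mf L setT
    k measurableT mk (fun y _ => k0 y).
  rewrite preimage_setT => <-.
  by apply: eq_measure_integral => // A mA _; exact: lebesgue_torus_reflect.
move=> mh; rewrite integralE [RHS]integralE; congr (_ - _)%E.
  rewrite -(ge0 _ (measurable_funepos mh) (funepos_ge0 h)).
  by apply: eq_integral => y _; rewrite !funeposE.
rewrite -(ge0 _ (measurable_funeneg mh) (funeneg_ge0 h)).
by apply: eq_integral => y _; rewrite !funenegE.
Qed.

(** A translation is the composition of two reflections. *)
Lemma integral_torus_translate (x : torus R d) (h : torus R d -> \bar R) :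
  measurable_fun setT h -> (\int[L]_y h (x + y)%R = \int[L]_y h y)%E.
Proof.
move=> mh; rewrite -(integral_torus_reflect x mh).
rewrite -(@integral_torus_reflect 0 (fun y => h (x - y))).
  by apply: eq_integral => y _; rewrite sub0r opprK.
by apply: (measurableT_comp mh); exact: measurable_torusB.
Qed.

End torus_invariance.

(** * Borel sets of the torus *)

Section row_norm.
Variables (R : realType) (d : nat).
Implicit Types (a : 'rV[R]_d) (c : R).

Lemma rV_coord_le a i : `|a ord0 i| <= `|a|.
Proof.
rewrite {2}/Num.norm /= mx_normrE.
exact: (le_bigmax _ (fun ij : 'I_1 * 'I_d => `|a ij.1 ij.2|) (ord0, i)).
Qed.

Lemma rV_norm_le a c : 0 <= c -> (forall i, `|a ord0 i| <= c) -> `|a| <= c.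
Proof.
move=> c0 h; rewrite {1}/Num.norm /= mx_normrE.
by apply: bigmax_le => // -[i j] _ /=; rewrite (ord1 i).
Qed.
End row_norm.

Section measurable_continuous.

(** Countable gluing. Below, [q] is a rounding map or the membership test of a null set. *)
Lemma measurable_fun_pieces d1 d2 (T : measurableType d1) (S : measurableType d2)
    (C : countType) (q : T -> C) (F : C -> T -> S) :
  (forall k, measurable (q @^-1` [set k])) ->
  (forall k, measurable_fun setT (F k)) ->
  measurable_fun setT (fun z => F (q z) z).
Proof.
move=> mq mF _ Y mY; rewrite setTI.
rewrite (_ : _ @^-1` _ = \bigcup_k (q @^-1` [set k] `&` F k @^-1` Y)).
  apply: countable_bigcupT_measurable => // k; apply: measurableI => //.
  by rewrite -[X in measurable X]setTI; exact: mF.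
apply/seteqP; split => [z /= h|z [k _ [/= <- ]]//].
by exists (q z).
Qed.

Variables (R : realType) (d : nat).

(** The sigma-algebra is generated by the coordinates, not by the open sets. Rounding the argument
    down to the grid of mesh [1 / (m + 1)] gives functions with countably many values that converge
    to [f]. *)
Lemma measurable_continuous_rV (f : 'rV[R]_d -> R) :
  continuous f -> measurable_fun setT f.
Proof.
move=> cf.
pose q (m : nat) (x : 'rV[R]_d) : 'rV[int]_d :=
  map_mx (fun r : R => Num.floor (m.+1%:R * r)) x.
pose p (m : nat) (k : 'rV[int]_d) : 'rV[R]_d := m.+1%:R^-1 *: map_mx intr k.
apply: (@measurable_fun_cvg _ _ _ _ (fun m x => f (p m (q m x)))).
- move=> m; apply: (measurable_fun_pieces (F := fun k x => f (p m k))) => // k.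
  rewrite (_ : _ @^-1` _ = \bigcap_(i in [set: 'I_d])
    ((fun x : 'rV[R]_d => Num.floor (m.+1%:R * x ord0 i)) @^-1` [set k ord0 i])).
    apply: fin_bigcap_measurable => // i _.
    rewrite (_ : _ @^-1` _ = (fun x : 'rV[R]_d => m.+1%:R * x ord0 i) @^-1`
        `[(k ord0 i)%:~R, (k ord0 i + 1)%:~R[%classic).
      rewrite -[X in measurable X]setTI.
      have mm : measurable_fun setT (fun x : 'rV[R]_d => m.+1%:R * x ord0 i).
        by apply: measurable_funM => //; exact: measurable_coord_rV.
      exact: mm.
    apply/seteqP; split => x /=; rewrite in_itv/=.
      by move=> <-; exact: floor_itv.
    by move=> h; exact: floor_def.
  apply/seteqP; split => [x <- i _ /=|x h]; first by rewrite mxE.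
  by apply/rowP => i; rewrite mxE; exact: h.
- move=> x _; apply: (@continuous_cvg _ _ _ _ _ (fun m => p m (q m x)) f) => //.
    exact: cf.
  apply/cvgrPdist_lt => e e0.
  have /cvgrPdist_lt/(_ _ e0) := @cvg_harmonic R.
  apply: filterS => m; rewrite sub0r normrN ger0_norm ?harmonic_ge0// => he.
  apply: le_lt_trans he; apply: rV_norm_le => [|i]; first exact: harmonic_ge0.
  rewrite rVBE /p /q !mxE /harmonic.
  have /andP[h1 h2] := floor_itv (m.+1%:R * x ord0 i).
  have m0 : 0 < m.+1%:R :> R by [].
  have -> : x ord0 i = m.+1%:R^-1 * (m.+1%:R * x ord0 i) by rewrite mulKf ?gt_eqF.
  rewrite [in X in _ - X]mulKf ?gt_eqF// -mulrBr normrM gtr0_norm ?invr_gt0//.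
  rewrite ler_piMr ?invr_ge0// ger0_norm ?subr_ge0// lerBlDl ltW//.
  by rewrite -[X in _ + X]/(1%:~R) -intrD.
Qed.

Definition torus_continuous (f : torus R d -> R) :=
  forall x e, 0 < e -> exists2 r, 0 < r &
    forall y, torus_dist x y < r -> `|f x - f y| < e.

Lemma measurable_torus_continuous f : torus_continuous f -> measurable_fun setT f.
Proof.
move=> cf; have mf : measurable_fun setT (f \o @tproj R d).
  apply: measurable_continuous_rV => a.
  apply/(@cvgrPdist_lt _ R^o _ (nbhs a)) => e e0.
  have [r r0 fr] := cf (tproj a) e e0.
  near=> b; apply: fr; rewrite /torus_dist -tprojB.
  apply: le_lt_trans (torus_norm_le _) _; near: b.
  exact: cvgr_dist_lt.
by move=> _ Y mY; rewrite setTI /measurable/= -comp_preimage -[X in measurable X]setTI; exact: mf.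
Unshelve. all: end_near. Qed.

(** Two representatives of norm less than 1/2 differ by an integer vector of norm less than 1, so
    they coincide. The single short representative is then smaller than every [e]. *)
Lemma torus_norm0_eq0 (z : torus R d) : torus_norm z = 0 -> z = 0.
Proof.
move=> z0.
have [a az a1] : exists2 a, tproj a = z & `|a| < 2^-1.
  by apply/torus_norm_ltP; rewrite z0 invr_gt0.
suff -> : z = tproj 0 by rewrite tproj0.
rewrite -az; congr tproj; apply/eqP; rewrite -normr_le0; apply/ler_addgt0Pl => e e0.
rewrite addr0.
have [b bz be] : exists2 b, tproj b = z & `|b| < Num.min e 2^-1.
  by apply/torus_norm_ltP; rewrite z0 lt_min e0 invr_gt0/=.
move: be; rewrite lt_min => /andP[be b1].
suff -> : a = b by exact: ltW.
move: az; rewrite -bz => /tproj_eq/mxOverP abZ.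
apply/rowP => i; have /intrP[m] := abZ ord0 i.
rewrite rVBE => abm; apply/eqP; rewrite -subr_eq0 abm.
have : `|m%:~R| < 1%:~R :> R.
  rewrite -abm (splitr 1%:~R) (le_lt_trans (ler_normB _ _))// ltrD//.
    by rewrite (le_lt_trans (rV_coord_le _ _))// mul1r.
  by rewrite (le_lt_trans (rV_coord_le _ _))// mul1r.
by rewrite -intr_norm ltr_int => m1; rewrite intr_eq0; lia.
Qed.

Lemma torus_dist_eq0 (x y : torus R d) : torus_dist x y = 0 -> x = y.
Proof. by move=> /torus_norm0_eq0/eqP; rewrite subr_eq0 => /eqP. Qed.

End measurable_continuous.

Section torus_borel.
Variables (R : realType) (d : nat).
Local Notation torus := (torus R d).
Implicit Types (S : set torus).

Definition torus_lipschitz (C : R) (f : torus -> R) :=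
  forall x y, `|f x - f y| <= C * torus_dist x y.

Lemma torus_lipschitz_continuous C f : torus_lipschitz C f -> torus_continuous f.
Proof.
move=> lf x e e0; have C1 : 0 < `|C| + 1 by rewrite ltr_wpDl.
exists (e / (`|C| + 1)); first by rewrite divr_gt0.
move=> y; rewrite ltr_pdivlMr// => h; apply: le_lt_trans (lf x y) _.
apply: le_lt_trans h; rewrite mulrC ler_wpM2l ?torus_dist_ge0//.
by rewrite (le_trans (ler_norm _))// lerDl.
Qed.

Definition torus_open S :=
  forall x, S x -> exists2 r : R, 0 < r & forall y, torus_dist x y < r -> S y.

(* The point 1 keeps the infimum meaningful when [S] is everything. *)
Let dset S x : set R := [set torus_dist x y | y in ~` S] `|` [set 1].
Definition dist_compl S (x : torus) : R := inf (dset S x).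

Let dset_inf S x : has_inf (dset S x).
Proof.
split; first by exists 1; right.
by exists 0 => _ [[y _ <-]|->]; rewrite ?torus_dist_ge0.
Qed.

Lemma dist_compl_ge0 S x : 0 <= dist_compl S x.
Proof.
apply: lb_le_inf; first exact: (dset_inf _ _).1.
by move=> _ [[y _ <-]|->]; rewrite ?torus_dist_ge0.
Qed.

Lemma dist_compl_le1 S x : dist_compl S x <= 1.
Proof. by apply: ge_inf; [exact: (dset_inf _ _).2|right]. Qed.

Lemma dist_compl_lipschitz S : torus_lipschitz 1 (dist_compl S).
Proof.
have h x y : dist_compl S x <= dist_compl S y + torus_dist x y.
  rewrite -lerBlDr; apply: lb_le_inf; first exact: (dset_inf _ _).1.
  move=> _ [[z Sz <-]|->].
    rewrite lerBlDl; apply: le_trans (torus_distD y x z).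
    by apply: ge_inf; [exact: (dset_inf _ _).2|left; exists z].
  by rewrite lerBlDr (le_trans (dist_compl_le1 _ _))// lerDl torus_dist_ge0.
move=> x y; rewrite mul1r ler_norml lerBlDl h andbT.
by rewrite lerBrDl lerBlDl addrC torus_distC h.
Qed.

Lemma dist_compl_gt0 S x : torus_open S -> (0 < dist_compl S x) <-> S x.
Proof.
move=> oS; split=> [h|/oS[r r0 Sr]].
  apply: contrapT => Sx; suff : dist_compl S x <= 0 by rewrite leNgt h.
  by apply: ge_inf; [exact: (dset_inf _ _).2|left; exists x; rewrite ?torus_distxx].
apply: (@lt_le_trans _ _ (Num.min r 1)); first by rewrite lt_min r0/=.
apply: lb_le_inf; first exact: (dset_inf _ _).1.
move=> _ [[y Sy <-]|->]; last by rewrite ge_min lexx orbT.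
by rewrite ge_min leNgt; apply/orP; left; apply/negP => /Sr.
Qed.

Lemma measurable_torus_open S : torus_open S -> measurable S.
Proof.
move=> oS; have -> : S = dist_compl S @^-1` `]0, +oo[.
  by apply/seteqP; split=> x /=; rewrite in_itv/= andbT => /(dist_compl_gt0 x oS).
rewrite -[X in measurable X]setTI; apply: measurable_torus_continuous => //.
exact: torus_lipschitz_continuous (@dist_compl_lipschitz S).
Qed.

(** The coordinate of [tlift] jumps only where it takes the value 0, and [a >= 0] excludes these
    points. The radius keeps the coordinate inside (a, 1). *)
Lemma torus_open_tlift (i : 'I_d) (a : R) : 0 <= a ->
  torus_open [set y : torus | a < tlift y ord0 i].
Proof.
move=> a0 x /= ax; have /andP[x0 x1] := tlift_cube x i.
exists (Num.min (tlift x ord0 i - a) (1 - tlift x ord0 i)).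
  by rewrite lt_min !subr_gt0 ax.
move=> y; rewrite torus_distC => /torus_norm_ltP[b byx].
rewrite lt_min => /andP[b1 b2].
have -> : y = tproj (tlift x + b) by rewrite tprojD tliftK byx addrC subrK.
have := rV_coord_le b i => hb.
have : `|b ord0 i| < tlift x ord0 i - a by exact: le_lt_trans b1.
have : `|b ord0 i| < 1 - tlift x ord0 i by exact: le_lt_trans b2.
rewrite !ltr_norml => /andP[h1 h2] /andP[h3 h4].
rewrite tlift_tprojE (_ : Num.floor _ = 0) ?subr0.
  by rewrite mxE; lra.
by apply/floor_def; rewrite mxE; lra.
Qed.

(** Borel sets of the torus are defined through [tproj]; this recovers that open sets generate them.
    For a negative bound the preimage of the ray is everything, as [tlift] is nonnegative. *)
Lemma measurable_fun_torus_open d1 (T : measurableType d1) (f : T -> torus) :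
  (forall S, torus_open S -> measurable (f @^-1` S)) -> measurable_fun setT f.
Proof.
move=> mf; have -> : f = @tproj R d \o (fun z => tlift (f z)).
  by apply/funext => z /=; rewrite tliftK.
apply: (measurableT_comp (@measurable_tproj R d)); apply: measurable_fun_rV => i.
move=> mT; apply: (measurability _ (RGenOInfty.measurableE R)) => //.
move=> _ [_ [a ->] <-]; rewrite setTI.
have [a0|a0] := leP 0 a.
  have := mf _ (@torus_open_tlift i _ a0).
  rewrite (_ : f @^-1` _ = (fun z => tlift (f z) ord0 i) @^-1` `]a, +oo[)//.
  by apply/seteqP; split => z /=; rewrite in_itv/= andbT.
rewrite (_ : _ @^-1` _ = setT)//; apply/seteqP; split => // z _ /=.
rewrite in_itv/= andbT (lt_le_trans a0)//.
by have /andP[] := tlift_cube (f z) i.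
Qed.

(** The discontinuous coordinates of [tlift] do not pass to the limit, but the Lipschitz function
    [dist_compl S] does, and its positivity set is [S]. *)
Lemma measurable_fun_torus_cvg d1 (T : measurableType d1) (f_ : nat -> T -> torus)
    (f : T -> torus) :
  (forall n, measurable_fun setT (f_ n)) ->
  (forall z, torus_dist (f_ n z) (f z) @[n --> \oo] --> 0) ->
  measurable_fun setT f.
Proof.
move=> mf cf; apply: measurable_fun_torus_open => S oS.
have -> : f @^-1` S = (dist_compl S \o f) @^-1` `]0, +oo[.
  by apply/seteqP; split=> x /=; rewrite in_itv/= andbT => /(dist_compl_gt0 _ oS).
rewrite -[X in measurable X]setTI.
suff : measurable_fun setT (dist_compl S \o f) by exact.
apply: (@measurable_fun_cvg _ _ _ _ (fun n => dist_compl S \o f_ n)).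
  move=> n; apply: measurableT_comp => //; apply: measurable_torus_continuous.
  exact: torus_lipschitz_continuous (@dist_compl_lipschitz S).
move=> z _ /=; apply/cvgrPdist_lt => e e0.
have /cvgrPdist_lt/(_ _ e0) := cf z.
apply: filterS => n; rewrite sub0r normrN ger0_norm ?torus_dist_ge0// => he.
rewrite distrC (le_lt_trans _ he)// (le_trans (dist_compl_lipschitz _ _ _))//.
by rewrite mul1r.
Qed.

Lemma torus_openI : setI_closed torus_open.
Proof.
move=> A B oA oB x [/oA[r r0 Ar] /oB[s s0 Bs]]; exists (Num.min r s).
  by rewrite lt_min r0.
by move=> y; rewrite lt_min => /andP[/Ar ? /Bs].
Qed.

(* The indicator of an open set is the increasing limit of the Lipschitz functions
   [min 1 (n * dist_compl S)]. *)
Lemma torus_measure_unique (m1 m2 : {measure set torus -> \bar R}) :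
  (m1 setT < +oo)%E ->
  (forall f C, torus_lipschitz C f -> (forall x, 0 <= f x <= 1) ->
    (\int[m1]_x (f x)%:E = \int[m2]_x (f x)%:E)%E) ->
  forall A, measurable A -> m1 A = m2 A.
Proof.
move=> m1T m12.
apply: (@measure_unique _ _ _ torus_open (fun=> setT)) => //.
- apply/seteqP; split => A; last first.
    apply: smallest_sub; [exact: sigma_algebra_measurable|exact: measurable_torus_open].
  move=> mA; have mid : measurable_fun setT (idfun : g_sigma_algebraType torus_open -> torus).
    by apply: measurable_fun_torus_open => S oS; exact: sub_sigma_algebra.
  by have := mid measurableT _ mA; rewrite setTI.
- exact: torus_openI.
- by move=> _ x _; exists 1.
- by rewrite bigcup_const.
move=> S oS; have mS := measurable_torus_open oS.
pose g n (x : torus) := Num.min 1 (n%:R * dist_compl S x).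
have g0 n x : 0 <= g n x.
  by rewrite le_min ler01/= mulr_ge0// dist_compl_ge0.
have g1 n x : g n x <= 1 by rewrite ge_min lexx.
have lg n : torus_lipschitz n%:R (g n).
  move=> x y; have := dist_compl_lipschitz S x y; rewrite mul1r => h.
  have h' : `|n%:R * dist_compl S x - n%:R * dist_compl S y| <= n%:R * torus_dist x y.
    by rewrite -mulrBr normrM ger0_norm// ler_wpM2l.
  apply: le_trans h'; rewrite /g; move: (_ * _) (_ * _) => u v.
  rewrite !minEle; case: (leP 1 u) => hu; case: (leP 1 v) => hv.
  - by rewrite subrr normr0.
  - by rewrite !ler0_norm; lra.
  - by rewrite !ger0_norm; lra.
  - by [].
have mg n : measurable_fun setT (fun x => (g n x)%:E).
  apply/measurable_EFinP; apply: measurable_torus_continuous.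
  exact: torus_lipschitz_continuous (lg n).
have cvgS (m : {measure set torus -> \bar R}) :
    (m S = limn (fun n => \int[m]_x (g n x)%:E))%E.
  rewrite -monotone_convergence//; last 2 first.
  - by move=> ? ? _; rewrite lee_fin.
  - move=> x _ p q pq; rewrite lee_fin le_min ge_min lexx/= ge_min.
    by apply/orP; right; rewrite ler_wpM2r ?dist_compl_ge0// ler_nat.
  rewrite -(setIT S) -integral_indic//; apply: eq_integral => x _.
  apply/esym/cvg_lim => //; rewrite indicE.
  have [Sx|Sx] := boolP (x \in S); last first.
    have d0 : dist_compl S x = 0.
      apply/eqP; rewrite eq_le dist_compl_ge0 leNgt andbT; apply/negP.
      by move=> /(dist_compl_gt0 x oS) Sx'; rewrite mem_set in Sx.
    by rewrite /g; under eq_fun do rewrite d0 mulr0 min_r//; exact: cvg_cst.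
  have h : 0 < dist_compl S x by apply/(dist_compl_gt0 x oS); move: Sx; rewrite inE.
  apply: cvg_near_cst; near=> n; rewrite /g min_l//.
  rewrite -ler_pdivrMr// mul1r; near: n; exact: nbhs_infty_ger.
rewrite !cvgS; congr (limn _); apply/funext => n.
by apply: (m12 _ _ (lg n)) => x; rewrite g0 g1.
Unshelve. all: end_near. Qed.

End torus_borel.

(** * Increments and partial derivatives *)

Lemma near_eq_continuous (T U : topologicalType) (f g : T -> U) (x : T) :
  {for x, continuous g} -> (\near x, f x = g x) -> {for x, continuous f}.
Proof.
move=> gc fg; rewrite /prop_for /continuous_at (nbhs_singleton fg).
apply: cvg_trans gc; apply: near_eq_cvg.
by apply: filterS fg => y ->.
Qed.

Lemma continuous_mull (R : realType) (T : topologicalType) (k : R) (f : T -> R) :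
  continuous f -> continuous (fun x => k * f x).
Proof. by move=> fc x; apply: cvgM; [exact: cvg_cst|exact: fc]. Qed.

Lemma continuous_add (R : realType) (T : topologicalType) (f g : T -> R) :
  continuous f -> continuous g -> continuous (fun x => f x + g x).
Proof. by move=> fc gc x; apply: cvgD; [exact: fc|exact: gc]. Qed.

Lemma continuous_affine (R : realType) (V : normedModType R) (c : V) (e : R) :
  continuous (fun a : V => c + e *: a).
Proof.
by move=> x; apply: cvgD; [exact: cvg_cst|apply: cvgZ; [exact: cvg_cst|exact: cvg_id]].
Qed.

Lemma continuous_comp_fun (T U V : topologicalType) (f : T -> U) (g : U -> V) :
  continuous f -> continuous g -> continuous (fun x => g (f x)).
Proof. by move=> fc gc x; apply: continuous_comp; [exact: fc|exact: gc]. Qed.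

Section directional_derivatives.
Variables (R : realType) (d : nat).
Implicit Types (f g : 'rV[R]_d -> R) (x v a c : 'rV[R]_d).

Lemma is_derive_line f x v (t D : R) :
  is_derive (x + t *: v) v f D <-> is_derive t 1 (fun s : R => f (x + s *: v)) D.
Proof.
have E : (fun h : R => h^-1 *: ((f \o shift (x + t *: v)) (h *: v) - f (x + t *: v))) =
   (fun h => h^-1 *: (((fun s : R => f (x + s *: v)) \o shift t) (h *: 1) - f (x + t *: v))).
  apply/funext => h /=; congr (_ *: (f _ - _)).
  by rewrite addrCA scalerDl [h *: 1]mulr1.
split=> -[h1 h2]; apply: DeriveDef.
- by move: h1; rewrite /derivable E.
- by move: h2; rewrite /derive E.
- by rewrite /derivable E.
- by rewrite /derive E.
Qed.

Lemma is_derive_affine f c (e : R) x v D : is_derive (c + e *: x) v f D ->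
  is_derive x v (fun a => f (c + e *: a)) (e * D).
Proof.
rewrite -{1}[c + _]addr0 -[X in _ + X](scale0r v) => /is_derive_line h.
rewrite -[x]addr0 -[X in _ + X](scale0r v); apply/is_derive_line.
have -> : (fun s : R => f (c + e *: (x + s *: v))) =
    (fun s : R => f ((c + e *: x) + s *: v)) \o (e \*: (@idfun R)).
  by apply/funext => s /=; rewrite scalerDr addrA scalerA.
rewrite mulrC; apply: is_derive1_comp.
  by rewrite /= [e *: 0]mulr0.
have := @is_deriveZ R R R idfun e 0 1 1 (is_derive_id _ _).
by rewrite [e *: 1]mulr1.
Qed.

Local Notation del i := (delta_mx ord0 i : 'rV[R]_d).

Lemma partial_rVP f x i : derivable f x (del i) ->
  is_derive x (del i) f (partial_rV i f x).
Proof. by move=> h; apply: DeriveDef. Qed.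

Lemma partial_affine f c (e : R) i x : derivable f (c + e *: x) (del i) ->
  derivable (fun a => f (c + e *: a)) x (del i) /\
  partial_rV i (fun a => f (c + e *: a)) x = e * partial_rV i f (c + e *: x).
Proof. by move=> /partial_rVP/is_derive_affine[h1 h2]; split. Qed.

Lemma Ck_rV_continuous n f : Ck_rV n f -> continuous f.
Proof. by case: n => [|n] []. Qed.

(** Regularity is local. A periodization is a finite sum only near each point, with a number of
    terms that depends on the point. *)
Lemma Ck_rV_near n f : (forall x, exists2 g, Ck_rV n g & \near x, f x = g x) ->
  Ck_rV n f.
Proof.
have fc k : (forall x, exists2 g, Ck_rV k g & \near x, f x = g x) -> continuous f.
  move=> h x; have [g /Ck_rV_continuous gc fg] := h x.
  exact: near_eq_continuous (gc x) fg.
elim: n f fc => [|n IH] f fc h; first by split=> //; exact: fc h.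
split; [exact: fc h|move=> i; split=> [x|]].
  have [g [_ /(_ i)[gd _]] fg] := h x.
  by apply: near_eq_derivable (gd x); apply: filterS fg => y ->.
apply: IH => [k hk x|x].
  have [g /Ck_rV_continuous gc fg] := hk x.
  exact: near_eq_continuous (gc x) fg.
have [g [_ /(_ i)[gd gC]] fg] := h x.
exists (partial_rV i g) => //.
move: fg => /nbhs_interior; apply: filterS => y fg.
exact: near_eq_derive.
Qed.

Lemma Ck_rVZ n f (k : R) : Ck_rV n f -> Ck_rV n (fun x => k * f x).
Proof.
elim: n f => [|n IH] f [fc h]; split=> //.
- exact: continuous_mull.
- exact: continuous_mull.
move=> i; have [hd hC] := h i; split=> [x|].
  exact: (@derivableZ _ _ _ f k).
suff -> : partial_rV i (fun x => k * f x) = (fun x => k * partial_rV i f x).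
  exact: IH.
by apply/funext => x; rewrite /partial_rV (@deriveZ _ _ _ f k).
Qed.

Lemma Ck_rVD n f g : Ck_rV n f -> Ck_rV n g -> Ck_rV n (fun x => f x + g x).
Proof.
elim: n f g => [|n IH] f g [fc h] [gc h']; split=> //.
- exact: continuous_add.
- exact: continuous_add.
move=> i; have [hd hC] := h i; have [hd' hC'] := h' i; split=> [x|].
  exact: (@derivableD _ _ _ f g).
suff -> : partial_rV i (fun x => f x + g x) =
    (fun x => partial_rV i f x + partial_rV i g x) by exact: IH.
by apply/funext => x; rewrite /partial_rV (@deriveD _ _ _ f g).
Qed.

Lemma Ck_rV_affine n f c (e : R) : Ck_rV n f -> Ck_rV n (fun a => f (c + e *: a)).
Proof.
have ac g : continuous g -> continuous (fun a => g (c + e *: a)).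
  move=> gc; apply: (@continuous_comp_fun _ _ _ (fun a => c + e *: a) g) => //.
  exact: continuous_affine.
elim: n f => [|n IH] f [fc h]; split=> //; [exact: ac|exact: ac|].
move=> i; have [hd hC] := h i; split=> [x|].
  by have [] := partial_affine (hd (c + e *: x)).
suff -> : partial_rV i (fun a => f (c + e *: a)) =
    (fun x => e * partial_rV i f (c + e *: x)) by apply: Ck_rVZ; exact: IH.
by apply/funext => x; have [_] := partial_affine (hd (c + e *: x)).
Qed.

Lemma Ck_rV_sum n (I : Type) (s : seq I) (F : I -> 'rV[R]_d -> R) :
  (forall i, Ck_rV n (F i)) -> Ck_rV n (fun x => \sum_(i <- s) F i x).
Proof.
move=> hF; elim: s => [|i s IH].
  under eq_fun do rewrite big_nil.
  elim: n {hF} => [|n IH]; split=> //; try exact: cst_continuous.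
  move=> i; split=> [x|]; first exact: derivable_cst.
  by rewrite (_ : partial_rV i _ = fun=> 0)//; apply/funext => x; exact: derive_cst.
by under eq_fun do rewrite big_cons; exact: Ck_rVD.
Qed.

(** Change one coordinate at a time and apply the mean value theorem on each edge. With [c = 0] this
    is a Lipschitz bound, with the gradient at [x] a Taylor estimate. *)
Lemma norm_increment_le f x a (c : 'I_d -> R) (M : R) :
  (forall z i, derivable f z (del i)) ->
  (forall z i, `|z - x| <= `|a| -> `|partial_rV i f z - c i| <= M) ->
  `|f (x + a) - f x - \sum_(i < d) a ord0 i * c i| <= d%:R * M * `|a|.
Proof.
move=> fd hM.
pose p (k : nat) : 'rV[R]_d := x + \row_(i < d) (if (i < k)%N then a ord0 i else 0).
have p0 : p 0%N = x.
  by rewrite /p (_ : \row__ _ = 0) ?addr0//; apply/rowP => i; rewrite !mxE.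
have pd : p d = x + a.
  by rewrite /p; congr (_ + _); apply/rowP => i; rewrite !mxE ltn_ord.
have pS (i : 'I_d) s : p i + s *: del i = x + \row_(j < d)
    (if (j < i)%N then a ord0 j else if j == i then s else 0).
  rewrite /p -addrA; congr (_ + _); apply/rowP => j; rewrite !mxE eqxx/=.
  case: ltngtP => [ji|ij|/val_inj ->].
  - by rewrite (_ : j == i = false) ?mulr0 ?addr0//; apply/eqP => e; rewrite e ltnn in ji.
  - by rewrite (_ : j == i = false) ?mulr0 ?addr0//; apply/eqP => e; rewrite e ltnn in ij.
  - by rewrite eqxx mulr1 add0r.
have step (i : 'I_d) : `|f (p i.+1) - f (p i) - a ord0 i * c i| <= M * `|a|.
  have -> : p i.+1 = p i + a ord0 i *: del i.
    rewrite pS /p; congr (_ + _); apply/rowP => j; rewrite !mxE ltnS leq_eqVlt.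
    case: ltngtP => //=; last by move=> /val_inj ->; rewrite eqxx.
    by move=> ij; case: eqP => // e; rewrite e ltnn in ij.
  pose g (s : R) := f (p i + s *: del i).
  have gd (s : R) : is_derive s (1 : R) g (partial_rV i f (p i + s *: del i)).
    by apply/is_derive_line; exact: partial_rVP.
  have gc (A : set R) : {within A, continuous g}.
    apply: continuous_subspaceT => s; apply: differentiable_continuous.
    by apply/derivable1_diffP; case: (gd s).
  (* The norm is the maximum norm, so the points of the edge path stay within [|a|] of [x]. *)
  have key s : `|s| <= `|a ord0 i| -> `|partial_rV i f (p i + s *: del i) - c i| <= M.
    move=> sa; apply: hM; rewrite pS addrC addKr; apply: rV_norm_le => // j.
    rewrite mxE; case: ifP => _; first exact: rV_coord_le.
    case: ifP => _; last by rewrite normr0.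
    by rewrite (le_trans sa)// rV_coord_le.
  have [s sa ->] : exists2 s, `|s| <= `|a ord0 i| &
      f (p i + a ord0 i *: del i) - f (p i) = partial_rV i f (p i + s *: del i) * a ord0 i.
    have e0 : f (p i) = g 0 by rewrite /g scale0r addr0.
    rewrite e0 -/(g (a ord0 i)).
    have [a0|a0] := leP 0 (a ord0 i).
      have [s sI ->] := MVT_segment a0 (fun s _ => gd s) (gc _).
      exists s; last by rewrite subr0.
      by move: sI; rewrite in_itv/= => /andP[s0 sa]; rewrite !ger0_norm.
    have [s sI e] := MVT_segment (ltW a0) (fun s _ => gd s) (gc _).
    exists s.
      by move: sI; rewrite in_itv/= => /andP[s0 sa]; rewrite !ler0_norm ?lerN2// ltW.
    by rewrite -opprB e sub0r mulrN opprK.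
  rewrite [X in X - _]mulrC -mulrBr normrM mulrC; apply: ler_pM => //; first exact: key.
  exact: rV_coord_le.
have -> : f (x + a) - f x = \sum_(i < d) (f (p i.+1) - f (p i)).
  by rewrite -pd -{1}p0 -(telescope_sumr (fun k => f (p k)) (leq0n d)) big_mkord.
rewrite -sumrB (le_trans (ler_norm_sum _ _ _))//.
rewrite (le_trans (ler_sum _ (fun i _ => step i)))//.
by rewrite sumr_const card_ord -[leLHS]mulr_natl mulrA.
Qed.

End directional_derivatives.

Lemma fin_bounded (R : realType) (I : finType) (T : Type) (f : I -> T -> R) :
  (forall i, exists2 B : R, 0 <= B & forall y, `|f i y| <= B) ->
  exists2 B : R, 0 <= B & forall i y, `|f i y| <= B.
Proof.
move=> h.
have /choice[B hB] : forall i, exists B : R, 0 <= B /\ forall y, `|f i y| <= B.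
  by move=> i; have [B] := h i; exists B.
exists (\sum_i B i) => [|i y]; first by apply: sumr_ge0 => i _; have [] := hB i.
rewrite (le_trans ((hB i).2 y))// (bigD1 i)//= lerDl sumr_ge0// => j _.
by have [] := hB j.
Qed.

Section torus_smooth.
Variables (R : realType) (d : nat).
Local Notation torus := (torus R d).
Local Notation pi := (@tproj R d).
Implicit Types (rho : torus -> R).

Lemma measurable_torus_comp (f : torus -> R) :
  continuous (f \o pi) -> measurable_fun setT f.
Proof.
move=> /measurable_continuous_rV mf _ Y mY.
by rewrite setTI /measurable/= -comp_preimage -[X in measurable X]setTI; exact: mf.
Qed.

Lemma rV_closed_ball_compact (r : R) : compact [set a : 'rV[R]_d | `|a| <= r].
Proof.
apply: bounded_closed_compact.
  exists r; split; first exact: num_real.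
  by move=> s rs a /= /le_trans; apply; exact: ltW.
rewrite (_ : mkset _ = (fun a : 'rV[R]_d => `|a|) @^-1` [set x | x <= r])//.
apply: closed_comp; last exact: closed_le.
by move=> x _; exact: norm_continuous.
Qed.

Lemma norm_tlift_le1 (y : torus) : `|tlift y| <= 1.
Proof.
apply: rV_norm_le => // i; have /andP[h0 h1] := tlift_cube y i.
by rewrite ger0_norm// ltW.
Qed.

Lemma torus_bounded (f : torus -> R) : continuous (f \o pi) ->
  exists2 B : R, 0 <= B & forall y, `|f y| <= B.
Proof.
move=> cf.
have /compact_bounded[B [_ hB]] : compact ((f \o pi) @` [set a : 'rV[R]_d | `|a| <= 1]).
  apply: continuous_compact; last exact: rV_closed_ball_compact.
  exact: continuous_subspaceT.
exists (`|B| + 1) => [|y]; first by rewrite addr_ge0.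
apply: hB; first by rewrite (le_lt_trans (ler_norm _))// ltrDl.
by exists (tlift y); rewrite /= ?tliftK// norm_tlift_le1.
Qed.

Lemma partial_tproj f i (a b : 'rV[R]_d) :
  (forall x, derivable (f \o pi) x (delta_mx ord0 i)) -> pi a = pi b ->
  partial_rV i (f \o pi) a = partial_rV i (f \o pi) b :> R.
Proof.
move=> fd ab; have := partial_affine (fd ((b - a) + 1 *: a)) => -[_].
rewrite mul1r scale1r subrK => <-; congr (partial_rV i _ a).
by apply/funext => x /=; rewrite scale1r tprojD tprojB ab subrr add0r.
Qed.

Lemma torus_partialE rho i a : (forall x, derivable (rho \o pi) x (delta_mx ord0 i)) ->
  torus_partial i rho (pi a) = partial_rV i (rho \o pi) a.
Proof.
by move=> fd; apply: partial_tproj => //; rewrite /tproj reprK.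
Qed.

Lemma torus_partial_comp rho i : (forall x, derivable (rho \o pi) x (delta_mx ord0 i)) ->
  torus_partial i rho \o pi = partial_rV i (rho \o pi).
Proof. by move=> fd; apply/funext => a; exact: torus_partialE. Qed.

Lemma smooth_partial rho i : smooth_rV (rho \o pi) ->
  (forall x, derivable (rho \o pi) x (delta_mx ord0 i)) /\
  smooth_rV (torus_partial i rho \o pi).
Proof.
move=> sm; have fd x : derivable (rho \o pi) x (delta_mx ord0 i).
  by have [_ /(_ i)[]] := sm 1%N.
split=> // n; rewrite torus_partial_comp//.
by have [_ /(_ i)[]] := sm n.+1.
Qed.

Lemma smooth_reflect rho x : smooth_rV (rho \o pi) ->
  smooth_rV ((fun y => rho (x - y)) \o pi) /\
  forall i y, torus_partial i (fun y => rho (x - y)) y = - torus_partial i rho (x - y).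
Proof.
move=> sm; have E : (fun y => rho (x - y)) \o pi =
    (fun a => (rho \o pi) (tlift x + (-1) *: a)).
  by apply/funext => a /=; rewrite scaleN1r tprojD tprojN tliftK.
split=> [n|i y]; first by rewrite E; apply: Ck_rV_affine.
have [fd _] := smooth_partial i sm.
have [_] := partial_affine (fd (tlift x + (-1) *: repr y)).
rewrite -E mulN1r => h; rewrite {1}/torus_partial h -torus_partialE//.
by rewrite tprojD scaleN1r tprojN tliftK /tproj reprK.
Qed.

Lemma smooth_taylor rho : smooth_rV (rho \o pi) -> exists2 K : R, 0 <= K &
  [/\ forall y a, `|rho (y + pi a) - rho y| <= K * `|a|,
      forall i y, `|torus_partial i rho y| <= K &
      forall y a, `|rho (y + pi a) - rho y - \sum_(i < d) a ord0 i * torus_partial i rho y|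
        <= K * `|a| ^+ 2].
Proof.
move=> sm.
have fd i := (smooth_partial i sm).1; have sp i := (smooth_partial i sm).2.
have fdd i j := (smooth_partial j (sp i)).1; have spp i j := (smooth_partial j (sp i)).2.
have [B1 B10 hB1] := fin_bounded (fun i => torus_bounded (sp i 0%N).1).
have [B2 B20 hB2] := fin_bounded (fun ij : 'I_d * 'I_d =>
  torus_bounded (spp ij.1 ij.2 0%N).1).
have lip y a : `|rho (y + pi a) - rho y| <= d%:R * B1 * `|a|.
  have := @norm_increment_le R d (rho \o pi) (tlift y) a (fun=> 0) B1 (fun z i => fd i z).
  rewrite /= tprojD tliftK big1 ?subr0; last by move=> i _; rewrite mulr0.
  by apply => z i _; rewrite subr0 -torus_partialE.
have lipp i y a : `|torus_partial i rho (y + pi a) - torus_partial i rho y|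
    <= d%:R * B2 * `|a|.
  have := @norm_increment_le R d (torus_partial i rho \o pi) (tlift y) a (fun=> 0) B2
    (fun z j => fdd i j z).
  rewrite /= tprojD tliftK big1 ?subr0; last by move=> j _; rewrite mulr0.
  by apply => z j _; rewrite subr0 -torus_partialE//; exact: (hB2 (i, j)).
(* The three terms serve the bound on the gradient, the Lipschitz estimate and the quadratic
   remainder. *)
exists (B1 + d%:R * B1 + d%:R * (d%:R * B2)).
  by rewrite !addr_ge0 ?mulr_ge0.
split=> [y a|i y|y a].
- rewrite (le_trans (lip _ _))// ler_wpM2r// -addrA addrCA lerDl.
  by rewrite addr_ge0 ?mulr_ge0.
- by rewrite (le_trans (hB1 _ _))// -addrA lerDl addr_ge0 ?mulr_ge0.
have := @norm_increment_le R d (rho \o pi) (tlift y) a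
  (fun i => torus_partial i rho y) (d%:R * B2 * `|a|) (fun z i => fd i z).
rewrite /= tprojD tliftK => h; apply: le_trans (h _) _.
  move=> z i za; rewrite -torus_partialE//.
  have -> : pi z = y + pi (z - tlift y) by rewrite tprojB tliftK addrC subrK.
  by rewrite (le_trans (lipp _ _ _))// ler_wpM2l ?mulr_ge0.
rewrite -mulrA -mulrA -expr2 -mulrA mulrA mulrA ler_wpM2r ?sqr_ge0//.
by rewrite mulrA lerDr addr_ge0 ?mulr_ge0.
Qed.

End torus_smooth.

(** * Mollifiers *)

Section kernels.
Variables (R : realType) (d : nat).
Local Notation torus := (torus R d).
Local Notation pi := (@tproj R d).
Local Notation L := (lebesgue_torus R d).

(** All that the sequel uses of a periodized mollifier; [r] bounds the radius of its support. *)
Definition smooth_kernel (rho : torus -> R) (r : R) :=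
  [/\ smooth_rV (rho \o pi), forall y, 0 <= rho y,
      (\int[L]_y (rho y)%:E = 1)%E &
      forall y, rho y != 0 -> torus_norm y < r].

Lemma rV_norm_lt (a : 'rV[R]_d) (A : R) : `|a| < A -> forall i, `|a ord0 i| < A.
Proof. by move=> aA i; apply: le_lt_trans aA; exact: rV_coord_le. Qed.

Lemma smooth_periodization (m : nat) (g : 'rV[R]_d -> R) :
  smooth_rV g -> (forall a : 'rV[R]_d, g a != 0 -> forall i, `|a ord0 i| < m%:R) ->
  smooth_rV ((fun y : torus => \sum_(a \in [set a : 'rV[R]_d | pi a = y]) g a) \o pi).
Proof.
move=> sg gs n; apply: Ck_rV_near => x.
(* For [|c| < A] a point of the support differs from [c] by less than [m + A] in each coordinate, so
   a single window serves a whole neighbourhood of [x]. *)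
pose A := (Num.trunc `|x|).+1; have xA : `|x| < A%:R by exact: truncnS_gt.
exists (fun c => \sum_(j : {ffun 'I_d -> 'I_((m + A).*2)}) g (c + zshift R j)).
  apply: Ck_rV_sum => j.
  under eq_fun do rewrite addrC -[X in _ + X]scale1r.
  exact: Ck_rV_affine.
have : \near x, `|x| < A%:R.
  by apply: (@cvgr_norm_lt _ _ _ (nbhs x) _ id x) => //; exact: cvg_id.
apply: filterS => c cA /=; apply: fiber_sumE => a /gs ga _ i.
have := ga i; have := rV_norm_lt cA i; rewrite !ltr_norml natrD.
by move=> /andP[? ?] /andP[? ?]; apply/andP; split; lra.
Qed.

Lemma mollifier_kernel (chi : 'rV[R]_d -> R) : mollifier chi ->
  exists2 M : R, 0 < M &
    forall delta, 0 < delta < 1 -> smooth_kernel (torus_mollifier chi delta) (M * delta).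
Proof.
move=> [schi chi0 cchi ichi].
have [m hm] : exists m : nat, forall a, chi a != 0 -> `|a| < m%:R.
  have [B [_ hB]] := compact_bounded cchi.
  exists (Num.trunc (`|B| + 1)).+1 => a ca.
  apply: (@le_lt_trans _ _ (`|B| + 1)); last exact: truncnS_gt.
  apply: hB; first by rewrite (le_lt_trans (ler_norm _))// ltrDl.
  exact: subset_closure.
have m0 : 0 < m.+1%:R :> R by [].
(* The support of [chi] lies in the ball of radius [m]; the successor makes the constant positive
   even for [m = 0]. *)
exists m.+1%:R => // delta /andP[d0 d1].
pose g (a : 'rV[R]_d) := delta ^- d * chi (delta^-1 *: a).
have ga a : g a != 0 -> `|a| < m.+1%:R * delta.
  rewrite mulf_eq0 negb_or => /andP[_ /hm].
  rewrite normrZ gtr0_norm ?invr_gt0// ltr_pdivrMl// => h.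
  by rewrite mulrC (lt_trans h)// ltr_pM2l// ltr_nat.
have gs (a : 'rV[R]_d) : g a != 0 -> forall i, `|a ord0 i| < m.+1%:R.
  by move=> /ga h; apply: rV_norm_lt; rewrite (lt_le_trans h)// ger_pMr// ltW.
have sg : smooth_rV g.
  move=> n; apply: Ck_rVZ; under eq_fun do rewrite -[X in chi X]add0r.
  exact: Ck_rV_affine.
have rhoE y : torus_mollifier chi delta y =
    \sum_(a \in [set a : 'rV[R]_d | pi a = y]) g a by [].
have g0 a : 0 <= g a by rewrite mulr_ge0// invr_ge0 exprn_ge0// ltW.
split.
- have := smooth_periodization sg gs.
  by congr smooth_rV.
- by move=> y; rewrite rhoE (fiber_sum_tliftE _ gs) sumr_ge0.
- under eq_integral do rewrite rhoE (fiber_sum_tliftE _ gs).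
  have mg : measurable_fun setT g.
    by apply: measurable_continuous_rV; exact: Ck_rV_continuous (sg 0%N).
  rewrite integral_zshift_sum//.
  have mchi : measurable_fun setT chi.
    by apply: measurable_continuous_rV; exact: Ck_rV_continuous (schi 0%N).
  under eq_integral do rewrite EFinM -[X in chi X]add0r.
  rewrite ge0_integralZl//=; last 3 first.
  - apply/measurable_EFinP; apply: (measurableT_comp mchi).
    exact: measurable_affine_rV.
  - by move=> x _; rewrite lee_fin.
  - by rewrite lee_fin invr_ge0 exprn_ge0// ltW.
  rewrite (ge0_integral_rV_affine _ _ (g := fun a => (chi a)%:E))//; last 2 first.
  - by rewrite invr_eq0 gt_eqF.
  - exact/measurable_EFinP.
  rewrite ichi mule1 -EFinM gtr0_norm ?invr_gt0// invrK mulVf//.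
  by rewrite expf_neq0// gt_eqF.
- move=> y; rewrite rhoE => hy.
  suff [a ay ga0] : exists2 a, pi a = y & g a != 0.
    by rewrite -ay (le_lt_trans (torus_norm_le _))// ga.
  apply: contrapT => h; move/eqP: hy; apply.
  apply: fsbig1 => a /= ay; apply/eqP; apply: contrapT => ga0.
  by apply: h; exists a => //; apply/negP.
Qed.

End kernels.

(** * Convolutions *)

Section bounded_measurable.
Context d0 (T : measurableType d0) (R : realType) (P : probability T R).
Implicit Types f g : T -> R.

Definition bounded_measurable f :=
  measurable_fun setT f /\ exists B, forall x, `|f x| <= B.

Lemma bounded_measurable_integrable f :
  bounded_measurable f -> P.-integrable setT (EFin \o f).
Proof.
move=> [mf [B hB]]; apply: measurable_bounded_integrable => //.
  by rewrite /= probability_setT ltry.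
exists `|B|; split; first exact: num_real.
by move=> M BM x _ /=; rewrite (le_trans (hB x))// (le_trans (ler_norm _))// ltW.
Qed.

Lemma bounded_measurable_cst c : bounded_measurable (fun=> c).
Proof. by split; [exact: measurable_cst|exists `|c|]. Qed.

Lemma bounded_measurableD f g : bounded_measurable f -> bounded_measurable g ->
  bounded_measurable (fun x => f x + g x).
Proof.
move=> [mf [B hB]] [mg [C hC]]; split; first exact: measurable_funD.
by exists (B + C) => x; rewrite (le_trans (ler_normD _ _))// lerD.
Qed.

Lemma bounded_measurableN f : bounded_measurable f -> bounded_measurable (fun x => - f x).
Proof.
move=> [mf [B hB]]; split; first exact: measurableT_comp.
by exists B => x; rewrite normrN.
Qed.

Lemma bounded_measurableB f g : bounded_measurable f -> bounded_measurable g ->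
  bounded_measurable (fun x => f x - g x).
Proof. by move=> bf bg; apply: bounded_measurableD => //; exact: bounded_measurableN. Qed.

Lemma bounded_measurableM f g : bounded_measurable f -> bounded_measurable g ->
  bounded_measurable (fun x => f x * g x).
Proof.
move=> [mf [B hB]] [mg [C hC]]; split; first exact: measurable_funM.
by exists (B * C) => x; rewrite normrM ler_pM.
Qed.

Lemma bounded_measurable_sum (I : Type) (s : seq I) (F : I -> T -> R) :
  (forall i, bounded_measurable (F i)) ->
  bounded_measurable (fun x => \sum_(i <- s) F i x).
Proof.
move=> hF; elim: s => [|i s IH].
  by under eq_fun do rewrite big_nil; exact: bounded_measurable_cst.
by under eq_fun do rewrite big_cons; exact: bounded_measurableD.
Qed.

Lemma Rintegral_bmD f g : bounded_measurable f -> bounded_measurable g ->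
  \int[P]_x (f x + g x) = \int[P]_x f x + \int[P]_x g x.
Proof.
by move=> bf bg; rewrite RintegralD//; exact: bounded_measurable_integrable.
Qed.

Lemma Rintegral_bmB f g : bounded_measurable f -> bounded_measurable g ->
  \int[P]_x (f x - g x) = \int[P]_x f x - \int[P]_x g x.
Proof.
by move=> bf bg; rewrite RintegralB//; exact: bounded_measurable_integrable.
Qed.

Lemma Rintegral_bmZ c f : bounded_measurable f ->
  \int[P]_x (c * f x) = c * \int[P]_x f x.
Proof.
by move=> bf; rewrite RintegralZl//; exact: bounded_measurable_integrable.
Qed.

Lemma Rintegral_bm_sum (I : Type) (s : seq I) (F : I -> T -> R) :
  (forall i, bounded_measurable (F i)) ->
  \int[P]_x (\sum_(i <- s) F i x) = \sum_(i <- s) \int[P]_x F i x.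
Proof.
move=> hF; elim: s => [|i s IH].
  under eq_Rintegral do rewrite big_nil.
  by rewrite big_nil Rintegral_cst// mul0r.
under eq_Rintegral do rewrite big_cons.
by rewrite big_cons Rintegral_bmD// ?IH//; exact: bounded_measurable_sum.
Qed.

Lemma Rintegral_prob_cst c : \int[P]_x c = c.
Proof. by rewrite Rintegral_cst// /= probability_setT mulr1. Qed.

Lemma le_Rintegral_bm f g : bounded_measurable f -> bounded_measurable g ->
  (forall x, f x <= g x) -> \int[P]_x f x <= \int[P]_x g x.
Proof.
by move=> bf bg fg; apply: le_Rintegral => //; exact: bounded_measurable_integrable.
Qed.

Lemma normr_Rintegral_bm f B : bounded_measurable f -> (forall x, `|f x| <= B) ->
  `|\int[P]_x f x| <= B.
Proof.
move=> bf fB; rewrite ler_norml; apply/andP; split.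
  rewrite -[leLHS]Rintegral_prob_cst; apply: le_Rintegral_bm => //.
    exact: bounded_measurable_cst.
  by move=> x; have := fB x; rewrite ler_norml => /andP[].
rewrite -[leRHS]Rintegral_prob_cst; apply: le_Rintegral_bm => //.
  exact: bounded_measurable_cst.
by move=> x; have := fB x; rewrite ler_norml => /andP[].
Qed.

End bounded_measurable.

Lemma bounded_measurable_comp d0 d1 (T : measurableType d0) (S : measurableType d1)
    (R : realType) (f : T -> R) (p : S -> T) :
  bounded_measurable f -> measurable_fun setT p ->
  bounded_measurable (fun x => f (p x)).
Proof.
move=> [mf [B hB]] mp; split; first exact: measurableT_comp.
by exists B => x.
Qed.

Section convolution.
Variables (R : realType) (d : nat).
Local Notation torus := (torus R d).
Local Notation pi := (@tproj R d).
Local Notation L := (lebesgue_torus R d).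
Implicit Types (v : torus -> 'rV[R]_d) (rho : torus -> R).

Definition bounded_field U v :=
  (forall i, measurable_fun setT (fun x => v x ord0 i)) /\ forall x, `|v x| <= U.

Lemma bounded_field_coord U v i : bounded_field U v ->
  bounded_measurable (fun x => v x ord0 i).
Proof.
move=> [mv vU]; split=> //; exists U => x.
by rewrite (le_trans (rV_coord_le _ _)).
Qed.

Lemma bounded_measurable_reflect (x : torus) (f : torus -> R) :
  bounded_measurable f -> bounded_measurable (fun y : torus => f (x - y)).
Proof.
by move=> bf; apply: (bounded_measurable_comp bf); exact: measurable_torusB.
Qed.

Lemma bounded_measurable_shift (x : torus) (f : torus -> R) :
  bounded_measurable f -> bounded_measurable (fun y : torus => f (y + x)).
Proof.
by move=> bf; apply: (bounded_measurable_comp bf); exact: measurable_torusD.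
Qed.

Lemma smooth_bounded_measurable rho : smooth_rV (rho \o pi) -> bounded_measurable rho.
Proof.
move=> /(_ 0%N)[c _]; split; first exact: measurable_torus_comp.
by have [B _ hB] := torus_bounded c; exists B.
Qed.

Lemma Rintegral_torus_reflect (x : torus) (f : torus -> R) : measurable_fun setT f ->
  \int[L]_y f (x - y) = \int[L]_y f y.
Proof.
move=> mf; rewrite /Rintegral (integral_torus_reflect x (h := EFin \o f))//.
exact/measurable_EFinP.
Qed.

Lemma Rintegral_torus_shift (x : torus) (f : torus -> R) : measurable_fun setT f ->
  \int[L]_y f (y + x) = \int[L]_y f y.
Proof.
move=> mf; rewrite /Rintegral; under eq_integral do rewrite addrC.
rewrite (integral_torus_translate x (h := EFin \o f))//.
exact/measurable_EFinP.
Qed.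

Section kernel.
Variables (rho : torus -> R) (r : R) (krho : smooth_kernel rho r).

Lemma kernel_bm : bounded_measurable rho.
Proof. by case: krho => s _ _ _; exact: smooth_bounded_measurable. Qed.

Lemma kernel_Rintegral : \int[L]_y rho y = 1.
Proof. by case: krho => _ _ h _; rewrite /Rintegral h. Qed.

(** Integration against a nonnegative kernel of mass 1 is an average over the ball of radius [r].
    Taking for [c] the value at the centre gives approximation, taking 0 gives bounds. *)
Lemma kernel_average (f : torus -> R) (c e : R) : bounded_measurable f ->
  (forall y, torus_norm y < r -> `|f y - c| <= e) ->
  `|\int[L]_y (f y * rho y) - c| <= e.
Proof.
move=> bf fe; have br := kernel_bm; have [_ r0 _ rr] := krho.
have le1 (s : R) : \int[L]_y (s * rho y) = s.
  by rewrite Rintegral_bmZ// kernel_Rintegral mulr1.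
have bs (s : R) : bounded_measurable (fun y : torus => s * rho y).
  by apply: bounded_measurableM => //; exact: bounded_measurable_cst.
have bfr := bounded_measurableM bf br.
rewrite ler_norml lerBrDr lerBlDr; apply/andP; split.
  rewrite -[leLHS]le1; apply: le_Rintegral_bm => // y.
  have [->|/rr/fe] := eqVneq (rho y) 0; first by rewrite !mulr0.
  by rewrite ler_norml => /andP[h _]; rewrite ler_wpM2r//; move: h; rewrite lerBrDr.
rewrite -[leRHS]le1; apply: le_Rintegral_bm => // y.
have [->|/rr/fe] := eqVneq (rho y) 0; first by rewrite !mulr0.
by rewrite ler_norml => /andP[_ h]; rewrite ler_wpM2r//; move: h; rewrite lerBlDr.
Qed.

Lemma torus_conv_near v U (e : R) x : bounded_field U v -> 0 <= e ->
  (forall y, torus_dist x y < r -> `|v y - v x| <= e) ->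
  `|torus_conv v rho x - v x| <= e.
Proof.
move=> bv e0 ve; apply: rV_norm_le => // i; rewrite rVBE mxE.
apply: (@kernel_average (fun y : torus => v (x - y) ord0 i)).
  exact: bounded_measurable_reflect (bounded_field_coord i bv).
move=> y yr; rewrite -rVBE (le_trans (rV_coord_le _ _))// ve//.
by rewrite /torus_dist opprB addrC subrK.
Qed.

Lemma torus_conv_le v U x : bounded_field U v -> `|torus_conv v rho x| <= U.
Proof.
move=> bv; apply: rV_norm_le => [|i].
  by rewrite (le_trans _ (bv.2 0)).
rewrite mxE -[X in `|X|]subr0; apply: (@kernel_average (fun y : torus => v (x - y) ord0 i)).
  exact: bounded_measurable_reflect (bounded_field_coord i bv).
by move=> y _; rewrite subr0 (le_trans (rV_coord_le _ _))// bv.2.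
Qed.

Lemma torus_conv_dist_le v w U V (e : R) x : bounded_field U v -> bounded_field V w ->
  (forall y, `|v y - w y| <= e) ->
  `|torus_conv v rho x - torus_conv w rho x| <= e.
Proof.
move=> bv bw vwe; have br := kernel_bm.
apply: rV_norm_le => [|i]; first exact: le_trans (vwe 0).
have bvi := bounded_measurable_reflect x (bounded_field_coord i bv).
have bwi := bounded_measurable_reflect x (bounded_field_coord i bw).
rewrite rVBE !mxE -Rintegral_bmB; [|exact: bounded_measurableM..].
under eq_Rintegral do rewrite -mulrBl.
rewrite -[X in `|X|]subr0.
apply: (@kernel_average (fun y : torus => v (x - y) ord0 i - w (x - y) ord0 i)).
  exact: bounded_measurableB.
by move=> y _; rewrite subr0 -rVBE (le_trans (rV_coord_le _ _)).
Qed.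

(** Moves the dependence on [x] from [v], which is not differentiable, to the smooth kernel. *)
Lemma torus_convE v U x i : bounded_field U v ->
  torus_conv v rho x ord0 i = \int[L]_y (v y ord0 i * rho (x - y)).
Proof.
move=> bv; have [mv _] := bounded_field_coord i bv; have [mr _] := kernel_bm.
rewrite mxE -(Rintegral_torus_reflect x).
  by apply: eq_Rintegral => y _; rewrite opprB addrC subrK.
apply: measurable_funM => //; apply: (measurableT_comp mv).
exact: measurable_torusB.
Qed.

Definition conv_partial v x (i j : 'I_d) : R :=
  \int[L]_y (v y ord0 i * torus_partial j rho (x - y)).

(** The expansion of [rho] integrated against [v]. The constant comes from [rho] alone, so one [K]
    serves the fields [u t] at all times. *)
Lemma torus_conv_taylor : exists2 K : R, 0 <= K &
  forall v U, bounded_field U v ->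
  [/\ forall x a, `|torus_conv v rho (x + pi a) - torus_conv v rho x| <= U * K * `|a|,
      forall x i j, `|conv_partial v x i j| <= U * K &
      forall x a i, `|torus_conv v rho (x + pi a) ord0 i - torus_conv v rho x ord0 i
         - \sum_(j < d) a ord0 j * conv_partial v x i j| <= U * K * `|a| ^+ 2].
Proof.
have [srho _ _ _] := krho; have br := kernel_bm.
have [K K0 [lipK bK tayK]] := smooth_taylor srho.
have bp j : bounded_measurable (torus_partial j rho).
  exact: smooth_bounded_measurable (smooth_partial j srho).2.
exists K => // v U bv; have U0 : 0 <= U by rewrite (le_trans _ (bv.2 0)).
have bvi i := bounded_field_coord i bv.
have vU y i : `|v y ord0 i| <= U by rewrite (le_trans (rV_coord_le _ _))// bv.2.
have bvr i x : bounded_measurable (fun y : torus => v y ord0 i * rho (x - y)).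
  by apply: bounded_measurableM => //; exact: bounded_measurable_reflect.
have bvp i x j : bounded_measurable (fun y : torus => v y ord0 i * torus_partial j rho (x - y)).
  by apply: bounded_measurableM => //; exact: bounded_measurable_reflect.
split=> [x a|x i j|x a i].
- apply: rV_norm_le => [|i]; first by rewrite !mulr_ge0.
  rewrite rVBE !(torus_convE _ _ bv) -Rintegral_bmB//.
  apply: normr_Rintegral_bm; first exact: bounded_measurableB.
  move=> y; rewrite -mulrBr normrM -mulrA ler_pM//.
  by rewrite addrAC.
- apply: normr_Rintegral_bm => // y.
  by rewrite normrM ler_pM.
- rewrite !(torus_convE _ _ bv).
  under eq_bigr do rewrite -Rintegral_bmZ//.
  rewrite -Rintegral_bm_sum; last first.
    by move=> j; apply: bounded_measurableM => //; exact: bounded_measurable_cst.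
  rewrite -!Rintegral_bmB//; first last.
  - apply: bounded_measurable_sum => j.
    by apply: bounded_measurableM => //; exact: bounded_measurable_cst.
  - exact: bounded_measurableB.
  apply: normr_Rintegral_bm.
    apply: bounded_measurableB; first exact: bounded_measurableB.
    apply: bounded_measurable_sum => j.
    by apply: bounded_measurableM => //; exact: bounded_measurable_cst.
  move=> y; rewrite -mulrBr.
  under eq_bigr do rewrite mulrCA.
  rewrite -mulr_sumr -mulrBr normrM -mulrA ler_pM//.
  by rewrite (addrAC x) tayK.
Qed.

(* The test function is [y |-> rho (x - y)]. *)
Lemma conv_divergence_free v U x : bounded_field U v -> weakly_divergence_free v ->
  \sum_(i < d) conv_partial v x i i = 0.
Proof.
move=> bv dv; have [srho _ _ _] := krho.
have bp j : bounded_measurable (torus_partial j rho).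
  exact: smooth_bounded_measurable (smooth_partial j srho).2.
have bvp i j : bounded_measurable (fun y : torus => v y ord0 i * torus_partial j rho (x - y)).
  apply: bounded_measurableM; first exact: (bounded_field_coord _ bv).
  exact: bounded_measurable_reflect.
have [sphi dphi] := smooth_reflect x srho.
have := dv _ sphi; under eq_integral do under eq_bigr do rewrite dphi mulrN.
rewrite /conv_partial -Rintegral_bm_sum// => h.
apply/eqP; rewrite -oppr_eq0 -mulN1r -Rintegral_bmZ; last exact: bounded_measurable_sum.
rewrite /Rintegral -[eqbRHS]/(fine 0%E) -h.
apply/eqP; congr fine; apply: eq_integral => y _.
by rewrite sumrN mulN1r.
Qed.

End kernel.
End convolution.

(** * The Euler scheme *)

Lemma norm_sum_ord_le (R : realType) (d : nat) (F : 'I_d -> R) (c : R) :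
  (forall i, `|F i| <= c) -> `|\sum_(i < d) F i| <= d%:R * c.
Proof.
move=> Fc; rewrite (le_trans (ler_norm_sum _ _ _))//.
rewrite (le_trans (ler_sum _ (fun i _ => Fc i)))//.
by rewrite sumr_const card_ord -[leLHS]mulr_natl.
Qed.

Section euler.
Variables (R : realType) (d : nat).
Local Notation torus := (torus R d).
Local Notation pi := (@tproj R d).
Local Notation L := (lebesgue_torus R d).
Implicit Types (v : torus -> 'rV[R]_d) (psi : torus -> R) (h S B M K : R).

(* [C^{1,1}] regularity in terms of increments only. Composing [psi] with an Euler
   step preserves it by plain algebra, so that neither the chain rule nor the
   differentiability of the flow is ever needed. *)
Definition C11 S psi := exists g : torus -> 'I_d -> R,
  (forall x i, `|g x i| <= S) /\
  forall x a, `|psi (x + pi a) - psi x - \sum_(i < d) a ord0 i * g x i|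
    <= S * `|a| ^+ 2.

(** [D x i j] plays the part of the derivative of the [i]-th component in direction [j]; its trace
    is the divergence. *)
Definition solenoidal_C11 M K v := bounded_field M v /\
  exists D : torus -> 'I_d -> 'I_d -> R,
  [/\ forall x a, `|v (x + pi a) - v x| <= K * `|a|,
      forall x i j, `|D x i j| <= K,
      forall x a i, `|v (x + pi a) ord0 i - v x ord0 i
        - \sum_(j < d) a ord0 j * D x i j| <= K * `|a| ^+ 2 &
      forall x, \sum_(i < d) D x i i = 0].

Definition euler_step h v (x : torus) : torus := x + pi (h *: v x).

Lemma measurable_euler_step h v M : bounded_field M v ->
  measurable_fun setT (euler_step h v).
Proof.
move=> [mv _]; apply: measurable_torusD => //.
apply: (measurableT_comp (@measurable_tproj R d)); apply: measurable_fun_rV => i.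
by under eq_fun do rewrite mxE; exact: measurable_funM.
Qed.

(** An Euler step stretches an increment by at most [1 + h * K]; its square is at most
    [1 + h * (2 * K + K ^+ 2)] as [h <= 1]. The quadratic remainder of [v] contributes
    [h * d * K]. *)
Lemma C11_euler_step h v M K S psi : 0 <= h <= 1 -> 0 <= S -> 0 <= K ->
  solenoidal_C11 M K v -> C11 S psi ->
  C11 (S * (1 + h * (2 * K + K ^+ 2 + d%:R * K))) (psi \o euler_step h v).
Proof.
move=> /andP[h0 h1] S0 K0 [bv [D [lv bD tD _]]] [g [bg tg]].
pose E := euler_step h v.
(* The gradient that the chain rule predicts: the transpose of [1 + h D] applied to the gradient at
   the image point. *)
exists (fun x j => g (E x) j + h * \sum_(i < d) D x i j * g (E x) i); split.
  move=> x j; rewrite (le_trans (ler_normD _ _))// normrM ger0_norm//.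
  apply: (@le_trans _ _ (S + h * (d%:R * (K * S)))).
    rewrite lerD// ler_wpM2l//; apply: norm_sum_ord_le => i.
    by rewrite normrM ler_pM.
  have : 0 <= S * h * (2 * K + K ^+ 2) by rewrite !mulr_ge0// addr_ge0 ?mulr_ge0 ?exprn_ge0.
  lra.
move=> x a; set b := a + h *: (v (x + pi a) - v x).
have Eb : E (x + pi a) = E x + pi b.
  rewrite /E /euler_step /b -!addrA; congr (x + _); rewrite -!tprojD; congr pi.
  by rewrite scalerBr [RHS]addrC -addrA subrK.
have lb : `|b| <= (1 + h * K) * `|a|.
  rewrite (le_trans (ler_normD _ _))// mulrDl mul1r lerD// normrZ ger0_norm//.
  by rewrite -mulrA ler_wpM2l.
rewrite /= -/E Eb.
have := tg (E x) b; set A := psi _; set A' := psi _ => t1.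
have t2 : `|\sum_(i < d) g (E x) i * (v (x + pi a) ord0 i - v x ord0 i
        - \sum_(j < d) a ord0 j * D x i j)| <= d%:R * (S * (K * `|a| ^+ 2)).
  by apply: norm_sum_ord_le => i; rewrite normrM ler_pM.
have sumE : \sum_(j < d) a ord0 j * (g (E x) j + h * (\sum_(i < d) D x i j * g (E x) i)) =
   \sum_(i < d) b ord0 i * g (E x) i - h * \sum_(i < d) g (E x) i *
      (v (x + pi a) ord0 i - v x ord0 i - \sum_(j < d) a ord0 j * D x i j).
  have -> : \sum_(j < d) a ord0 j * (g (E x) j + h * (\sum_(i < d) D x i j * g (E x) i)) =
     \sum_(j < d) a ord0 j * g (E x) j +
     h * \sum_(i < d) \sum_(j < d) g (E x) i * (a ord0 j * D x i j).
    rewrite exchange_big/= mulr_sumr -big_split/=; apply: eq_bigr => j _.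
    rewrite mulrDr; congr (_ + _); rewrite mulrCA; congr (h * _).
    by rewrite mulr_sumr; apply: eq_bigr => i _; ring.
  rewrite mulr_sumr mulr_sumr -sumrB -big_split/=; apply: eq_bigr => i _.
  rewrite -mulr_sumr /b [b in b * _ - _]mxE [X in (_ + X) * _ - _]mxE rVBE.
  by ring.
rewrite sumE.
have -> : A - A' - (\sum_(i < d) b ord0 i * g (E x) i -
   h * \sum_(i < d) g (E x) i *
      (v (x + pi a) ord0 i - v x ord0 i - \sum_(j < d) a ord0 j * D x i j)) =
  (A - A' - \sum_(i < d) b ord0 i * g (E x) i) + h * \sum_(i < d) g (E x) i *
      (v (x + pi a) ord0 i - v x ord0 i - \sum_(j < d) a ord0 j * D x i j) by ring.
rewrite (le_trans (ler_normD _ _))// normrM (ger0_norm h0).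
apply: (@le_trans _ _ (S * ((1 + h * K) * `|a|) ^+ 2 + h * (d%:R * (S * (K * `|a| ^+ 2))))).
  rewrite lerD ?ler_wpM2l// (le_trans t1)// ler_wpM2l// lerXn2r// nnegrE//.
  by rewrite mulr_ge0// addr_ge0// mulr_ge0.
have hh : S * (h * h) * K ^+ 2 * `|a| ^+ 2 <= S * h * K ^+ 2 * `|a| ^+ 2.
  rewrite !ler_wpM2r ?exprn_ge0// ler_wpM2l//.
  by rewrite -[leRHS]mulr1 ler_wpM2l.
rewrite -subr_ge0 in hh; rewrite -subr_ge0.
by apply: le_trans hh _; rewrite le_eqVlt; apply/orP; left; apply/eqP; ring.
Qed.

(* Up to [O(h^2)], [psi (x + h v) - psi x] is the sum of the
   [v_i x * (psi (x + h e_i) - psi x)]. Translation invariance moves the increments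
   from [psi] to the [v_i], where they add up to [O(h^2)] since [v] is solenoidal. *)
Lemma Rintegral_euler_step h v M K S B psi : 0 <= h -> 0 <= S ->
  solenoidal_C11 M K v -> C11 S psi -> measurable_fun setT psi ->
  (forall x, `|psi x| <= B) ->
  `|\int[L]_x psi (euler_step h v x) - \int[L]_x psi x| <=
    h ^+ 2 * (S * (M ^+ 2 + d%:R * M) + d%:R * K * B).
Proof.
move=> h0 S0 [bv [D [lv bD tD D0]]] [g [bg tg]] mpsi bpsi.
have bp : bounded_measurable psi by split=> //; exists B.
have bpE : bounded_measurable (fun x : torus => psi (euler_step h v x)).
  by apply: (bounded_measurable_comp bp); exact: measurable_euler_step bv.
pose e (i : 'I_d) : 'rV[R]_d := delta_mx ord0 i.
have M0 : 0 <= M by rewrite (le_trans _ (bv.2 0)).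
have eE i j : (h *: e i) ord0 j = if j == i then h else 0.
  by rewrite !mxE eqxx/=; case: eqP; rewrite ?mulr1 ?mulr0.
have he i : `|h *: e i| <= h.
  apply: rV_norm_le => // j; rewrite eE; case: ifP => _; first by rewrite ger0_norm.
  by rewrite normr0.
have sume i (f : 'I_d -> R) : \sum_(j < d) (h *: e i) ord0 j * f j = h * f i.
  rewrite (bigD1 i)//= eE eqxx big1 ?addr0// => j ji.
  by rewrite eE (negPf ji) mul0r.
pose F x := \sum_(i < d) v x ord0 i * (psi (x + pi (h *: e i)) - psi x).
have bvi i := bounded_field_coord i bv.
have bF1 i : bounded_measurable (fun x : torus => v x ord0 i * psi (x + pi (h *: e i))).
  by apply: bounded_measurableM => //; exact: bounded_measurable_shift.
have bF2 i : bounded_measurable (fun x : torus => v x ord0 i * psi x).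
  exact: bounded_measurableM.
have bF0 i : bounded_measurable (fun x : torus =>
    v x ord0 i * (psi (x + pi (h *: e i)) - psi x)).
  apply: bounded_measurableM => //; apply: bounded_measurableB => //.
  exact: bounded_measurable_shift.
have bF : bounded_measurable F by apply: bounded_measurable_sum.
have ptw x : `|psi (euler_step h v x) - psi x - F x| <= h ^+ 2 * (S * (M ^+ 2 + d%:R * M)).
  have vM i : `|v x ord0 i| <= M by rewrite (le_trans (rV_coord_le _ _))// bv.2.
  have t1 : `|psi (euler_step h v x) - psi x - \sum_(i < d) h * (v x ord0 i * g x i)|
      <= S * (h * M) ^+ 2.
    have := tg x (h *: v x); rewrite -/(euler_step h v x).
    under eq_bigr do rewrite mxE -mulrA.
    move=> t; rewrite (le_trans t)// ler_wpM2l// lerXn2r ?nnegrE ?mulr_ge0//.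
    by rewrite normrZ ger0_norm// ler_wpM2l// bv.2.
  have t2 : `|F x - \sum_(i < d) h * (v x ord0 i * g x i)| <= d%:R * (M * (S * h ^+ 2)).
    rewrite /F -sumrB; apply: norm_sum_ord_le => i; rewrite mulrCA -mulrBr normrM ler_pM//.
    have := tg x (h *: e i); rewrite sume => t; rewrite (le_trans t)//.
    by rewrite ler_wpM2l// lerXn2r ?nnegrE.
  rewrite (_ : _ - F x = (psi (euler_step h v x) - psi x
    - \sum_(i < d) h * (v x ord0 i * g x i)) - (F x - \sum_(i < d) h * (v x ord0 i * g x i))); last by ring.
  rewrite (le_trans (ler_normB _ _))// (le_trans (lerD t1 t2))//.
  by rewrite le_eqVlt; apply/orP; left; apply/eqP; ring.
have intF : \int[L]_x F x = \int[L]_x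
    (\sum_(i < d) (v (x - pi (h *: e i)) ord0 i - v x ord0 i) * psi x).
  have bv' i : bounded_measurable (fun x : torus => v (x - pi (h *: e i)) ord0 i).
    exact: (bounded_measurable_shift (- pi (h *: e i)) (bvi i)).
  rewrite !Rintegral_bm_sum//; last first.
    by move=> i; apply: bounded_measurableM => //; exact: bounded_measurableB.
  apply: eq_bigr => i _.
  under eq_Rintegral do rewrite mulrBr.
  rewrite Rintegral_bmB//.
  under [RHS]eq_Rintegral do rewrite mulrBl.
  rewrite Rintegral_bmB//; last exact: bounded_measurableM.
  congr (_ - _).
  rewrite -[RHS](Rintegral_torus_shift (pi (h *: e i))); last first.
    by case: (bounded_measurableM (bv' i) bp).
  by apply: eq_Rintegral => x _; rewrite addrK.
have bG : bounded_measurable (fun x : torus =>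
    \sum_(i < d) (v (x - pi (h *: e i)) ord0 i - v x ord0 i) * psi x).
  apply: bounded_measurable_sum => i; apply: bounded_measurableM => //.
  apply: bounded_measurableB => //.
  exact: (bounded_measurable_shift (- pi (h *: e i)) (bvi i)).
have b2 : `|\int[L]_x F x| <= h ^+ 2 * (d%:R * K * B).
  rewrite intF; apply: normr_Rintegral_bm => // x.
  rewrite -mulr_suml normrM.
  have -> : h ^+ 2 * (d%:R * K * B) = (d%:R * (K * h ^+ 2)) * B by ring.
  apply: ler_pM => //.
  (* The added terms sum to [h] times the trace, which is 0. Each summand becomes the quadratic
     remainder of [v] for the increment [- h e_i]. *)
  have -> : \sum_(i < d) (v (x - pi (h *: e i)) ord0 i - v x ord0 i) =
      \sum_(i < d) (v (x - pi (h *: e i)) ord0 i - v x ord0 i + h * D x i i).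
    by rewrite [RHS]big_split/= -mulr_sumr D0 mulr0 addr0.
  apply: norm_sum_ord_le => i; have := tD x (- (h *: e i)) i.
  rewrite tprojN; under eq_bigr do rewrite mxE mulNr.
  rewrite sumrN sume opprK normrN => t; rewrite (le_trans t)// ler_wpM2l//.
    by rewrite (le_trans _ (bD 0 i i)).
  by rewrite lerXn2r ?nnegrE.
rewrite -Rintegral_bmB//.
have -> : \int[L]_x (psi (euler_step h v x) - psi x) =
   \int[L]_x (psi (euler_step h v x) - psi x - F x) + \int[L]_x F x.
  rewrite -Rintegral_bmD//; last by do 2 apply: bounded_measurableB => //.
  by apply: eq_Rintegral => x _; rewrite subrK.
rewrite mulrDr (le_trans (ler_normD _ _))// lerD//.
apply: normr_Rintegral_bm => //.
by do 2 apply: bounded_measurableB => //.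
Qed.

End euler.

Section euler_scheme.
Variables (R : realType) (d : nat).
Local Notation torus := (torus R d).
Local Notation pi := (@tproj R d).
Local Notation L := (lebesgue_torus R d).
Implicit Types (v : torus -> 'rV[R]_d) (psi : torus -> R) (h S B : R).

(** The recursion peels off the first step, not the last: composed with [psi], the scheme is then a
    [C11] function composed with one Euler step. *)
Fixpoint euler h (W : nat -> torus -> 'rV[R]_d) (n : nat) (x : torus) : torus :=
  if n is n'.+1 then euler h (fun k => W k.+1) n' (euler_step h (W 0%N) x) else x.

Lemma torus_lip_dist v K : 0 <= K ->
  (forall x a, `|v (x + pi a) - v x| <= K * `|a|) ->
  forall x y, `|v x - v y| <= K * torus_dist x y.
Proof.
move=> K0 lv x y; apply/ler_addgt0Pl => e e0.
(* The distance is an infimum, so a slack is needed; [K + 1] guards against [K = 0]. *)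
have [a axy ha] : exists2 a, pi a = x - y & `|a| < torus_dist x y + e / (K + 1).
  by apply/torus_norm_ltP; rewrite ltrDl divr_gt0// ltr_wpDl.
have -> : x = y + pi a by rewrite axy addrC subrK.
rewrite (le_trans (lv _ _))// axy (addrC y) subrK.
rewrite (le_trans (ler_wpM2l K0 (ltW ha)))// mulrDr addrC lerD2r.
rewrite mulrCA ler_piMr//; first exact: ltW.
by rewrite ler_pdivrMr ?ltr_wpDl// mul1r lerDl.
Qed.

Lemma torus_dist_translate (x y z : torus) : torus_dist (x + z) (y + z) = torus_dist x y.
Proof. by rewrite /torus_dist opprD addrACA subrr addr0. Qed.

Lemma torus_dist_addr (x : torus) a b : torus_dist (x + pi a) (x + pi b) <= `|a - b|.
Proof.
by rewrite /torus_dist opprD addrACA subrr add0r -tprojB torus_norm_le.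
Qed.

Lemma torus_dist_euler_step h v K x y : 0 <= h -> 0 <= K ->
  (forall x a, `|v (x + pi a) - v x| <= K * `|a|) ->
  torus_dist (euler_step h v x) (euler_step h v y) <= (1 + h * K) * torus_dist x y.
Proof.
move=> h0 K0 lv; rewrite (le_trans (torus_distD (x + pi (h *: v y)) _ _))//.
rewrite torus_dist_translate addrC mulrDl mul1r lerD2l.
rewrite (le_trans (torus_dist_addr _ _ _))// -scalerBr normrZ ger0_norm//.
by rewrite -mulrA ler_wpM2l// torus_lip_dist.
Qed.

Section solenoidal.
Variables (M K h : R) (h0 : 0 <= h) (K0 : 0 <= K).
Implicit Types W : nat -> torus -> 'rV[R]_d.

Lemma measurable_euler W n : (forall k, solenoidal_C11 M K (W k)) ->
  measurable_fun setT (euler h W n).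
Proof.
elim: n W => [|n IH] W hW /=; first exact: measurable_id.
apply: measurableT_comp; first exact: IH.
by have [bv _] := hW 0%N; exact: measurable_euler_step bv.
Qed.

(** Discrete Gronwall: each step expands distances by at most [1 + h * K] and adds a defect of at
    most [h * eta]. *)
Lemma euler_error W n (x : nat -> torus) (z : torus) (eta : R) : 0 <= eta ->
  (forall k, solenoidal_C11 M K (W k)) ->
  (forall k, (k < n)%N -> torus_dist (x k.+1) (euler_step h (W k) (x k)) <= h * eta) ->
  torus_dist (euler h W n z) (x n) <=
    (1 + h * K) ^+ n * (torus_dist z (x 0%N) + n%:R * (h * eta)).
Proof.
move=> eta0; have q1 : 1 <= 1 + h * K by rewrite lerDl mulr_ge0.
elim: n W x z => [|n IH] W x z hW hx /=; first by rewrite expr0 mul0r addr0 mul1r.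
rewrite (le_trans (IH (fun k => W k.+1) (fun k => x k.+1) _ _ _))//.
  by move=> k kn; exact: hx.
rewrite exprSr -mulrA ler_wpM2l ?exprn_ge0 ?(le_trans ler01)//.
have [_ [D [lv _ _ _]]] := hW 0%N.
have := torus_dist_euler_step z (x 0%N) h0 K0 lv.
have := torus_distD (euler_step h (W 0%N) (x 0%N)) (euler_step h (W 0%N) z) (x 1%N).
have := hx 0%N isT; rewrite torus_distC => t1 t2 t3.
apply: (@le_trans _ _ ((1 + h * K) * torus_dist z (x 0%N) + n.+1%:R * (h * eta))).
  by rewrite -natr1; lra.
by rewrite mulrDr lerD2l ler_peMl// mulr_ge0// mulr_ge0.
Qed.

Let C := 2 * K + K ^+ 2 + d%:R * K.
Let C0 : 0 <= C. Proof. by rewrite !addr_ge0 ?mulr_ge0 ?exprn_ge0. Qed.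

Lemma C11_euler W n S psi : h <= 1 -> 0 <= S -> (forall k, solenoidal_C11 M K (W k)) ->
  C11 S psi -> C11 (S * (1 + h * C) ^+ n) (psi \o euler h W n).
Proof.
move=> h1 S0; elim: n W => [|n IH] W hW cpsi; first by rewrite expr0 mulr1.
rewrite exprSr mulrA /=.
have := IH (fun k => W k.+1) (fun k => hW k.+1) cpsi.
apply: (@C11_euler_step R d h (W 0%N) M K _ (psi \o euler h (fun k => W k.+1) n)) => //.
  by rewrite h0.
by rewrite mulr_ge0// exprn_ge0// addr_ge0// mulr_ge0.
Qed.

Lemma Rintegral_euler W n S B psi : h <= 1 -> 0 <= S ->
  (forall k, solenoidal_C11 M K (W k)) -> C11 S psi -> measurable_fun setT psi ->
  (forall x, `|psi x| <= B) ->
  `|\int[L]_x psi (euler h W n x) - \int[L]_x psi x| <=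
    n%:R * h ^+ 2 * (S * (1 + h * C) ^+ n * (M ^+ 2 + d%:R * M) + d%:R * K * B).
Proof.
move=> h1 S0; have q1 : 1 <= 1 + h * C by rewrite lerDl mulr_ge0.
elim: n W => [|n IH] W hW cpsi mpsi bpsi; first by rewrite /= subrr normr0 !mul0r.
have M0 : 0 <= M by have [[_ bM] _] := hW 0%N; rewrite (le_trans _ (bM 0)).
rewrite /= -(subrKA (\int[L]_x psi (euler h (fun k => W k.+1) n x))).
rewrite (le_trans (ler_normD _ _))//.
have cn := C11_euler n h1 S0 (fun k => hW k.+1) cpsi.
have Sn0 : 0 <= S * (1 + h * C) ^+ n.
  by rewrite mulr_ge0// exprn_ge0// (le_trans ler01).
have mn : measurable_fun setT (psi \o euler h (fun k => W k.+1) n).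
  by apply: measurableT_comp => //; exact: measurable_euler.
have := Rintegral_euler_step h0 Sn0 (hW 0%N) cn mn (fun x => bpsi _).
have := IH (fun k => W k.+1) (fun k => hW k.+1) cpsi mpsi bpsi.
set q := 1 + h * C in q1 Sn0 *; set A := M ^+ 2 + _; set B' := _ * B => t1 t2.
have A0 : 0 <= A by rewrite addr_ge0 ?exprn_ge0 ?mulr_ge0.
rewrite addrC (le_trans (lerD t1 t2))//.
apply: (@le_trans _ _ (n.+1%:R * h ^+ 2 * (S * q ^+ n * A + B'))).
  by rewrite -natr1; lra.
rewrite ler_wpM2l ?mulr_ge0 ?exprn_ge0// lerD2r ler_wpM2r// ler_wpM2l//.
by rewrite exprS ler_peMl// exprn_ge0// (le_trans ler01).
Qed.
End solenoidal.
End euler_scheme.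

(** * Flows of solenoidal fields preserve the measure *)

Section solenoidal_flow.
Variables (R : realType) (d : nat).
Local Notation torus := (torus R d).
Local Notation pi := (@tproj R d).
Local Notation L := (lebesgue_torus R d).
Variables (t M K : R) (t0 : 0 < t) (K0 : 0 <= K).
Variables (V : R -> torus -> 'rV[R]_d) (X : R -> torus -> torus).
Hypothesis hV : forall s, 0 <= s <= t -> solenoidal_C11 M K (V s).
Hypothesis hX0 : forall x, X 0 x = x.
(** The link between flow and field is the consistency of the Euler scheme, with a defect [o(h)]
    uniform in [s] and [x]. *)
Hypothesis hX : forall eta, 0 < eta -> exists2 h0 : R, 0 < h0 &
  forall h s x, 0 < h < h0 -> 0 <= s -> s + h <= t ->
    torus_dist (X (s + h) x) (euler_step h (V s) (X s x)) <= h * eta.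

Lemma expr_le_expR n (C : R) : 0 <= C -> (1 + t / n.+1%:R * C) ^+ n.+1 <= expR (t * C).
Proof.
move=> C0; have h0 : 0 <= t / n.+1%:R * C by rewrite mulr_ge0// divr_ge0// ltW.
have -> : expR (t * C) = expR (t / n.+1%:R * C) ^+ n.+1.
  by rewrite -expRM_natl mulrA (mulrC n.+1%:R) divfK// pnatr_eq0.
by rewrite lerXn2r ?nnegrE ?addr_ge0 ?expR_ge0// expR_ge1Dx.
Qed.

(** The minimum keeps the sampling time in [0, t] for every [k], also beyond the last step, so that
    all fields of the sequence are solenoidal. *)
Let W n (k : nat) := V (Num.min t (k%:R * (t / n.+1%:R))).
Let E n := euler (t / n.+1%:R) (W n) n.+1.

Let hW n k : solenoidal_C11 M K (W n k).
Proof.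
apply: hV; rewrite le_min ge_min lexx (ltW t0)/= andbT.
by rewrite mulr_ge0// divr_ge0// ltW.
Qed.

Let small_step (h0 : R) : 0 < h0 -> exists N, forall n, (N <= n)%N -> t / n.+1%:R < h0.
Proof.
move=> h00; exists (Num.trunc (t / h0)) => n nN.
rewrite ltr_pdivrMr// mulrC -ltr_pdivrMr//.
by rewrite (lt_le_trans (truncnS_gt _))// ler_nat.
Qed.

Lemma flow_euler_cvg (e : R) : 0 < e ->
  exists N, forall n, (N <= n)%N -> forall x, torus_dist (E n x) (X t x) <= e.
Proof.
move=> e0; pose eta := e / (expR (t * K) * t).
have eta0 : 0 < eta by rewrite divr_gt0// mulr_gt0// expR_gt0.
have [h0 h00 hh] := hX eta0; have [N hN] := small_step h00.
exists N => n nN x; set h := t / n.+1%:R; have hp : 0 < h by rewrite divr_gt0.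
have hn : n.+1%:R * h = t by rewrite /h mulrC divfK// pnatr_eq0.
have := @euler_error R d M K h (ltW hp) K0 (W n) n.+1 (fun k => X (k%:R * h) x) x eta
  (ltW eta0) (hW n).
rewrite hn mul0r hX0 torus_distxx add0r => H; apply: le_trans (H _) _.
  move=> k kn; have kt : k%:R * h + h <= t.
    by rewrite -hn -[X in _ + X]mul1r -mulrDl natr1 ler_wpM2r ?(ltW hp)// ler_nat.
  have -> : k.+1%:R * h = k%:R * h + h by rewrite -natr1 mulrDl mul1r.
  have WE : W n k = V (k%:R * h).
    by rewrite /W -/h min_r// (le_trans _ kt)// lerDl ltW.
  by rewrite WE; apply: hh => //; [rewrite hp hN|rewrite mulr_ge0// ltW].
rewrite (mulrA n.+1%:R) hn; have := expr_le_expR n K0; rewrite -/h => q.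
apply: (@le_trans _ _ (expR (t * K) * (t * eta))).
  by rewrite ler_wpM2r// mulr_ge0// ltW.
by rewrite /eta mulrA mulrC divfK// gt_eqF// mulr_gt0// expR_gt0.
Qed.

(** Measurability is inherited from the Euler maps, which converge to [X t]. *)
Lemma measurable_flow : measurable_fun setT (X t).
Proof.
apply: (@measurable_fun_torus_cvg _ _ _ _ E).
  move=> n; apply: (measurable_euler (M := M) (K := K)) => //.
move=> x; apply/cvgrPdist_le => e e0; have [N hN] := flow_euler_cvg e0.
near=> n; rewrite sub0r normrN ger0_norm ?torus_dist_ge0//; apply: hN.
by near: n; exact: nbhs_infty_ge.
Unshelve. all: end_near. Qed.

Lemma Rintegral_flow_C11 (psi : torus -> R) (S B C : R) : 0 <= S -> C11 S psi ->
  torus_lipschitz C psi -> (forall x, `|psi x| <= B) ->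
  \int[L]_x psi (X t x) = \int[L]_x psi x.
Proof.
move=> S0 cpsi lpsi bpsi.
have mpsi : measurable_fun setT psi.
  by apply: measurable_torus_continuous; exact: torus_lipschitz_continuous lpsi.
have bp : bounded_measurable psi by split=> //; exists B.
have bX : bounded_measurable (fun x : torus => psi (X t x)).
  by apply: (bounded_measurable_comp bp); exact: measurable_flow.
have bE n : bounded_measurable (fun x : torus => psi (E n x)).
  by apply: (bounded_measurable_comp bp); apply: (measurable_euler (M := M) (K := K)).
have M0 : 0 <= M by have [[_ bM] _] := hW 0 0%N; rewrite (le_trans _ (bM 0)).
have B0 : 0 <= B by rewrite (le_trans _ (bpsi 0)).
apply/eqP; rewrite -subr_eq0 -normr_le0; apply/ler_addgt0Pl => e e0; rewrite addr0.
pose D := 2 * K + K ^+ 2 + d%:R * K.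
have D0 : 0 <= D by rewrite !addr_ge0 ?mulr_ge0 ?exprn_ge0.
pose Q := t * (S * expR (t * D) * (M ^+ 2 + d%:R * M) + d%:R * K * B).
have Q0 : 0 <= Q.
  by rewrite mulr_ge0 ?(ltW t0)// addr_ge0 ?mulr_ge0 ?addr_ge0 ?exprn_ge0 ?expR_ge0 ?mulr_ge0.
have C1 : 0 < `|C| + 1 by rewrite ltr_wpDl.
have Q1 : 0 < Q + 1 by rewrite ltr_wpDl.
have e2 : 0 < e / 2 / (`|C| + 1) by rewrite !divr_gt0.
have [N1 hN1] := flow_euler_cvg e2.
(* The bound 1 is required by the [C11] estimates; the other one makes the Euler defect, at most
   [h * Q], less than [e / 2]. *)
have q0 : 0 < Num.min 1 (e / 2 / (Q + 1)) by rewrite lt_min ltr01 !divr_gt0.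
have [N2 hN2] := small_step q0.
pose n := maxn N1 N2; have := hN1 n (leq_maxl _ _) => h1.
have := hN2 n (leq_maxr _ _); set h := t / _; rewrite lt_min => /andP[h1' hQ].
have hp : 0 < h by rewrite divr_gt0.
rewrite -(subrKA (\int[L]_x psi (E n x))) (le_trans (ler_normD _ _))// (splitr e) lerD//.
  rewrite -Rintegral_bmB//; apply: normr_Rintegral_bm; first exact: bounded_measurableB.
  move=> x; rewrite (le_trans (lpsi _ _))// torus_distC.
  apply: (@le_trans _ _ ((`|C| + 1) * (e / 2 / (`|C| + 1)))).
    rewrite (le_trans (ler_wpM2r (torus_dist_ge0 _ _) (ler_norm _)))//.
    by apply: ler_pM; rewrite ?torus_dist_ge0 ?lerDl.
  by rewrite mulrC divfK// gt_eqF.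
have := @Rintegral_euler R d M K h (ltW hp) K0 (W n) n.+1 S B psi (ltW h1') S0 (hW n) cpsi mpsi bpsi.
move=> H; rewrite (le_trans H)//.
apply: (@le_trans _ _ (h * (Q + 1))); last by rewrite ltW// -ltr_pdivlMr.
have -> : n.+1%:R * h ^+ 2 = h * t.
  by rewrite expr2 mulrA mulrC (mulrC n.+1%:R) divfK// pnatr_eq0.
rewrite -mulrA ler_wpM2l ?(ltW hp)//; apply: (@le_trans _ _ Q); last by rewrite lerDl.
rewrite /Q ler_wpM2l ?(ltW t0)// lerD2r ler_wpM2r ?addr_ge0 ?exprn_ge0 ?mulr_ge0//.
by rewrite ler_wpM2l//; exact: expr_le_expR.
Qed.

(** A Lipschitz function is uniformly close to its mollification, which is [C11]. *)
Lemma Rintegral_flow_lipschitz (psi : torus -> R) (B C : R) : (0 < d)%N ->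
  (forall r, 0 < r -> exists rho : torus -> R, smooth_kernel rho r) ->
  torus_lipschitz C psi -> (forall x, `|psi x| <= B) ->
  \int[L]_x psi (X t x) = \int[L]_x psi x.
Proof.
move=> d0 kern lpsi bpsi; pose i0 := Ordinal d0.
have mpsi : measurable_fun setT psi.
  by apply: measurable_torus_continuous; exact: torus_lipschitz_continuous lpsi.
have bp : bounded_measurable psi by split=> //; exists B.
have bX : bounded_measurable (fun x : torus => psi (X t x)).
  by apply: (bounded_measurable_comp bp); exact: measurable_flow.
have B0 : 0 <= B by rewrite (le_trans _ (bpsi 0)).
apply/eqP; rewrite -subr_eq0 -normr_le0; apply/ler_addgt0Pl => e e0; rewrite addr0.
have C1 : 0 < `|C| + 1 by rewrite ltr_wpDl.
pose r := e / 2 / (`|C| + 1); have r0 : 0 < r by rewrite !divr_gt0.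
have [rho krho] := kern r r0.
(* Convolution is defined for vector fields: [psi] is put in every coordinate and coordinate [i0] is
   read off. *)
pose w (x : torus) : 'rV[R]_d := \row_(i < d) psi x.
have bw : bounded_field B w.
  split=> [i|x]; first by under eq_fun do rewrite mxE.
  by apply: rV_norm_le => // i; rewrite mxE.
pose phi x := torus_conv w rho x ord0 i0.
have [A A0 hA] := torus_conv_taylor krho; have [lw bD tw] := hA w B bw.
have phipsi x : `|phi x - psi x| <= e / 2.
  have -> : psi x = w x ord0 i0 by rewrite mxE.
  rewrite /phi -rVBE (le_trans (rV_coord_le _ _))//.
  apply: (torus_conv_near krho bw); first by rewrite divr_ge0// ltW.
  move=> y xy; apply: rV_norm_le => [|i]; first by rewrite divr_ge0// ltW.
  rewrite rVBE !mxE (le_trans (lpsi _ _))// torus_distC.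
  apply: (@le_trans _ _ ((`|C| + 1) * r)); last by rewrite mulrC divfK// gt_eqF.
  rewrite (le_trans (ler_wpM2r (torus_dist_ge0 _ _) (ler_norm _)))//.
  by apply: ler_pM; rewrite ?torus_dist_ge0 ?lerDl// ltW.
have lphi : torus_lipschitz (B * A) phi.
  move=> x y; rewrite /phi -rVBE (le_trans (rV_coord_le _ _))//.
  by apply: torus_lip_dist => //; rewrite mulr_ge0.
have bphi x : `|phi x| <= B.
  by rewrite (le_trans (rV_coord_le _ _))//; exact: (torus_conv_le krho).
have cphi : C11 (B * A) phi.
  exists (fun x j => conv_partial rho w x i0 j); split=> [x j|x a]; first exact: bD.
  exact: tw.
clearbody phi.
have BA : 0 <= B * A by rewrite mulr_ge0.
have eq1 := Rintegral_flow_C11 BA cphi lphi bphi.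
have mphi : measurable_fun setT phi.
  by apply: measurable_torus_continuous; exact: torus_lipschitz_continuous lphi.
have bp' : bounded_measurable phi by split=> //; exists B.
have bX' : bounded_measurable (fun x : torus => phi (X t x)).
  by apply: (bounded_measurable_comp bp'); exact: measurable_flow.
rewrite -(subrKA (\int[L]_x phi (X t x))) (le_trans (ler_normD _ _))// (splitr e) lerD//.
  rewrite -Rintegral_bmB//; apply: normr_Rintegral_bm; first exact: bounded_measurableB.
  by move=> x; rewrite distrC.
rewrite eq1 -Rintegral_bmB//; apply: normr_Rintegral_bm; first exact: bounded_measurableB.
by [].
Qed.

End solenoidal_flow.

(** * Regularity in time *)

Section time_regularity.
Variables (R : realType) (d : nat).
Local Notation torus := (torus R d).
Local Notation pi := (@tproj R d).
Implicit Types (v : torus -> 'rV[R]_d) (u : R -> torus -> 'rV[R]_d).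

Lemma holder_norm_ge alpha v :
  (forall x, (`|v x|%:E <= holder_norm alpha v)%E) /\
  (forall x y, ((`|v x - v y| / torus_dist x y `^ alpha)%:E <= holder_norm alpha v)%E).
Proof.
rewrite /holder_norm; set A := ereal_sup _; set B := ereal_sup _.
have hA x : (`|v x|%:E <= A)%E by apply: ereal_sup_ubound; exists x.
have hB x y : ((`|v x - v y| / torus_dist x y `^ alpha)%:E <= B)%E.
  by apply: ereal_sup_ubound; exists (x, y).
have A0 : (0 <= A)%E by apply: le_trans (hA 0); rewrite lee_fin.
have B0 : (0 <= B)%E.
  by apply: le_trans (hB 0 0); rewrite lee_fin divr_ge0// powR_ge0.
split=> [x|x y]; first by apply: (le_trans (hA x)); rewrite leeDl.
by apply: (le_trans (hB x y)); rewrite leeDr.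
Qed.

Definition uniformly_continuous_field v := forall e, 0 < e -> exists2 r : R, 0 < r &
  forall x y, torus_dist x y < r -> `|v x - v y| <= e.

Lemma holder_norm_fine alpha v : (holder_norm alpha v < +oo)%E ->
  [/\ 0 <= fine (holder_norm alpha v), forall x, `|v x| <= fine (holder_norm alpha v) &
  forall x y, `|v x - v y| / torus_dist x y `^ alpha <= fine (holder_norm alpha v)].
Proof.
move=> Noo; have [h1 h2] := holder_norm_ge alpha v.
have N0 : (0 <= holder_norm alpha v)%E by apply: le_trans (h1 0); rewrite lee_fin.
have Nfin : holder_norm alpha v \is a fin_num by rewrite ge0_fin_numE.
split; first exact: fine_ge0.
  by move=> x; rewrite -lee_fin fineK.
by move=> x y; rewrite -lee_fin fineK.
Qed.

Lemma holder_norm_uniformly_continuous alpha v : 0 < alpha ->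
  (holder_norm alpha v < +oo)%E -> uniformly_continuous_field v.
Proof.
move=> al0 /holder_norm_fine[]; set N := holder_norm _ _ => N0 _ hB.
move=> e e0; have H1 : 0 < fine N + 1 by rewrite ltr_wpDl.
pose q := e / (fine N + 1); have q0 : 0 < q by rewrite divr_gt0.
(* The distance raised to the power [alpha] is then less than [q]. *)
exists (q `^ alpha^-1); first by rewrite powR_gt0.
(* At distance 0 the Hoelder quotient is 0 by convention and says nothing, but then [x = y]. *)
move=> x y xy; have [/torus_dist_eq0 ->|xy0] := eqVneq (torus_dist x y) 0.
  by rewrite subrr normr0 ltW.
have dp : 0 < torus_dist x y by rewrite lt_neqAle eq_sym xy0 torus_dist_ge0.
have dq : torus_dist x y `^ alpha < q.
  have -> : q = (q `^ alpha^-1) `^ alpha.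
    by rewrite -powRrM mulVf ?gt_eqF// powRr1// ltW.
  by rewrite gt0_ltr_powR// nnegrE ?torus_dist_ge0 ?powR_ge0.
have := hB x y; rewrite ler_pdivrMr ?powR_gt0// => h; apply: (le_trans h).
apply: (@le_trans _ _ ((fine N + 1) * q)); last by rewrite mulrC divfK// gt_eqF.
by apply: ler_pM; rewrite ?powR_ge0 ?lerDl// ltW.
Qed.

Lemma uniformly_continuous_field_measurable v : uniformly_continuous_field v ->
  forall i, measurable_fun setT (fun x => v x ord0 i).
Proof.
move=> uv i; apply: measurable_torus_continuous => x e e0.
have e2 : 0 < e / 2 by rewrite divr_gt0.
have [r r0 hr] := uv _ e2; exists r => // y xy.
rewrite -rVBE (le_lt_trans (rV_coord_le _ _))// (le_lt_trans (hr _ _ xy))//.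
by rewrite ltr_pdivrMr// ltr_pMr// ltr1n.
Qed.

Variables (T alpha : R) (T0 : 0 < T) (alpha0 : 0 < alpha).

Lemma continuous_holderP u : continuous_holder alpha T u ->
  forall t e, 0 <= t <= T -> 0 < e -> exists2 r : R, 0 < r &
    forall s, 0 <= s <= T -> `|s - t| < r -> forall x, `|u s x - u t x| <= e.
Proof.
move=> cu t e t0T e0.
have := cu t t0T; move=> /(_ [set y : \bar R | (y < e%:E)%E]) h.
have /h : nbhs (0%E : \bar R) [set y : \bar R | (y < e%:E)%E].
  by exists e => //= y; rewrite /ball/= sub0r normrN => hy; rewrite lte_fin (le_lt_trans (ler_norm _)).
rewrite nbhs_simpl /= => /nbhs_ballP[r /= r0 hr].
exists r => // s s0T st x.
have /= := hr s; rewrite /ball/= distrC => /(_ st).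
have sT : `[0, T]%classic s by rewrite /= in_itv.
move=> /(_ sT) hlt; have [/(_ x) h1 _] := holder_norm_ge alpha (fun x => u s x - u t x).
by rewrite -lee_fin ltW// (le_lt_trans h1).
Qed.


(* The consequences of [Ck_holder] that the proof uses; they no longer mention
   [k] or the Hoelder exponent. *)
Definition regular_field M u :=
  [/\ forall t, 0 <= t <= T -> bounded_field M (u t),
      forall t, 0 <= t <= T -> uniformly_continuous_field (u t) &
      forall e, 0 < e -> exists2 h0 : R, 0 < h0 & forall s t, 0 <= s <= T ->
        0 <= t <= T -> `|s - t| < h0 -> forall x, `|u s x - u t x| <= e].

(** Compactness of [0, T], in its near-covering form, makes the estimates uniform in time: along [n]
    going to infinity for the bound, along [h] going to 0 from the right for the modulus of
    continuity. *)
Lemma Ck_holder_regular k u : Ck_holder k alpha T u -> exists M, regular_field M u.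
Proof.
move=> hu; have [fu cu] : (forall t : R, 0 <= t <= T -> (holder_norm alpha (u t) < +oo)%E)
    /\ continuous_holder alpha T u by case: k hu => [|k] [? [? _]].
have ct := continuous_holderP cu.
have cov := (compact_near_coveringP _).1 (@segment_compact R 0 T).
have [M hM] : exists M : R, forall t, 0 <= t <= T -> forall x, `|u t x| <= M.
  have H : \forall n \near \oo, `[0, T]%classic `<=`
      (fun t => 0 <= t <= T -> forall x, `|u t x| <= n%:R).
    apply: (cov nat _ (fun n t => 0 <= t <= T -> forall x, `|u t x| <= n%:R)).
    move=> t; rewrite /= in_itv/= => t0T.
    have [_ hB _] := holder_norm_fine (fu t t0T); set B := fine _ in hB.
    have [r r0 hr] := ct t 1 t0T ltr01.
    exists ([set s | `|s - t| < r], [set n : nat | B + 1 <= n%:R]).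
      split=> /=; last exact: nbhs_infty_ger.
      by apply/nbhs_ballP; exists r => //= s; rewrite /ball/= distrC.
    move=> [s n] [/= st Bn] s0T x.
    rewrite -[u s x](subrK (u t x)) (le_trans (ler_normD _ _))// (le_trans _ Bn)//.
    by rewrite addrC lerD// hr.
  have [n Hn] := filter_ex H; exists n%:R => t t0T.
  by apply: Hn => //; rewrite /= in_itv.
exists M; split=> [t t0T|t t0T|e e0].
- split; last exact: hM.
  by apply: uniformly_continuous_field_measurable; apply: holder_norm_uniformly_continuous (fu t t0T).
- exact: holder_norm_uniformly_continuous (fu t t0T).
have H : \forall h \near (0 : R)^'+, `[0, T]%classic `<=`
    (fun t => forall s, 0 <= s <= T -> 0 <= t <= T -> `|s - t| < h ->
      forall x, `|u s x - u t x| <= e).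
  apply: (cov R _ (fun h t => forall s, 0 <= s <= T -> 0 <= t <= T -> `|s - t| < h ->
      forall x, `|u s x - u t x| <= e)).
  move=> t; rewrite /= in_itv/= => t0T.
  have e2 : 0 < e / 2 by rewrite divr_gt0.
  have [r r0 hr] := ct t (e / 2) t0T e2.
  (* Half the radius for the centre, half for the increment, as for a Lebesgue number. *)
  exists ([set s | `|s - t| < r / 2], [set h : R | h < r / 2]).
    split=> /=; last by apply: nbhs_right_lt; rewrite divr_gt0.
    by apply/nbhs_ballP; exists (r / 2) => /=; [rewrite divr_gt0|move=> s; rewrite /ball/= distrC].
  move=> [t' h] [/= tt' hr'] s s0T t'0T st' x.
  rewrite -(subrKA (u t x)) (le_trans (ler_normD _ _))// (splitr e) lerD//.
    apply: hr => //; rewrite -(subrKA t') (le_lt_trans (ler_normD _ _))// (splitr r) ltrD//.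
    exact: lt_trans hr'.
  rewrite distrC; apply: hr => //; rewrite (lt_le_trans tt')//.
  by rewrite ler_pdivrMr// ler_peMr ?ler1n// ltW.
have [h [h0 Hh]] : exists h : R, 0 < h /\ `[0, T]%classic `<=`
    (fun t => forall s, 0 <= s <= T -> 0 <= t <= T -> `|s - t| < h ->
      forall x, `|u s x - u t x| <= e).
  near (0 : R)^'+ => h; exists h; split; near: h; [exact: nbhs_right_gt|exact: H].
by exists h => // s t s0T t0T; apply: Hh => //; rewrite /= in_itv.
Unshelve. all: end_near. Qed.

End time_regularity.

(** * Characteristics *)

Section characteristics.
Variables (R : realType) (d : nat).
Local Notation torus := (torus R d).
Local Notation pi := (@tproj R d).
Local Notation L := (lebesgue_torus R d).
Local Notation mu := (@completed_lebesgue_measure R).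
Local Notation CR := (caratheodory_type ((wlength (@idfun R))^*)%mu).
Implicit Types (V : R -> torus -> 'rV[R]_d) (gamma : R -> torus).

Lemma measurable_completed (A : set R) :
  measurable (A : set (measurableTypeR R)) -> measurable (A : set CR).
Proof. exact: sub_caratheodory. Qed.

Lemma measurable_completed_itv (i : interval R) : measurable ([set` i] : set CR).
Proof. by apply: measurable_completed; exact: measurable_itv. Qed.

Lemma integrable_cst_fin d0 (S : measurableType d0) (m : {measure set S -> \bar R})
    (D : set S) (c : R) : measurable D -> (m D < +oo)%E ->
  m.-integrable D (EFin \o (fun=> c)).
Proof.
move=> mD mDoo; apply/integrableP; split; first exact: measurable_cst.
by rewrite integral_cst// lte_mul_pinfty// lee_fin.
Qed.

Lemma normr_Rintegral_le d0 (S : measurableType d0) (m : {measure set S -> \bar R})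
    (D : set S) (f : S -> R) (B : R) : measurable D -> (m D < +oo)%E ->
  m.-integrable D (EFin \o f) -> (forall x, D x -> `|f x| <= B) ->
  `|\int[m]_(x in D) f x| <= B * fine (m D).
Proof.
move=> mD mDoo fi fB; rewrite (le_trans (le_normr_Rintegral _ _))//.
rewrite -Rintegral_cst//; apply: le_Rintegral => //.
- by apply: integrable_norm.
- exact: integrable_cst_fin.
Qed.

Lemma completed_itvE (a b : R) : a <= b ->
  mu `]a, b] = (b - a)%:E /\ mu `[a, b] = (b - a)%:E.
Proof.
move=> ab; have E (A : set R) : mu A = lebesgue_measure A by [].
rewrite !E !lebesgue_measure_itv/= !lte_fin.
move: ab; rewrite le_eqVlt => /predU1P[->|->]; first by rewrite ltxx subrr.
by rewrite -EFinD.
Qed.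

Lemma characteristic_integrable T V x gamma i (A : set CR) : characteristic T V x gamma ->
  measurable A -> A `<=` `[0, T] -> mu.-integrable A (EFin \o (fun s => V s (gamma s) ord0 i)).
Proof.
move=> [fi _] mA AT; apply: integrableS (fi i) => //.
exact: measurable_completed_itv.
Qed.

(** With [c = 0] this is Lipschitz continuity in time; with the velocity at time [s] it is the
    consistency of the Euler scheme. *)
Lemma characteristic_increment T V x gamma (s h eta : R) (c : 'rV[R]_d) :
  characteristic T V x gamma -> 0 <= s -> 0 <= h -> s + h <= T ->
  0 <= eta -> (forall r, s <= r <= s + h -> `|V r (gamma r) - c| <= eta) ->
  torus_dist (gamma (s + h)) (gamma s + pi (h *: c)) <= h * eta.
Proof.
move=> ch s0 h0 shT eta0 hc; have [_ eq] := ch.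
have ssh : s <= s + h by rewrite lerDl.
rewrite (eq (s + h)); last by rewrite shT addr_ge0.
rewrite (eq s); last by rewrite s0 (le_trans ssh).
rewrite -addrA -tprojD; apply: (le_trans (torus_dist_addr _ _ _)).
apply: rV_norm_le => [|i]; first exact: mulr_ge0.
rewrite rVBE mxE [X in _ - X]mxE mxE [X in _ - (_ + X)]mxE.
pose f r := V r (gamma r) ord0 i.
have m1 := measurable_completed_itv `[0, s].
have m2 := measurable_completed_itv `]s, s + h].
have fi1 : mu.-integrable `]s, s + h] (EFin \o f).
  apply: (characteristic_integrable i ch) => // r; rewrite /= !in_itv/= => /andP[sr rs].
  by rewrite (ltW (le_lt_trans s0 sr)) (le_trans rs).
have mu2 : mu `]s, s + h] = h%:E.
  by have [-> _] := completed_itvE ssh; rewrite addrC addKr.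
have setE : `[0, s + h]%classic = `[0, s]%classic `|` `]s, s + h]%classic :> set R.
  by rewrite -(@itv_bndbnd_setU _ _ (BLeft 0) (BRight s) (BRight (s + h)))// bnd_simp.
rewrite setE Rintegral_setU//; last 2 first.
- apply: (characteristic_integrable i ch); first exact: measurableU.
  rewrite -setE => r; rewrite /= !in_itv/= => /andP[-> /= rs]; exact: le_trans shT.
- apply/disj_setPS => r [] /=; rewrite !in_itv/= => /andP[_ rs] /andP[sr _].
  by move: sr; rewrite ltNge rs.
rewrite [X in X - _]addrC addrKA.
have ci : mu.-integrable `]s, s + h] (EFin \o (fun=> c ord0 i)).
  by apply: integrable_cst_fin => //; rewrite [ltLHS]mu2 ltry.
have -> : h * c ord0 i = \int[mu]_(r in `]s, s + h]) c ord0 i.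
  by rewrite Rintegral_cst// mulrC; congr (_ * _); exact: esym (congr1 fine mu2).
rewrite -RintegralB//.
have -> : h * eta = eta * fine (mu `]s, s + h]).
  by rewrite mulrC; congr (_ * _); exact: esym (congr1 fine mu2).
apply: normr_Rintegral_le => //.
- by rewrite [ltLHS]mu2 ltry.
- exact: (integrableB m2 fi1 ci).
move=> r; rewrite /= in_itv/= => /andP[sr rs].
by rewrite -rVBE (le_trans (rV_coord_le _ _))// hc// (ltW sr).
Qed.

Lemma characteristic0 T V x gamma : 0 <= T -> characteristic T V x gamma -> gamma 0 = x.
Proof.
move=> T0 ch; have [_ ->] := ch; last by rewrite lexx.
rewrite (_ : \row__ _ = 0) ?tproj0 ?addr0//; apply/rowP => i; rewrite !mxE.
apply/eqP; rewrite -normr_le0.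
have [_ mu0] := completed_itvE (lexx (0 : R)); rewrite subrr in mu0.
have m0 := measurable_completed_itv `[0, 0].
have sub0 : (`[0, 0]%classic : set R) `<=` `[0, T]%classic.
  by move=> r; rewrite /= !in_itv/= => /andP[-> /le_trans ->].
have := @normr_Rintegral_le _ _ mu `[0, 0] (fun s => V s (gamma s) ord0 i)
  `|V 0 (gamma 0) ord0 i| m0.
rewrite [X in fine X]mu0 mulr0; apply.
- by rewrite [ltLHS]mu0 ltry.
- exact: (characteristic_integrable i ch).
- by move=> r; rewrite /= in_itv/= -eq_le => /eqP <-.
Qed.

Lemma characteristic_lipschitz T V x gamma (M s r : R) : 0 <= M ->
  characteristic T V x gamma -> (forall q y, 0 <= q <= T -> `|V q y| <= M) ->
  0 <= s <= T -> 0 <= r <= T -> torus_dist (gamma s) (gamma r) <= M * `|s - r|.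
Proof.
move=> M0 ch VM.
wlog sr : s r / r <= s => [H|] sT rT.
  have [/H|/ltW/H] := leP r s; first exact.
  by rewrite torus_distC distrC; exact.
have := @characteristic_increment T V x gamma r (s - r) M 0 ch.
move: sT rT => /andP[s0 sT] /andP[r0 rT].
rewrite subrKC scaler0 tproj0 addr0 ger0_norm ?subr_ge0// [(s - r) * M]mulrC.
apply => // q /andP[rq qs]; rewrite subr0 VM// (le_trans r0)//=.
exact: le_trans sT.
Qed.

End characteristics.

(** * The flow of the mollified field *)

Section mollified_flow.
Variables (R : realType) (d : nat).
Local Notation torus := (torus R d).
Local Notation pi := (@tproj R d).
Local Notation L := (lebesgue_torus R d).
Variables (T M : R) (T0 : 0 < T) (u : R -> torus -> 'rV[R]_d).
Hypothesis u_reg : regular_field T M u.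
Hypothesis u_div : forall t : R, 0 <= t <= T -> weakly_divergence_free (u t).

Lemma regular_field_ge0 : 0 <= M.
Proof.
have [bu _ _] := u_reg; have [|_ /(_ 0)] := bu 0; first by rewrite lexx ltW.
exact: le_trans.
Qed.

Variables (rho : torus -> R) (r : R) (krho : smooth_kernel rho r).
Let V (t : R) := torus_conv (u t) rho.

Lemma mollified_solenoidal : exists2 K : R, 0 <= K &
  forall t, 0 <= t <= T -> solenoidal_C11 M K (V t).
Proof.
have [bu _ _] := u_reg; have M0 := regular_field_ge0.
have [K K0 hK] := torus_conv_taylor krho.
exists (M * K) => [|t tT]; first exact: mulr_ge0.
have [lV bD tV] := hK _ _ (bu t tT).
split; last first.
  exists (conv_partial rho (u t)); split=> // x.
  exact: (conv_divergence_free krho x (bu t tT) (u_div tT)).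
split=> [i|x]; last exact: (torus_conv_le krho _ (bu t tT)).
apply: measurable_torus_continuous.
apply: (@torus_lipschitz_continuous _ _ (M * K)) => x y.
rewrite -rVBE (le_trans (rV_coord_le _ _))//.
by apply: torus_lip_dist => //; exact: mulr_ge0.
Qed.

Variable X : R -> torus -> torus.
Hypothesis X_flow : forall x, characteristic T V x (fun t => X t x).

Lemma mollified_le t x : 0 <= t <= T -> `|V t x| <= M.
Proof. by have [bu _ _] := u_reg => tT; exact: (torus_conv_le krho _ (bu t tT)). Qed.

Lemma mollified_flow_lipschitz s t x : 0 <= s <= T -> 0 <= t <= T ->
  torus_dist (X s x) (X t x) <= M * `|s - t|.
Proof.
apply: (characteristic_lipschitz (gamma := fun t => X t x)) (X_flow x) _.
  exact: regular_field_ge0.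
by move=> q y; exact: mollified_le.
Qed.

(** During one step the velocity varies with time, by no more than [u] does since averaging keeps
    the bound, and with position, by at most [K] times the distance [M * h] travelled. *)
Lemma mollified_flow_consistent (eta : R) : 0 < eta -> exists2 h0 : R, 0 < h0 &
  forall h s x, 0 < h < h0 -> 0 <= s -> s + h <= T ->
    torus_dist (X (s + h) x) (euler_step h (V s) (X s x)) <= h * eta.
Proof.
move=> eta0; have [bu _ cu] := u_reg; have M0 := regular_field_ge0.
have [K K0 sV] := mollified_solenoidal.
have e2 : 0 < eta / 2 by rewrite divr_gt0.
have [h1 h10 hu] := cu _ e2.
have KM1 : 0 < K * M + 1 by rewrite ltr_wpDl// mulr_ge0.
exists (Num.min h1 (eta / 2 / (K * M + 1))); first by rewrite lt_min h10 divr_gt0.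
move=> h s x /andP[h0]; rewrite lt_min => /andP[hh1 hh2] s0 shT.
apply: (characteristic_increment (X_flow x)) => //; [exact: ltW|exact: ltW|].
move=> q /andP[sq qsh].
have sT : 0 <= s <= T by rewrite s0 (le_trans _ shT)// lerDl ltW.
have qT : 0 <= q <= T by rewrite (le_trans s0)// (le_trans qsh).
have qs : `|q - s| <= h by rewrite ger0_norm ?subr_ge0// lerBlDl.
rewrite -(subrKA (V s (X q x))) (le_trans (ler_normD _ _))// (splitr eta) lerD//.
  apply: (torus_conv_dist_le krho _ (bu q qT) (bu s sT)).
  by apply: hu => //; exact: le_lt_trans hh1.
have [_ [_ [lV _ _ _]]] := sV s sT.
rewrite (le_trans (torus_lip_dist K0 lV _ _))//.
rewrite (le_trans (ler_wpM2l K0 (mollified_flow_lipschitz x qT sT)))//.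
apply: (@le_trans _ _ ((K * M + 1) * (eta / 2 / (K * M + 1)))); last first.
  by rewrite mulrC divfK// gt_eqF.
rewrite (mulrA K); apply: ler_pM; rewrite ?lerDl ?mulr_ge0//.
by rewrite (le_trans qs)// ltW.
Qed.

Lemma mollified_flow0 x : X 0 x = x.
Proof. exact: characteristic0 (ltW T0) (X_flow x). Qed.

Lemma mollified_flow_preserves t : 0 <= t <= T -> (0 < d)%N ->
  (forall e : R, 0 < e -> exists sigma : torus -> R, smooth_kernel sigma e) ->
  measurable_fun setT (X t) /\
  forall (psi : torus -> R) (B C : R), torus_lipschitz C psi ->
    (forall x, `|psi x| <= B) -> \int[L]_x psi (X t x) = \int[L]_x psi x.
Proof.
(* The Euler argument is set up for positive times; at time 0 the flow is the identity. *)
move=> /andP[]; rewrite le_eqVlt => /predU1P[<-|t0] tT d0 kern.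
  rewrite (_ : X 0 = id); first by split=> //; exact: measurable_id.
  by apply/funext => x; exact: mollified_flow0.
have [K K0 sV] := mollified_solenoidal.
have sVt s : 0 <= s <= t -> solenoidal_C11 M K (V s).
  by move=> /andP[s0 st]; apply: sV; rewrite s0 (le_trans st).
have cons (eta : R) : 0 < eta -> exists2 h0 : R, 0 < h0 &
    forall h s x, 0 < h < h0 -> 0 <= s -> s + h <= t ->
    torus_dist (X (s + h) x) (euler_step h (V s) (X s x)) <= h * eta.
  move=> /mollified_flow_consistent[h0 h00 hh]; exists h0 => // h s x hh0 s0 sht.
  by apply: hh => //; exact: le_trans tT.
split; first exact: (measurable_flow t0 K0 sVt mollified_flow0 cons).
move=> psi B C lpsi bpsi.
exact: (Rintegral_flow_lipschitz t0 K0 sVt mollified_flow0 cons d0 kern lpsi bpsi).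
Qed.

(** [L1_maps] wants maps measurable on the whole line times the torus, while the flow is controlled
    on [0, T] only; it is frozen outside. *)
Definition clamp (t : R) : R := Num.min T (Num.max 0 t).

Lemma clamp_itv t : 0 <= clamp t <= T.
Proof. by rewrite /clamp le_min ge_min lexx le_max lexx (ltW T0). Qed.

Lemma clamp_id t : 0 <= t <= T -> clamp t = t.
Proof. by move=> /andP[t0 tT]; rewrite /clamp max_r// min_r. Qed.

Lemma clamp_lipschitz s t : `|clamp s - clamp t| <= `|s - t|.
Proof.
rewrite /clamp ler_norml.
have := ler_norm (s - t); have := ler_norm (t - s); rewrite distrC.
move: (`|_|) => a; rewrite !minElt !maxElt.
by do ![case: ifPn]; rewrite -?leNgt; move=> *; apply/andP; split; lra.
Qed.

(** The flow is measurable in space and Lipschitz in time, so it is the limit of the maps whose time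
    is rounded down to a grid. *)
Lemma measurable_mollified_flow : (0 < d)%N ->
  (forall e : R, 0 < e -> exists sigma : torus -> R, smooth_kernel sigma e) ->
  measurable_fun setT (fun z : measurableTypeR R * torus => X (clamp z.1) z.2).
Proof.
move=> d0 kern; have M0 := regular_field_ge0.
pose q (n : nat) (s : R) : int := Num.floor (n.+1%:R * s).
pose p (n : nat) (k : int) : R := k%:~R / n.+1%:R.
apply: (@measurable_fun_torus_cvg _ _ _ _
  (fun n (z : measurableTypeR R * torus) => X (clamp (p n (q n z.1))) z.2)).
  move=> n; apply: (measurable_fun_pieces
    (q := fun z : measurableTypeR R * torus => q n z.1)
    (F := fun k (z : measurableTypeR R * torus) => X (clamp (p n k)) z.2)) => k.
    rewrite (_ : _ @^-1` _ = (fun z : measurableTypeR R * torus => n.+1%:R * z.1) @^-1`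
        `[k%:~R, (k + 1)%:~R[%classic).
      rewrite -[X in measurable X]setTI.
      have mm : measurable_fun setT (fun z : measurableTypeR R * torus => n.+1%:R * z.1 : R).
        by apply: measurable_funM => //; exact: measurable_fst.
      exact: mm.
    apply/seteqP; split => x /=; rewrite in_itv/=.
      by move=> <-; exact: floor_itv.
    by move=> h; exact: floor_def.
  have [mX _] := mollified_flow_preserves (clamp_itv (p n k)) d0 kern.
  exact: (measurableT_comp mX measurable_snd).
move=> [s x] /=; apply/cvgrPdist_le => e e0.
have M1 : 0 < M + 1 by rewrite ltr_wpDl.
have e1 : 0 < e / (M + 1) by rewrite divr_gt0.
have /cvgrPdist_le/(_ _ e1) := @cvg_harmonic R.
apply: filterS => n; rewrite sub0r normrN ger0_norm ?harmonic_ge0// => he.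
rewrite sub0r (normrN (torus_dist _ _)) ger0_norm ?torus_dist_ge0//.
rewrite (le_trans (mollified_flow_lipschitz _ (clamp_itv _) (clamp_itv _)))//.
rewrite (le_trans (ler_wpM2l M0 (clamp_lipschitz _ _)))//.
apply: (@le_trans _ _ ((M + 1) * (e / (M + 1)))); last by rewrite mulrC divfK// gt_eqF.
apply: ler_pM; rewrite ?lerDl//; apply: le_trans he.
have /andP[h1 h2] := floor_itv (n.+1%:R * s); rewrite -/(q n s) in h1 h2.
have n0 : 0 < n.+1%:R :> R by [].
have -> : p n (q n s) - s = (n.+1%:R)^-1 * ((q n s)%:~R - n.+1%:R * s).
  by rewrite mulrBr mulKf ?gt_eqF// mulrC.
rewrite normrM gtr0_norm ?invr_gt0// /harmonic ler_piMr ?invr_ge0//.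
rewrite ler0_norm ?subr_le0// opprB lerBlDl ltW//.
by rewrite -[X in _ + X]/(1%:~R) -intrD.
Qed.

End mollified_flow.

(** * Passage to the limit *)

Section almost_everywhere_convergence.

(** The series of the [h k] has a finite integral, so it converges almost everywhere and its terms
    tend to 0. *)
Lemma summable_ae_cvg0 d (T : measurableType d) (R : realType)
    (m : {measure set T -> \bar R}) (D : set T) (h : nat -> T -> R) :
  measurable D -> (forall k, measurable_fun D (h k)) -> (forall k x, 0 <= h k x) ->
  (forall k, (\int[m]_(x in D) (h k x)%:E <= (2^-1 ^+ k)%:E)%E) ->
  {ae m, forall x, D x -> h k x @[k --> \oo] --> (0 : R)}.
Proof.
move=> mD mh h0 hk.
have mhE k : measurable_fun D (fun x => (h k x)%:E) by exact/measurable_EFinP.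
have h0E k x : D x -> (0 <= (h k x)%:E)%E by rewrite lee_fin.
pose H x := (\sum_(k <oo) (h k x)%:E)%E.
have mH : measurable_fun D H by apply: ge0_emeasurable_sum => //= k x Dx _; exact: h0E.
have H0 x : (0 <= H x)%E by apply: nneseries_ge0 => k _ _; rewrite lee_fin.
have iH : m.-integrable D H.
  apply/integrableP; split => //; under eq_integral do rewrite gee0_abs//.
  rewrite integral_nneseries//.
  apply: (@le_lt_trans _ _ (\sum_(k <oo) (2^-1 ^+ k)%:E)%E).
    apply: lee_nneseries => k _; last exact: hk.
    by move=> _; apply: integral_ge0 => x Dx; exact: h0E.
  apply: (@le_lt_trans _ _ 2%:E); last exact: ltry.
  apply: lime_le; first by apply: is_cvg_nneseries => k _ _; rewrite lee_fin exprn_ge0.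
  apply: nearW => n; rewrite sumEFin lee_fin.
  have -> : \sum_(0 <= i < n) 2^-1 ^+ i = 2 - 2 * 2^-1 ^+ n :> R.
    elim: n => [|n IH]; first by rewrite big_geq// expr0 mulr1 subrr.
    by rewrite big_nat_recr//= IH exprS; field.
  by rewrite gerBl mulr_ge0// exprn_ge0.
apply: filterS (integrable_ae mD iH) => x /[apply] Hfin.
apply: cvg_series_cvg_0; apply: nondecreasing_is_cvgn.
  by apply: nondecreasing_series => k _ _; exact: h0.
exists (fine (H x)) => _ [n _ <-].
rewrite -lee_fin fineK// -sumEFin; apply: nneseries_lim_ge => k _ _.
by rewrite lee_fin.
Qed.

Lemma null_sections d1 d2 (T1 : measurableType d1) (T2 : measurableType d2)
    (R : realType) (m1 : {sigma_finite_measure set T1 -> \bar R})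
    (m2 : {sigma_finite_measure set T2 -> \bar R}) (N : set (T1 * T2)) :
  measurable N -> ((m1 \x m2) N = 0)%E ->
  {ae m2, forall y, m1 [set x | N (x, y)] = 0%E}.
Proof.
move=> mN N0.
have mI : measurable_fun setT (fun z : T1 * T2 => (\1_N z)%:E : \bar R).
  by apply/measurable_EFinP; exact: measurable_indic.
have I0 (z : T1 * T2) : (0 <= (\1_N z)%:E :> \bar R)%E by rewrite lee_fin.
have := fubini_tonelli2 (m1 := m1) (m2 := m2) _ mI I0.
rewrite integral_indic// setIT [LHS]N0 => /esym H.
have GE y : fubini_G m1 (fun z => (\1_N z)%:E) y = (m1 \o ysection N) y.
  rewrite /fubini_G /= -(setIT (ysection N y)) -integral_indic//.
    apply: eq_integral => x _; rewrite !indicE; congr ((nat_of_bool _)%:R%:E).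
    by rewrite mem_ysection.
  exact: measurable_ysection.
have {}H : (\int[m2]_y (m1 \o ysection N) y = 0)%E.
  by rewrite -H; apply: eq_integral => y _; rewrite GE.
have mY := measurable_fun_ysection m1 mN.
have /ae_eq_integral_abs := mY.
move=> /(_ m2 measurableT)[+ _].
under eq_integral do rewrite gee0_abs//.
move=> /(_ H); apply: filterS => y /(_ I) /= <-.
by congr (m1 _); apply/seteqP; split => x /=; rewrite ysectionE.
Qed.

End almost_everywhere_convergence.

Section limit_of_characteristics.

Lemma Rintegral_dominated d0 (S : measurableType d0) (R : realType)
    (m : {measure set S -> \bar R}) (D : set S) (h_ : nat -> S -> R) (h : S -> R) (B : R) :
  measurable D -> (m D < +oo)%E -> (forall k, measurable_fun D (h_ k)) ->
  (forall k s, D s -> `|h_ k s| <= B) ->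
  (forall s, D s -> h_ k s @[k --> \oo] --> h s) ->
  m.-integrable D (EFin \o h) /\
  \int[m]_(s in D) h_ k s @[k --> \oo] --> \int[m]_(s in D) h s.
Proof.
move=> mD Doo mh hB hcvg.
have mhE k : measurable_fun D (EFin \o h_ k) by exact/measurable_EFinP.
have cE s : D s -> (EFin \o h_ k) s @[k --> \oo] --> (EFin \o h) s.
  by move=> Ds; apply/cvg_EFin; [exact: nearW|exact: hcvg].
have mhl : measurable_fun D (EFin \o h) by exact: (emeasurable_fun_cvg _ _ mhE cE).
have [ih _ ch] := @dominated_convergence _ _ _ m D mD (fun k => EFin \o h_ k) (EFin \o h)
  (cst B%:E) mhE mhl (aeW _ cE) (integrable_cst_fin B mD Doo)
  (aeW _ (fun s k Ds => hB k s Ds)).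
split=> //; apply: fine_cvg; rewrite fineK//.
exact: integrable_fin_num.
Qed.

(** On [N] nothing is known of [h], which may fail to be measurable on [D]; the limit is therefore
    an integral over the complement of [N] in [D]. *)
Lemma Rintegral_dominated_null d0 (S : measurableType d0) (R : realType)
    (m : {measure set S -> \bar R}) (D N : set S) (h_ : nat -> S -> R) (h : S -> R) (B : R) :
  measurable D -> (m D < +oo)%E -> measurable N -> m N = 0%E ->
  (forall k, m.-integrable D (EFin \o h_ k)) ->
  (forall k s, D s -> `|h_ k s| <= B) ->
  (forall s, D s -> ~ N s -> h_ k s @[k --> \oo] --> h s) ->
  \int[m]_(s in D) h_ k s @[k --> \oo] --> \int[m]_(s in D `\` N) h s.
Proof.
move=> mD Doo mN N0 ih hB hcvg.
have mDN : measurable (D `\` N) by exact: measurableD.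
have E k : \int[m]_(s in D) h_ k s = \int[m]_(s in D `\` N) h_ k s.
  by rewrite /Rintegral (negligible_integral mN mD (ih k) N0).
under eq_fun do rewrite E.
apply: (proj2 (@Rintegral_dominated _ _ _ m (D `\` N) h_ h B mDN _ _ _ _)).
- apply: le_lt_trans Doo; apply: le_measure; rewrite ?inE//; exact: subDsetl.
- move=> k; have /measurable_int := ih k => /measurable_EFinP.
  by apply: measurable_funS => //; exact: subDsetl.
- by move=> k s [Ds _]; exact: hB.
- by move=> s [Ds Ns]; exact: hcvg.
Qed.

Variables (R : realType) (d : nat).
Local Notation torus := (torus R d).
Local Notation pi := (@tproj R d).
Local Notation mu := (@completed_lebesgue_measure R).
Variables (T M : R) (T0 : 0 < T) (u : R -> torus -> 'rV[R]_d).
Hypothesis u_reg : regular_field T M u.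
Variables (rho_ : nat -> torus -> R) (r_ : nat -> R).
Hypothesis kernels : forall k, smooth_kernel (rho_ k) (r_ k).
Hypothesis radii : r_ k @[k --> \oo] --> 0.
Variables (x : torus) (gamma_ : nat -> R -> torus).
Let V k (t : R) := torus_conv (u t) (rho_ k).
Hypothesis chars : forall k, characteristic T (V k) x (gamma_ k).

Lemma mollified_velocity_cvg (s : R) (z_ : nat -> torus) (y : torus) i : 0 <= s <= T ->
  torus_dist (z_ k) y @[k --> \oo] --> 0 ->
  V k s (z_ k) ord0 i @[k --> \oo] --> u s y ord0 i.
Proof.
move=> sT zy; have [bu uu _] := u_reg; apply/cvgrPdist_le => e e0.
have e2 : 0 < e / 2 by rewrite divr_gt0.
have [r r0 hr] := uu s sT _ e2.
have /cvgrPdist_lt/(_ _ r0) n1 := zy; have /cvgrPdist_lt/(_ _ r0) n2 := radii.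
near=> k.
have zk : torus_dist (z_ k) y < r.
  rewrite -[ltLHS]ger0_norm ?torus_dist_ge0// -normrN -sub0r; near: k; exact: n1.
have rk : r_ k < r.
  rewrite (le_lt_trans (ler_norm _))// -normrN -sub0r; near: k; exact: n2.
rewrite distrC -rVBE (le_trans (rV_coord_le _ _))//.
rewrite -(subrKA (u s (z_ k))) (le_trans (ler_normD _ _))// (splitr e) lerD//; last exact: hr.
apply: (torus_conv_near (kernels k) (bu s sT)); first exact: ltW.
by move=> w wz; apply: hr; rewrite torus_distC (lt_trans wz).
Unshelve. all: end_near. Qed.

(* Dominated convergence is used twice: almost everywhere convergence to [phi]
   makes the integrals of the velocities converge at every time, which defines
   [gamma]; convergence to [gamma] at every time then identifies their limits. *)
Lemma characteristics_limit (phi : R -> torus) :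
  {ae (@lebesgue_measure R), forall s, 0 <= s <= T ->
    torus_dist (gamma_ k s) (phi s) @[k --> \oo] --> 0} ->
  exists gamma, characteristic T u x gamma /\
    forall t, 0 <= t <= T -> torus_dist (gamma_ k t) (gamma t) @[k --> \oo] --> 0.
Proof.
move=> [N [mN N0 hN]]; have [bu _ _] := u_reg.
have mNc := measurable_completed mN; have N0c : mu N = 0%E := N0.
have Vle k s y i : 0 <= s <= T -> `|V k s y ord0 i| <= M.
  by move=> sT; rewrite (le_trans (rV_coord_le _ _))//; exact: (torus_conv_le (kernels k) _ (bu s sT)).
have mI (t : R) := measurable_completed_itv `[0, t].
have Ioo (t : R) : 0 <= t -> (mu `[0%R, t] < +oo)%E.
  by move=> t0; have [_ ->] := completed_itvE t0; rewrite ltry.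
have sub (t s : R) : t <= T -> `[0, t]%classic s -> 0 <= s <= T.
  by move=> tT; rewrite /= in_itv/= => /andP[-> st]; exact: le_trans tT.
have fi k i t : t <= T -> mu.-integrable `[0, t] (EFin \o (fun s => V k s (gamma_ k s) ord0 i)).
  move=> tT; apply: (characteristic_integrable i (chars k)) => // s /(sub _ _ tT).
  by rewrite /= in_itv.
pose w t i := \int[mu]_(s in `[0, t] `\` N) u s (phi s) ord0 i.
have wP t i : 0 <= t <= T ->
    \int[mu]_(s in `[0, t]) V k s (gamma_ k s) ord0 i @[k --> \oo] --> w t i.
  move=> /andP[t0 tT]; apply: (@Rintegral_dominated_null _ _ _ mu _ N _ _ M) => //.
  - exact: Ioo.
  - by move=> k; exact: fi.
  - by move=> k s /(sub _ _ tT); exact: Vle.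
  move=> s /(sub _ _ tT) sT Ns; apply: mollified_velocity_cvg => //.
  by apply: contrapT => h; apply: Ns; apply: hN => /= /(_ sT).
have [gamma gammaE] : exists gamma, forall t, gamma t = x + pi (\row_i w t i).
  by exists (fun t => x + pi (\row_i w t i)).
have gP t : 0 <= t <= T -> torus_dist (gamma_ k t) (gamma t) @[k --> \oo] --> 0.
  move=> tT; apply/cvgrPdist_le => e e0.
  have H : \forall k \near \oo, forall i, `|w t i -
      \int[mu]_(s in `[0, t]) V k s (gamma_ k s) ord0 i| <= e.
    apply: filter_forall => i.
    by have /cvgrPdist_le/(_ _ e0) := wP t i tT.
  apply: filterS H => k Hk.
  rewrite sub0r (normrN (torus_dist _ _)) ger0_norm ?torus_dist_ge0//.
  have [_ ->//] := chars k.
  rewrite gammaE (le_trans (torus_dist_addr _ _ _))//; apply: rV_norm_le; first exact: ltW.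
  by move=> i; rewrite rVBE !mxE distrC.
have vc s i : 0 <= s <= T -> V k s (gamma_ k s) ord0 i @[k --> \oo] --> u s (gamma s) ord0 i.
  by move=> sT; apply: mollified_velocity_cvg => //; exact: gP.
exists gamma; split=> //.
have lim t i : 0 <= t <= T ->
    mu.-integrable `[0, t] (EFin \o (fun s => u s (gamma s) ord0 i)) /\
    \int[mu]_(s in `[0, t]) V k s (gamma_ k s) ord0 i @[k --> \oo] -->
      \int[mu]_(s in `[0, t]) u s (gamma s) ord0 i.
  move=> /andP[t0 tT]; apply: (@Rintegral_dominated _ _ _ mu _
    (fun k s => V k s (gamma_ k s) ord0 i) (fun s => u s (gamma s) ord0 i) M).
  - exact: mI.
  - exact: Ioo.
  - by move=> k; have /measurable_int/measurable_EFinP := fi k i t tT.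
  - by move=> k s /(sub _ _ tT); exact: Vle.
  - by move=> s /(sub _ _ tT) sT; exact: vc.
split=> [i|t tT].
  by have [] := lim T i; rewrite ?lexx ?ltW.
rewrite gammaE; congr (_ + pi _); apply/rowP => i; rewrite !mxE.
by apply: (cvg_unique _ (wP t i tT) (lim t i tT).2).
Qed.

End limit_of_characteristics.

(** * From a convergent sequence of flows to a selection *)

Section selection.
Variables (R : realType) (d : nat).
Local Notation torus := (torus R d).
Local Notation L := (lebesgue_torus R d).
Variables (T M : R) (T0 : 0 < T) (u : R -> torus -> 'rV[R]_d).
Hypothesis u_reg : regular_field T M u.
Hypothesis u_div : forall t : R, 0 <= t <= T -> weakly_divergence_free (u t).
Hypothesis d0 : (0 < d)%N.
Variables (rho_ : nat -> torus -> R) (r_ : nat -> R).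
Hypothesis kernels : forall k, smooth_kernel (rho_ k) (r_ k).
Hypothesis radii : r_ k @[k --> \oo] --> 0.
Hypothesis r_gt0 : forall k, 0 < r_ k.
Variable X_ : nat -> R -> torus -> torus.
Hypothesis X_flow : forall k x,
  characteristic T (fun t => torus_conv (u t) (rho_ k)) x (fun t => X_ k t x).

Let kern (e : R) : 0 < e -> exists sigma : torus -> R, smooth_kernel sigma e.
Proof.
move=> e0; have /cvgrPdist_lt/(_ _ e0)[k _ /(_ k (leqnn k))] := radii.
rewrite sub0r normrN gtr0_norm// => rk; exists (rho_ k).
have [h1 h2 h3 h4] := kernels k; split=> // y /h4 hy; exact: lt_trans rk.
Qed.

Lemma selection_of_pointwise_limit :
  {ae L, forall x, exists gamma, characteristic T u x gamma /\
    forall t, 0 <= t <= T -> torus_dist (X_ k t x) (gamma t) @[k --> \oo] --> 0} ->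
  exists Y, measure_preserving_selection T u Y.
Proof.
move=> [N [mN N0 hN]].
(* On the null set the curves are made constant, so that at each time [Y] is an everywhere limit of
   measurable maps. *)
have /choice[Y hY] : forall x, exists gamma : R -> torus,
    (~ N x -> characteristic T u x gamma /\
      forall t, 0 <= t <= T -> torus_dist (X_ k t x) (gamma t) @[k --> \oo] --> 0) /\
    (N x -> gamma = fun=> x).
  move=> x; have [Nx|Nx] := pselect (N x); first by exists (fun=> x).
  have [gamma hg] : exists gamma, characteristic T u x gamma /\
      forall t, 0 <= t <= T -> torus_dist (X_ k t x) (gamma t) @[k --> \oo] --> 0.
    by apply: contrapT => h; apply: Nx; exact: hN.
  by exists gamma; split.
exists (fun t x => Y x t).
have pres k (t : R) (tT : 0 <= t <= T) := mollified_flow_preserves T0 u_reg u_div (kernels k) (X_flow k) tT d0 kern.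
have mY t : 0 <= t <= T -> measurable_fun setT (fun x => Y x t).
  move=> tT; apply: (@measurable_fun_torus_cvg _ _ _ _
    (fun k x => if x \in N then x else X_ k t x)).
    move=> k; apply: (measurable_fun_pieces (q := fun x => x \in N)
      (F := fun b x => if b then x else X_ k t x)) => -[].
    - by rewrite (_ : _ @^-1` _ = N)//; apply/seteqP; split => x /= h; [exact: set_mem|exact: mem_set].
    - rewrite (_ : _ @^-1` _ = ~` N); first exact: measurableC.
      by apply/seteqP; split => x /=; [move=> /negbT; rewrite notin_setE|move=> h; rewrite memNset].
    - exact: measurable_id.
    - by have [] := pres k t tT.
  move=> x; have [Nx|Nx] := boolP (x \in N).
    have [_ ->] := hY x; last by rewrite inE in Nx.
    by under eq_fun do rewrite torus_distxx; exact: cvg_cst.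
  have Nx' : ~ N x by move=> h; rewrite mem_set in Nx.
  by have [/(_ Nx')[_ hc] _] := hY x; exact: hc.
have ccompl (psi : torus -> R) (C : R) t : 0 <= t <= T -> torus_lipschitz C psi ->
    (forall x, 0 <= psi x <= 1) -> \int[L]_x psi (Y x t) = \int[L]_x psi x.
  move=> tT lpsi psi01.
  have psi1 x : `|psi x| <= 1 by have /andP[? ?] := psi01 x; rewrite ger0_norm.
  have mpsi : measurable_fun setT psi.
    by apply: measurable_torus_continuous; exact: torus_lipschitz_continuous lpsi.
  have bp : bounded_measurable psi by split=> //; exists 1.
  have H : \int[L]_x psi (X_ k t x) @[k --> \oo] --> \int[L]_(x in setT `\` N) psi (Y x t).
    apply: (@Rintegral_dominated_null _ _ _ L _ N _ (fun x => psi (Y x t)) 1) => //.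
    - by rewrite /= probability_setT ltry.
    - move=> k; apply: bounded_measurable_integrable.
      by apply: (bounded_measurable_comp bp); have [] := pres k t tT.
    move=> x _ Nx; have [/(_ Nx)[_ hc] _] := hY x.
    apply/cvgrPdist_le => e e0; have C1 : 0 < `|C| + 1 by rewrite ltr_wpDl.
    have e1 : 0 < e / (`|C| + 1) by rewrite divr_gt0.
    have /cvgrPdist_le/(_ _ e1) := hc t tT; apply: filterS => k.
    rewrite sub0r (normrN (torus_dist _ _)) ger0_norm ?torus_dist_ge0// => he.
    rewrite (le_trans (lpsi _ _))// torus_distC.
    apply: (@le_trans _ _ ((`|C| + 1) * (e / (`|C| + 1)))); last by rewrite mulrC divfK// gt_eqF.
    rewrite (le_trans (ler_wpM2r (torus_dist_ge0 _ _) (ler_norm _)))//.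
    by apply: ler_pM; rewrite ?torus_dist_ge0 ?lerDl.
  have bY : bounded_measurable (fun x : torus => psi (Y x t)).
    by apply: (bounded_measurable_comp bp); exact: mY.
  have -> : \int[L]_x psi (Y x t) = \int[L]_(x in setT `\` N) psi (Y x t).
    rewrite /Rintegral (negligible_integral mN measurableT _ N0)//.
    exact: bounded_measurable_integrable.
  have E k : \int[L]_x psi (X_ k t x) = \int[L]_x psi x.
    by have [_ h] := pres k t tT; exact: h lpsi psi1.
  move: H; under eq_fun do rewrite E.
  by move=> H; apply: (cvg_unique _ H (cvg_cst _)).
split; last first.
  exists N; split=> // x /= hx; apply: contrapT => Nx; apply: hx.
  by have [/(_ Nx)[]] := hY x.
move=> t tT; split.
  move=> _ B mB; rewrite setTI; apply: sub_caratheodory; apply: sub_sigma_algebra.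
  by have := mY t tT measurableT B mB; rewrite setTI.
move=> B mB; have mYB : measurable ((fun x => Y x t) @^-1` B).
  by have := mY t tT measurableT B mB; rewrite setTI.
rewrite /pushforward /completed_lebesgue_torus /completed_measure_extension.
(* On Borel sets the completed measure is the original one, and two finite Borel measures are
   compared through Lipschitz functions. *)
rewrite measurable_mu_extE//.
have := @torus_measure_unique R d
  (measure_function_pushforward__canonical__measure_function_Measure L (mY t tT)) L.
apply => //.
- by rewrite /= /pushforward preimage_setT [ltLHS]probability_setT ltry.
move=> psi C lpsi psi01.
have psi0 x : 0 <= psi x by have /andP[] := psi01 x.
have mpsi : measurable_fun setT psi.
  by apply: measurable_torus_continuous; exact: torus_lipschitz_continuous lpsi.
have psi1 x : `|psi x| <= 1 by have /andP[? ?] := psi01 x; rewrite ger0_norm.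
have bp : bounded_measurable psi by split=> //; exists 1.
have bY : bounded_measurable (fun x : torus => psi (Y x t)).
  by apply: (bounded_measurable_comp bp); exact: mY.
have := @ge0_integral_pushforward _ _ _ _ R _ (mY t tT) L setT (EFin \o psi)
  measurableT _ _.
rewrite preimage_setT => ->; last 2 first.
- exact/measurable_EFinP.
- by move=> y _; rewrite lee_fin.
have := ccompl psi C t tT lpsi psi01; rewrite /Rintegral => H.
rewrite -[LHS]fineK; last exact: integrable_fin_num (bounded_measurable_integrable L bY).
rewrite -[RHS]fineK; last exact: integrable_fin_num (bounded_measurable_integrable L bp).
by congr _%:E.
Qed.

(** The distances are summable, so convergence holds almost everywhere in time and space. By
    Tonelli, for almost every [x] it holds at almost every time, with limit curve the section of [f]
    at [x]. *)
Lemma selection_of_L1_limit (f : L1_maps R d T) (g_ : nat -> L1_maps R d T) :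
  (forall k t x, 0 <= t <= T -> g_ k (t, x) = X_ k t x) ->
  (forall k, (L1_dist f (g_ k) <= (2^-1 ^+ k)%:E)%E) ->
  exists Y, measure_preserving_selection T u Y.
Proof.
move=> gX fg; apply: selection_of_pointwise_limit.
pose D : set (measurableTypeR R * torus) := `[0, T] `*` setT.
have mD : measurable D by exact: measurableX.
have [N [mN N0 hN]] := @summable_ae_cvg0 _ _ R
  (@lebesgue_measure R \x lebesgue_torus R d)%E D
  (fun k z => torus_dist (f z) (g_ k z)) mD
  (fun k => measurable_funTS (measurable_torus_dist (@measurable_funPT _ _ _ _ f)
     (@measurable_funPT _ _ _ _ (g_ k))))
  (fun k z => torus_dist_ge0 _ _) fg.
have := null_sections mN N0.
apply: filterS => x Nx; apply: (characteristics_limit T0 u_reg kernels radii (X_flow^~ x)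
  (phi := fun s => f (s, x))).
exists [set s | N (s, x)]; split=> //.
  by have := measurable_ysection x mN; rewrite ysectionE.
move=> s /= hs; apply: hN => /= hz; apply: hs => sT.
have : D (s, x) by split => //=; rewrite in_itv.
move=> /hz; apply: cvg_trans; apply: near_eq_cvg; apply: nearW => k.
by rewrite gX// torus_distC.
Qed.

End selection.

(** [f] is a cluster point of the sequence in the compact closure of [A]: every tail of the sequence
    meets every ball around it. *)
Lemma precompact_cluster_sequence (R : realType) (d : nat) (T : R)
    (A : set (L1_maps R d T)) (a : nat -> L1_maps R d T) :
  precompact A -> (forall n, A (a n)) ->
  exists f, forall (e : R) N, 0 < e -> exists2 n, (N <= n)%N & (L1_dist f (a n) < e%:E)%E.
Proof.
rewrite precompactE => cA Aa.
have clA : (a @ \oo) (closure A).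
  by exists 0%N => // n _; exact: subset_closure.
have [f [_ cf]] := cA (a @ \oo) _ clA.
exists f => e N e0.
have nb : nbhs f (L1_ball f e) by exact: (nbhsx_ballx f e e0).
have an : (a @ \oo) [set a n | n in [set n | (N <= n)%N]].
  by exists N => // n /= Nn; exists n.
by have [_ [[n Nn <-] h]] := cf _ _ an nb; exists n.
Qed.

Unset Implicit Arguments.

Theorem corollary1p3 (R : realType) (d : nat) (T : R) (k : nat) (alpha : R)
    (u : R -> torus R d -> 'rV[R]_d) (chi : 'rV[R]_d -> R)
    (X : R -> R -> torus R d -> torus R d)
    (d_ge2 : (2 <= d)%N) (T_gt0 : 0 < T) (alpha01 : 0 < alpha < 1)
    (u_reg : Ck_holder k alpha T u)
    (u_div : forall t : R, 0 <= t <= T -> weakly_divergence_free (u t))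
    (u_noselection : ~ exists Y, measure_preserving_selection T u Y)
    (chi_mollifier : mollifier chi)
    (X_flow : forall delta : R, 0 < delta < 1 -> forall x : torus R d,
       characteristic T (fun t => torus_conv (u t) (torus_mollifier chi delta)) x
         (fun t => X delta t x)) :
  ~ precompact [set f : L1_maps R d T | exists2 delta : R, 0 < delta < 1 &
      forall (t : R) (x : torus R d), 0 <= t <= T -> f (t, x) = X delta t x].
Proof.
move=> cA; apply: u_noselection; have /andP[alpha0 _] := alpha01.
have [M uM] := Ck_holder_regular alpha0 u_reg.
have d0 : (0 < d)%N by exact: ltnW.
have [C C0 kern] := mollifier_kernel chi_mollifier.
(* Starting at 1/2 keeps every scale strictly below 1. *)
pose delta (n : nat) : R := n.+2%:R^-1.
have delta01 n : 0 < delta n < 1 by rewrite invr_gt0 ltr0n/= invf_lt1 ?ltr0n// ltr1n.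
have delta0 n : 0 < delta n by have /andP[] := delta01 n.
have dcvg : delta n @[n --> \oo] --> 0.
  apply/cvgrPdist_lt => e e0; have /cvgrPdist_lt/(_ _ e0) := @cvg_harmonic R.
  apply: filterS => n; rewrite !sub0r !normrN gtr0_norm ?harmonic_gt0// gtr0_norm//.
  by apply: le_lt_trans; rewrite /harmonic lef_pV2 ?posrE ?ltr0n// ler_nat.
(* Kernels of arbitrarily small support, needed to smooth the test functions for each fixed flow. *)
have small (e : R) : 0 < e -> exists sigma : torus R d -> R, smooth_kernel sigma e.
  move=> e0; have eC : 0 < e / C by rewrite divr_gt0.
  have /cvgrPdist_lt/(_ _ eC)[n _ /(_ n (leqnn n))] := dcvg.
  rewrite sub0r normrN gtr0_norm// ltr_pdivlMr// mulrC => h.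
  have [h1 h2 h3 h4] := kern _ (delta01 n).
  by exists (torus_mollifier chi (delta n)); split=> // y /h4 hy; exact: lt_trans h.
have mX n := measurable_mollified_flow T_gt0 uM u_div (kern _ (delta01 n))
  (X_flow _ (delta01 n)) d0 small.
pose a n : L1_maps R d T := MeasurableFun.Pack (MeasurableFun.Class
  (isMeasurableFun.Build _ _ _ _ _ (mX n))).
have aX n t x : 0 <= t <= T -> a n (t, x) = X (delta n) t x.
  by move=> tT; rewrite /a /= clamp_id.
have [f hf] := precompact_cluster_sequence cA
  (fun n => ex_intro2 _ _ (delta n) (delta01 n) (aX n)).
(* The rate [2^-1 ^+ j] makes the distances summable; [j <= n] makes the mollification scales tend
   to 0 along the extracted sequence. *)
have /choice[n_ hn] : forall j : nat, exists n, (j <= n)%N /\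
    (L1_dist f (a n) <= (2^-1 ^+ j)%:E)%E.
  move=> j; have e0 : 0 < 2^-1 ^+ j :> R by rewrite exprn_gt0// invr_gt0.
  by have [n jn /ltW h] := hf _ j e0; exists n.
apply: (selection_of_L1_limit T_gt0 uM u_div d0 (fun j => kern _ (delta01 (n_ j))) _ _
  (fun j => X_flow _ (delta01 (n_ j))) (f := f) (g_ := fun j => a (n_ j))).
- apply/cvgrPdist_le => e e0; have eC : 0 < e / C by rewrite divr_gt0.
  have /cvgrPdist_le/(_ _ eC) := dcvg.
  move=> [N _ hN]; exists N => // j /= Nj.
  rewrite sub0r normrN gtr0_norm ?mulr_gt0// mulrC -ler_pdivlMr//.
  have /= := hN (n_ j) (leq_trans Nj (hn j).1).
  by rewrite sub0r normrN gtr0_norm.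
- by move=> j; rewrite mulr_gt0.
- by move=> j t x; exact: aX.
- by move=> j; have [] := hn j.
Qed.
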